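(* Suppose that $\langle\mathbf{x};\mathbf{r},\mathbf{s}\rangle$ is a $C'(1/6)$ small cancellation presentation. Let $G$ be the group given by the sub-presentation $\langle\mathbf{x};\mathbf{r}\rangle$, and let $\varphi:F(\mathbf{x})\to G$ be the natural map. Suppose that $\mathbf{t}\subset F(\mathbf{x})$ is a set of words such that every non-empty word over $\mathbf{t}^{\pm1}$ which is freely reduced over $\mathbf{t}$ is cyclically $\mathbf{r}^{\ast}$-reduced. Then for all $U\in\langle\mathbf{s}\rangle\leq F(\mathbf{x})$ and $V\in\langle\mathbf{t}\rangle\leq F(\mathbf{x})$, if there exists $g\in G$ such that $g^{-1}\varphi(U)g=\varphi(V)$ in $G$ then there exists $W\in F(\mathbf{x})$ such that $\varphi(W)=g$ and $W^{-1}UW=V$ in $F(\mathbf{x})$. In particular, there exists $g\in G$ such that $\langle\mathbf{s}\rangle_G^{g}\cap\langle\mathbf{t}\rangle_G\neq 1$ in $G$ if and only if there exists $W\in F(\mathbf{x})$ such that $\langle\mathbf{s}\rangle^{W}\cap\langle\mathbf{t}\rangle\neq 1$ in $F(\mathbf{x})$.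
   Context: All presentations are countable. $\langle\mathbf{s}\rangle_G=\varphi(\langle\mathbf{s}\rangle)$ denotes the subgroup of $G$ generated by the words $\mathbf{s}$, and $A^g=g^{-1}Ag$. For a set $\mathbf{u}$ of non-trivial cyclically reduced words in $F(\mathbf{x})$, $\mathbf{u}^{\ast}$ denotes its symmetrised closure: all cyclic shifts of elements of $\mathbf{u}$ and of their inverses. A piece is a non-empty word which is a common initial segment of two distinct elements of $\mathbf{u}^{\ast}$. $C'(\lambda)$: if $R\in\mathbf{u}^{\ast}$ has an initial segment $P$ which is a piece then $|P|<\lambda|R|$. The presentation $\langle\mathbf{x};\mathbf{r},\mathbf{s}\rangle$ is $C'(\lambda)$ when $\mathbf{u}=\mathbf{r}\cup\mathbf{s}$ is. By convention relators are listed without redundancy: $\mathbf{r}\cap\mathbf{s}=\emptyset$ and no element of $\mathbf{r}\cup\mathbf{s}$ is a cyclic shift of another element of $\mathbf{r}\cup\mathbf{s}$ or of the inverse of another element. A word $U$ in $\mathbf{x}^{\pm1}$ is $\mathbf{r}^{\ast}$-reduced if it is freely reduced and has no subword $W$ such that $W$ is a subword of some $R\in\mathbf{r}^{\ast}$ with $|W|>\frac12|R|$. A word $U$ (not necessarily reduced) is cyclically $\mathbf{r}^{\ast}$-reduced if the free reduction (over $\mathbf{x}$) of every cyclic shift of $U$ is non-empty and $\mathbf{r}^{\ast}$-reduced. A word over $\mathbf{t}^{\pm1}$ is freely reduced over $\mathbf{t}$ if it contains no subword $TT^{-1}$ or $T^{-1}T$ with $T\in\mathbf{t}$, when regarded as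 a formal word in the symbols $\mathbf{t}^{\pm1}$; it is regarded as a word over $\mathbf{x}^{\pm1}$ by substitution. *)

(* Defs.v *)
From HB Require Import structures.
From mathcomp Require Import all_boot all_order all_algebra.
From mathcomp Require Import boolp classical_sets.

Set Implicit Arguments.
Unset Strict Implicit.
Unset Printing Implicit Defensive.

Local Open Scope classical_set_scope.
Local Open Scope group_scope.

(* The letter (x, true) stands for x and (x, false) for the inverse of x.     *)
Notation word X := (seq (X * bool)).

Section Words.
Variable X : eqType.
Implicit Types (a b : X * bool) (u v w : word X).

Definition linv a : X * bool := (a.1, ~~ a.2).

Definition winv w : word X := rev (map linv w).

Definition noncancel : rel (X * bool) := fun a b => b != linv a.

Definition reduced w : bool := sorted noncancel w.

(* No two cyclically adjacent letters cancel; in particular the empty word is *)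
(* cyclically reduced.                                                        *)
Definition cyclically_reduced w : bool := cycle noncancel w.

Definition cons_red a w : word X :=
  if w is b :: w' then (if b == linv a then w' else a :: w) else [:: a].

Definition free_reduction w : word X := foldr cons_red [::] w.

Lemma linvK : involutive linv.
Proof. by case=> x b; rewrite /linv /= negbK. Qed.

Lemma cons_red_reduced a w : reduced w -> reduced (cons_red a w).
Proof.
rewrite /reduced; case: w => [//|b w] /= pw.
case: ifP => [_|nba]; first exact: path_sorted pw.
by rewrite /= /noncancel nba.
Qed.

Lemma foldr_cons_red_reduced u w : reduced w -> reduced (foldr cons_red w u).
Proof. by move=> rw; elim: u => //= a u /cons_red_reduced. Qed.

Lemma free_reduction_reduced w : reduced (free_reduction w).
Proof. exact: foldr_cons_red_reduced. Qed.

Lemma free_reduction_id w : reduced w -> free_reduction w = w.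
Proof.
elim: w => //= a w IHw pw; rewrite IHw; last exact: path_sorted pw.
by case: w pw {IHw} => //= b w /andP[/negbTE-> _].
Qed.

Lemma cons_redK a w : reduced w -> cons_red a (cons_red (linv a) w) = w.
Proof.
case: w => [|b w] /=; first by rewrite eqxx.
rewrite linvK; case: eqP => [-> pw|_ _ /=]; last by rewrite eqxx.
by case: w pw => //= c w /andP[/negbTE-> _].
Qed.

Lemma foldr_cons_red u w :
  reduced w -> foldr cons_red w (free_reduction u) = foldr cons_red w u.
Proof.
move=> rw; elim: u => //= a u <-.
have: reduced (free_reduction u) by exact: free_reduction_reduced.
case: (free_reduction u) => [//|b v] /= _.
case: eqP => [->|//]; rewrite cons_redK //.
exact: foldr_cons_red_reduced.
Qed.

Lemma free_reduction_cat u v :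
  free_reduction (u ++ v) = foldr cons_red (free_reduction v) u.
Proof. exact: foldr_cat. Qed.

Lemma free_reduction_catl u v :
  free_reduction (free_reduction u ++ v) = free_reduction (u ++ v).
Proof.
by rewrite !free_reduction_cat foldr_cons_red ?free_reduction_reduced.
Qed.

Lemma free_reduction_catr u v :
  free_reduction (u ++ free_reduction v) = free_reduction (u ++ v).
Proof.
by rewrite !free_reduction_cat free_reduction_id ?free_reduction_reduced.
Qed.

Lemma winvK : involutive winv.
Proof. by move=> w; rewrite /winv map_rev revK mapK //; exact: linvK. Qed.

Lemma free_reduction_winvr w : free_reduction (w ++ winv w) = [::].
Proof.
elim: w => //= a w IHw; rewrite /winv map_cons rev_cons -cats1.
rewrite catA -free_reduction_catl IHw /=.
by rewrite eqxx.
Qed.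

End Words.

(* Elements of the free group are identified with freely reduced words.       *)
Record free_group (X : eqType) := FreeGroup {
  fword :> word X;
  fwordP : reduced fword }.

HB.instance Definition _ (X : eqType) := [isSub for @fword X].
HB.instance Definition _ (X : eqType) := [Equality of free_group X by <:].
HB.instance Definition _ (X : choiceType) := [Choice of free_group X by <:].
HB.instance Definition _ (X : countType) := [Countable of free_group X by <:].

Section FreeGroup.
Variable X : countType.
Implicit Types U V W : free_group X.

Definition class_of_word (w : word X) : free_group X :=
  FreeGroup (free_reduction_reduced w).

Definition fg_one : free_group X := class_of_word [::].
Definition fg_mul U V : free_group X := class_of_word (fword U ++ fword V).
Definition fg_inv U : free_group X := class_of_word (winv U).

Lemma fg_mulA : associative fg_mul.
Proof.
move=> U V W; apply: val_inj => /=.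
by rewrite free_reduction_catl free_reduction_catr catA.
Qed.

Lemma fg_mul1 : left_id fg_one fg_mul.
Proof.
by case=> w rw; apply: val_inj; rewrite /= free_reduction_id.
Qed.

Lemma fg_mulr1 : right_id fg_one fg_mul.
Proof.
by case=> w rw; apply: val_inj; rewrite /= cats0 free_reduction_id.
Qed.

Lemma fg_mulV : left_inverse fg_one fg_inv fg_mul.
Proof.
move=> U; apply: val_inj; rewrite /= free_reduction_catl.
by rewrite -{2}(winvK U) free_reduction_winvr.
Qed.

Lemma fg_mulrV : right_inverse fg_one fg_inv fg_mul.
Proof.
move=> U; apply: val_inj; rewrite /= free_reduction_catr.
exact: free_reduction_winvr.
Qed.

HB.instance Definition _ := isGroup.Build (free_group X)
  fg_mulA fg_mul1 fg_mulr1 fg_mulV fg_mulrV.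

End FreeGroup.

Section Subgroups.
Variable G : groupType.
Implicit Types (A S : set G) (g : G).

Definition generated S : set G :=
  smallest (fun H : set G => group_closed [in H]) S.

Definition normal_closure S : set G :=
  smallest (fun H : set G =>
    group_closed [in H] /\ forall h g, H h -> H (h ^ g)) S.

Definition conjugate_set A g : set G := [set a ^ g | a in A].

Lemma normal_closure1 S : normal_closure S 1.
Proof. by move=> H [[[H1 _] _] _]; apply: set_mem H1. Qed.

Lemma normal_closure_div S a b :
  normal_closure S a -> normal_closure S b -> normal_closure S (a / b).
Proof.
move=> Na Nb H HS; have [[[_ Hdiv] _] _] := HS; apply: set_mem.
by apply: (Hdiv a b); apply: mem_set; [exact: Na|exact: Nb].
Qed.

Lemma normal_closure_conj S a g :
  normal_closure S a -> normal_closure S (a ^ g).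
Proof. by move=> Na H HS; have [[_ HJ] _] := HS; apply: (HJ); exact: Na. Qed.

Lemma normal_closureV S a : normal_closure S a -> normal_closure S a^-1.
Proof.
move=> Na; rewrite -(mul1g a^-1).
exact: normal_closure_div (@normal_closure1 S) Na.
Qed.

Lemma normal_closureM S a b :
  normal_closure S a -> normal_closure S b -> normal_closure S (a * b).
Proof.
move=> Na Nb; rewrite -(invgK b).
exact: normal_closure_div Na (normal_closureV Nb).
Qed.

End Subgroups.

Section Presentation.
Variables (X : countType) (r : set (free_group X)).
Local Notation F := (free_group X).
Local Notation N := (normal_closure r).

Definition equal_mod (U V : F) : bool := `[< N (U^-1 * V) >].

Lemma equal_mod_equiv : equiv_class_of equal_mod.
Proof.
split=> [U|U V|V U W].
- by apply/asboolP; rewrite mulVg; exact: normal_closure1.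
- by apply/asboolP/asboolP => /normal_closureV; rewrite invgM invgK.
- move=> /asboolP NUV /asboolP NVW; apply/asboolP.
  by have := normal_closureM NUV NVW; rewrite mulgA mulgK.
Qed.

Canonical equal_mod_rel : equiv_rel F := EquivRelPack equal_mod_equiv.

(* The group F(X) / N given by the presentation < X ; r >.                    *)
Definition presented_group : Type := {eq_quot equal_mod_rel}%qT.

HB.instance Definition _ := Choice.on presented_group.
HB.instance Definition _ := Quotient.on presented_group.

Definition natural_map (U : F) : presented_group := (\pi_presented_group U)%qT.

Lemma natural_map_surj (g : presented_group) : exists U, natural_map U = g.
Proof. by exists (repr g); rewrite /natural_map reprK. Qed.

Lemma eq_natural_map U V : natural_map U = natural_map V <-> N (U^-1 * V).
Proof.
split=> [/eqP|NUV]; first by rewrite eqmodE => /asboolP.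
by apply/eqP; rewrite eqmodE; apply/asboolP.
Qed.

Lemma repr_natural_map U : N ((repr (natural_map U))^-1 * U).
Proof. by apply/eq_natural_map; rewrite {1}/natural_map reprK. Qed.

Definition pg_mul (g h : presented_group) := natural_map (repr g * repr h).
Definition pg_inv (g : presented_group) := natural_map (repr g)^-1.

Lemma natural_mapM U V :
  natural_map (U * V) = pg_mul (natural_map U) (natural_map V).
Proof.
have := repr_natural_map V; have := repr_natural_map U.
rewrite /pg_mul.
set U' := repr (natural_map U); set V' := repr (natural_map V) => NU NV.
apply/esym/eq_natural_map.
have -> : (U' * V')^-1 * (U * V) = (U'^-1 * U) ^ V' * (V'^-1 * V).
  by rewrite /conjg invgM !mulgA mulgK.
by apply: normal_closureM => //; exact: normal_closure_conj.
Qed.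

Lemma natural_mapV U : natural_map U^-1 = pg_inv (natural_map U).
Proof.
apply/esym/eq_natural_map; have /normal_closureV := repr_natural_map U.
move: (repr _) => U' NU.
rewrite invgK (_ : U' / U = ((U'^-1 * U)^-1) ^ U'^-1).
  exact: normal_closure_conj.
by rewrite /conjg invgM !invgK mulgA mulgA mulgK.
Qed.

Lemma pg_mulA : associative pg_mul.
Proof.
move=> g h k; have [U <-] := natural_map_surj g.
have [V <-] := natural_map_surj h; have [W <-] := natural_map_surj k.
by rewrite -!natural_mapM mulgA.
Qed.

Lemma pg_mul1 : left_id (natural_map 1) pg_mul.
Proof.
by move=> g; have [U <-] := natural_map_surj g; rewrite -natural_mapM mul1g.
Qed.

Lemma pg_mulr1 : right_id (natural_map 1) pg_mul.
Proof.
by move=> g; have [U <-] := natural_map_surj g; rewrite -natural_mapM mulg1.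
Qed.

Lemma pg_mulV : left_inverse (natural_map 1) pg_inv pg_mul.
Proof.
by move=> g; have [U <-] := natural_map_surj g;
   rewrite -natural_mapV -natural_mapM mulVg.
Qed.

Lemma pg_mulrV : right_inverse (natural_map 1) pg_inv pg_mul.
Proof.
by move=> g; have [U <-] := natural_map_surj g;
   rewrite -natural_mapV -natural_mapM mulgV.
Qed.

HB.instance Definition _ := isGroup.Build presented_group
  pg_mulA pg_mul1 pg_mulr1 pg_mulV pg_mulrV.

HB.instance Definition _ :=
  isMultiplicative.Build F presented_group natural_map natural_mapM.

End Presentation.

Section SmallCancellation.
Variable X : countType.
Implicit Types (u r : set (free_group X)) (U W : word X).

Definition nontrivial_cyclically_reduced u : Prop :=
  forall R, u R -> R <> 1 /\ cyclically_reduced R.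

Definition sym_closure u : set (word X) :=
  [set W | exists2 R, u R & exists i, W = rot i R \/ W = rot i (winv R)].

Definition irredundant u : Prop :=
  forall R R', u R -> u R' -> R <> R' ->
    ~ exists i, fword R = rot i R' \/ fword R = rot i (winv R').

Definition piece u (P : word X) : Prop :=
  P <> [::] /\ exists R R', [/\ sym_closure u R, sym_closure u R', R <> R',
    prefix P R & prefix P R'].

Definition metric_small_cancellation (lambda : rat) u : Prop :=
  forall R P, sym_closure u R -> prefix P R -> piece u P ->
    ((size P)%:R < lambda * (size R)%:R)%R.

Definition star_reduced r U : Prop :=
  reduced U /\
  ~ exists W R, [/\ infix W U, sym_closure r R, infix W R &
      (2^-1 * (size R)%:R < (size W)%:R :> rat)%R].

Definition cyclically_star_reduced r U : Prop :=
  forall i, free_reduction (rot i U) <> [::] /\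
            star_reduced r (free_reduction (rot i U)).

End SmallCancellation.

(* A word over t^{+-1}, with the elements of t as formal symbols, is a word   *)
(* T : word (free_group X); its substitution is not freely reduced over X.    *)
Definition substitute (X : countType) (T : word (free_group X)) : word X :=
  flatten [seq if a.2 then fword a.1 else winv a.1 | a <- T].

(* Main.v *)
From mathcomp Require Import all_fingroup zify lra.
Require Import Defs.
From mathcomp Require Import all_boot all_order all_algebra.
From mathcomp Require Import boolp classical_sets.

(** A conjugacy g^-1 phi(U) g = phi(V) says that V^-1 and a conjugate of U
    multiply, together with conjugates of relators from r, to 1 in the free
    group: it is an annular diagram over r with boundary words U and V.  The
    theorem holds because a minimal annular diagram has no cells at all.

    Diagrams are treated algebraically.  A list of faces is null when some
    product of conjugates of its members is trivial ([nullw]).  Every null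
    list of words lifts ([lifting]) to a null list in which each oriented edge
    occurs exactly once, together with its inverse; such a list is a planar
    map, and the usual surgeries become substitutions for one edge
    ([nullw_merge], [nullw_bridge], [mirror_reduce]).  Euler's formula is
    proved by removing the edges one at a time ([euler_inequality]), and
    counting vertices of degree two as flat corners turns it into the
    combinatorial Gauss-Bonnet inequality [curvature]: the number of genuine
    corners is at most 6 (#faces) - 12.

    In a reduced diagram a run of flat corners between two cells spells a
    piece, hence is shorter than a sixth of either boundary.  This gives
    Dehn's algorithm in the form [dehn_bigon]: a word x with no more than half
    of a relator, such that x rho is trivial in G for a subword rho of a
    relator, equals rho^-1 or the rest of that relator.

    For the annulus, V is conjugate to a cyclically reduced word all of whose
    rotations have no more than half of a relator of r, and U to a cyclically
    reduced word u which is a product of more than the middle two thirds of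
    words from s.  The pieces between s and r are short, so a relator of r
    meets u in less than a third of itself ([cyclic_core]).  A cell therefore
    meets the side of V in one interval of at most half of its length, by
    [dehn_bigon] ([annulus_hull]), and its remaining half has corners of total
    weight at least 4 when a contact with u has weight 2.  Every cell spends
    at least 6, which is what [curvature] offers; equality would force u to be
    glued to cells all along, and one segment of u, being more than two thirds
    of a word from s, is too long for that ([annulus_contradiction]).  So a
    reduced annular diagram has no cells, and removing a mirror pair of cells
    changes the conjugator by a product of conjugates of relators only: the
    given g is preserved ([annulus_conjugacy]). *)

Set Implicit Arguments.
Unset Strict Implicit.
Unset Printing Implicit Defensive.

Local Open Scope classical_set_scope.
Local Open Scope group_scope.

(** * Words, evaluation morphisms and null systems *)

Section FreeWords.
Variable X : countType.
Implicit Types (u v w : word X) (a b : X * bool) (g h : free_group X).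

Local Notation fg := (@class_of_word X).

Lemma fg_cat u v : fg (u ++ v) = fg u * fg v.
Proof. by apply: val_inj; rewrite /= free_reduction_catl free_reduction_catr. Qed.

Lemma fg_nil : fg [::] = 1.
Proof. by []. Qed.

Lemma fg_fword g : fg g = g.
Proof. by case: g => w rw; apply: val_inj; rewrite /= free_reduction_id. Qed.

Lemma fword_fg w : reduced w -> fword (fg w) = w.
Proof. exact: free_reduction_id. Qed.

Lemma fg_inj u v : reduced u -> reduced v -> fg u = fg v -> u = v.
Proof. by move=> ru rv uv; rewrite -(fword_fg ru) uv fword_fg. Qed.

Lemma fg_winv w : fg (winv w) = (fg w)^-1.
Proof.
apply/esym/mulg1_eq; rewrite -fg_cat; apply: val_inj.
by rewrite /= free_reduction_winvr.
Qed.

Lemma fg_cancel u a v : fg (u ++ a :: linv a :: v) = fg (u ++ v).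
Proof.
have -> : a :: linv a :: v = ([:: a] ++ winv [:: a]) ++ v by [].
by rewrite !fg_cat fg_winv mulgV mul1g.
Qed.

Lemma winv_cat u v : winv (u ++ v) = winv v ++ winv u.
Proof. by rewrite /winv map_cat rev_cat. Qed.

Lemma winv_cons a v : winv (a :: v) = rcons (winv v) (linv a).
Proof. by rewrite /winv /= rev_cons. Qed.

Lemma winv_rcons v a : winv (rcons v a) = linv a :: winv v.
Proof. by rewrite -cats1 winv_cat. Qed.

Lemma size_winv w : size (winv w) = size w.
Proof. by rewrite size_rev size_map. Qed.

Lemma mem_winv w a : (a \in winv w) = (linv a \in w).
Proof.
rewrite mem_rev -{1}(linvK a) mem_map //; exact: (can_inj (@linvK X)).
Qed.

Lemma linv_inj : injective (@linv X).
Proof. exact: (can_inj (@linvK X)). Qed.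

Lemma linv_neq a : linv a != a.
Proof. by case: a => x b; rewrite /linv xpair_eqE eqxx /=; case: b. Qed.

Lemma linv_eq a b : (linv a == b) = (a == linv b).
Proof. by apply/eqP/eqP => [<-|->]; rewrite linvK. Qed.

Lemma noncancelC a b : noncancel a b = noncancel (linv b) (linv a).
Proof. by rewrite /noncancel linvK eq_sym linv_eq eq_sym. Qed.

Lemma reduced_winv w : reduced (winv w) = reduced w.
Proof.
rewrite /reduced /winv rev_sorted sorted_map.
case: w => //= a w; by apply: eq_path => b c; rewrite /= -noncancelC.
Qed.

Lemma reduced_cat u v : reduced (u ++ v) -> reduced u /\ reduced v.
Proof. by move=> /cat_sorted2[]. Qed.

Lemma reduced_infix u v : infix u v -> reduced v -> reduced u.
Proof. by move=> /infixP[p [q ->]] /reduced_cat[_] /reduced_cat[]. Qed.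

(** Cancellation of one adjacent pair is the only relation between words, so an invariant of
    group elements may be defined on words. *)
Lemma eq_free_reduction (T : Type) (Phi : word X -> T) :
    (forall u a v, Phi (u ++ a :: linv a :: v) = Phi (u ++ v)) ->
  forall w, Phi (free_reduction w) = Phi w.
Proof.
move=> Phi_cancel w; rewrite -[LHS]/(Phi ([::] ++ _)) -[in RHS](cat0s w).
elim: w [::] => //= a w IHw u; rewrite -cat_rcons -IHw cat_rcons.
case: (free_reduction w) => //= b v; case: eqP => // ->.
by rewrite Phi_cancel.
Qed.

Lemma eq_fg (T : Type) (Phi : word X -> T) :
    (forall u a v, Phi (u ++ a :: linv a :: v) = Phi (u ++ v)) ->
  forall u v, fg u = fg v -> Phi u = Phi v.
Proof.
move=> Phi_cancel u v /(congr1 val) /= uv.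
by rewrite -(eq_free_reduction Phi_cancel u) uv eq_free_reduction.
Qed.

Lemma not_reducedP w :
  ~~ reduced w -> exists u a v, w = u ++ a :: linv a :: v.
Proof.
rewrite /reduced; elim: w => // a [//|b w] IHw /=.
rewrite negb_and => /orP[|nr].
  by rewrite negbK => /eqP->; exists [::], a, w.
by have [u [c [v ->]]] := IHw nr; exists (a :: u), c, v.
Qed.

End FreeWords.

Notation fg := (@class_of_word _).

Section Morphisms.
Variables (Y : countType) (H : groupType) (h : Y * bool -> H).
Hypothesis hV : forall a, h (linv a) = (h a)^-1.
Implicit Types (u v w : word Y) (g : free_group Y).

Definition evw w : H := foldr (fun a k => h a * k) 1 w.
Definition evg g : H := evw (fword g).

Lemma evw_cat u v : evw (u ++ v) = evw u * evw v.
Proof. by elim: u => [|a u IHu] /=; rewrite ?mul1g // IHu mulgA. Qed.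

Lemma evg_fg w : evg (fg w) = evw w.
Proof.
rewrite /evg /=; apply: eq_free_reduction => u a v.
by rewrite !evw_cat /= hV mulKVg.
Qed.

Lemma evgM g g' : evg (g * g') = evg g * evg g'.
Proof. by rewrite -[g * g']/(fg (fword g ++ fword g')) evg_fg evw_cat. Qed.

Lemma evg1 : evg 1 = 1.
Proof. by []. Qed.

Lemma evgV g : evg g^-1 = (evg g)^-1.
Proof. by apply/esym/mulg1_eq; rewrite -evgM mulgV evg1. Qed.

Lemma evw_winv w : evw (winv w) = (evw w)^-1.
Proof. by rewrite -!evg_fg fg_winv evgV. Qed.

End Morphisms.

Lemma evw_fg (Y : countType) (w : word Y) : evw (fun a => fg [:: a]) w = fg w.
Proof. by elim: w => //= a w ->; rewrite -fg_cat. Qed.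

Lemma eq_in_evw (Y : countType) (H : groupType) (h k : Y * bool -> H) w :
  {in w, h =1 k} -> evw h w = evw k w.
Proof.
elim: w => //= a w IHw hk; rewrite hk ?mem_head // IHw // => b bw.
by rewrite hk // inE bw orbT.
Qed.

Lemma evw1 (Y : countType) (H : groupType) (h : Y * bool -> H) w :
  {in w, forall a, h a = 1} -> evw h w = 1.
Proof.
elim: w => //= a w IHw hk; rewrite hk ?mem_head // IHw ?mulg1 // => b bw.
by rewrite hk // inE bw orbT.
Qed.

Section NullSystems.

(** The pairs are a conjugator (a path from the base point to a face) and the boundary value
    of that face. *)
Definition bprod (H : groupType) (L : seq (H * H)) : H :=
  foldr (fun pc g => pc.1 * pc.2 * pc.1^-1 * g) 1 L.

Lemma bprod_cat (H : groupType) (L M : seq (H * H)) :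
  bprod (L ++ M) = bprod L * bprod M.
Proof. by elim: L => [|pc L IHL] /=; rewrite ?mul1g // IHL mulgA. Qed.

Lemma bprod_conj (H : groupType) (k : H) (L : seq (H * H)) :
  bprod [seq (k * pc.1, pc.2) | pc <- L] = k * bprod L * k^-1.
Proof.
elim: L => [|pc L IHL] /=; first by rewrite mulg1 mulgV.
by rewrite IHL invgM !mulgA mulgVK.
Qed.

Lemma bprod_morph (H K : groupType) (f : H -> K) (L : seq (H * H)) :
    (forall x y, f (x * y) = f x * f y) -> f 1 = 1 -> (forall x, f x^-1 = (f x)^-1) ->
  f (bprod L) = bprod [seq (f pc.1, f pc.2) | pc <- L].
Proof. by move=> fM f1 fV; elim: L => //= pc L IHL; rewrite !fM IHL fV. Qed.

(** Van Kampen's lemma without pictures: the members of C are the boundary values of the faces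
    of a diagram on the sphere. The conjugators are hidden because only their existence
    matters. *)
Definition nullg (H : groupType) (C : seq H) : Prop :=
  exists2 L, unzip2 L = C & bprod L = 1.

Lemma nullg_perm (H : groupType) (C C' : seq H) :
  perm_eq C C' -> nullg C -> nullg C'.
Proof.
apply: (catCA_perm_ind (P := @nullg H)) => C1 C2 C3 [L eL L1].
pose L1' := take (size C1) L; pose L2 := take (size C2) (drop (size C1) L).
pose L3 := drop (size C2) (drop (size C1) L).
have eL' : L = L1' ++ L2 ++ L3 by rewrite !cat_take_drop.
have [e1 e2 e3] : [/\ unzip2 L1' = C1, unzip2 L2 = C2 & unzip2 L3 = C3].
  rewrite /L1' /L2 /L3 /unzip2 !map_take !map_drop -/(unzip2 L) eL.
  by rewrite take_size_cat // drop_size_cat // take_size_cat // drop_size_cat.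
exists (L2 ++ [seq ((bprod L2)^-1 * pc.1, pc.2) | pc <- L1'] ++ L3).
  by rewrite /unzip2 !map_cat -map_comp -/(unzip2 L2) -/(unzip2 L3) e2 e3 -e1.
by move: L1; rewrite eL' !bprod_cat bprod_conj invgK !mulgA mulgV mul1g.
Qed.

Lemma nullg_morph (H K : groupType) (f : H -> K) (C : seq H) :
    (forall x y, f (x * y) = f x * f y) -> f 1 = 1 -> (forall x, f x^-1 = (f x)^-1) ->
  nullg C -> nullg [seq f c | c <- C].
Proof.
move=> fM f1 fV [L <- L1]; exists [seq (f pc.1, f pc.2) | pc <- L].
  by rewrite /unzip2 -!map_comp.
by rewrite -bprod_morph // L1.
Qed.

Lemma nullg_conj (H : groupType) (c k : H) (C : seq H) :
  nullg (k * c * k^-1 :: C) -> nullg (c :: C).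
Proof.
move=> [[|[p c'] L] //= [-> <-] L1]; exists ((p * k, c) :: L) => //=.
by rewrite invgM !mulgA in L1 *.
Qed.

Lemma nullg_1 (H : groupType) (C : seq H) : nullg (1 :: C) <-> nullg C.
Proof.
split=> [[[|[p c'] L] //= [-> <-]]|[L <- L1]].
  by rewrite mulg1 mulgV mul1g; exists L.
by exists ((1, 1) :: L) => //=; rewrite !mul1g invg1 mul1g.
Qed.

End NullSystems.

(** * Lifting a null system to a planar map *)

Lemma evg_morph (Y : countType) (H K : groupType) (h : Y * bool -> H)
    (f : H -> K) (g : free_group Y) :
    (forall x y, f (x * y) = f x * f y) -> f 1 = 1 ->
  f (evg h g) = evg (f \o h) g.
Proof. by move=> fM f1; rewrite /evg; elim: (fword g) => //= a w IHw; rewrite fM IHw. Qed.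

Definition letter_image (Y X : countType) (s : Y * bool -> X * bool) (g : free_group Y) :
  free_group X := evg (fun a => fg [:: s a]) g.

Section LetterImage.
Variables (Y X : countType) (s : Y * bool -> X * bool).
Hypothesis sV : forall a, s (linv a) = linv (s a).

Lemma letterV a : fg [:: s (linv a)] = (fg [:: s a])^-1.
Proof. by rewrite sV -fg_winv. Qed.

Lemma letter_image_fg w : letter_image s (fg w) = fg (map s w).
Proof.
rewrite /letter_image evg_fg; last exact: letterV.
by elim: w => //= a w ->; rewrite -fg_cat.
Qed.

Lemma letter_imageM g g' : letter_image s (g * g') = letter_image s g * letter_image s g'.
Proof. by apply: evgM; exact: letterV. Qed.

Lemma letter_imageV g : letter_image s g^-1 = (letter_image s g)^-1.
Proof. by apply: evgV; exact: letterV. Qed.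

Lemma map_winv w : map s (winv w) = winv (map s w).
Proof. by rewrite /winv map_rev -!map_comp; congr rev; apply: eq_map => a; rewrite /= sV. Qed.

End LetterImage.

Lemma letter_image_comp (Z Y X : countType) (s : Y * bool -> X * bool) (t : Z * bool -> Y * bool) g :
    (forall a, s (linv a) = linv (s a)) ->
  letter_image s (letter_image t g) = letter_image (s \o t) g.
Proof.
move=> sV; rewrite {2}/letter_image evg_morph //; exact: letter_imageM.
Qed.

(** An element of [Y * bool] is a dart, an edge with a direction. Each edge has one face on
    each of its sides (perhaps the same face twice), as in a closed surface. *)
Definition quadratic (Y : countType) (C : seq (word Y)) : Prop :=
  uniq (flatten C) /\ forall x, x \in flatten C -> linv x \in flatten C.

Definition face_prod (Y : countType) (M : seq (free_group Y * word Y)) : free_group Y :=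
  bprod [seq (m.1, fg m.2) | m <- M].

(** M is a planar diagram with face labels D: its faces are made of distinct edges, which s
    labels by letters, and the conjugators are paths in the diagram. *)
Definition lifts (I X : countType) (s : I * bool -> X * bool)
    (M : seq (free_group I * word I)) (D : seq (free_group X * word X)) : Prop :=
  [/\ forall a, s (linv a) = linv (s a), quadratic (unzip2 M), face_prod M = 1 &
      [seq (letter_image s m.1, map s m.2) | m <- M] = D].

Lemma map_eq_cat (A B : Type) (f : A -> B) s a b : map f s = a ++ b ->
  map f (take (size a) s) = a /\ map f (drop (size a) s) = b.
Proof. by rewrite map_take map_drop => ->; rewrite take_size_cat // drop_size_cat. Qed.

Lemma face_prod_cat (Y : countType) (M N : seq (free_group Y * word Y)) :
  face_prod (M ++ N) = face_prod M * face_prod N.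
Proof. by rewrite /face_prod map_cat bprod_cat. Qed.

Lemma face_prod_image (Y X : countType) (s : Y * bool -> X * bool) M :
    (forall a, s (linv a) = linv (s a)) ->
  face_prod [seq (letter_image s m.1, map s m.2) | m <- M] = letter_image s (face_prod M).
Proof.
move=> sV; rewrite /face_prod bprod_morph ?evg1 //.
- by rewrite -!map_comp; congr bprod; apply: eq_map => m /=; rewrite letter_image_fg.
- exact: letter_imageM.
- exact: letter_imageV.
Qed.

Section Lifting.
Variable X : countType.

(** The number makes edges with the same letter distinct. *)
Definition tag_label (d : (nat * X) * bool) : X * bool := (d.1.2, d.2).
Local Notation liftable D := (exists M, lifts tag_label M D).

Lemma tag_labelV d : tag_label (linv d) = linv (tag_label d).
Proof. by []. Qed.

(** The cancelling pairs in a trivial word are matched like parentheses: each pair becomes one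
    edge. The result is a tree. *)
Lemma lift_trivial_word (w : word X) : fg w = 1 ->
  exists v, [/\ map tag_label v = w, quadratic [:: v] & fg v = 1].
Proof.
have [n] := ubnP (size w); elim: n w => // n IHn w le_wn w1.
have [rw|] := boolP (reduced w).
  by exists [::]; split=> //; rewrite (fg_inj rw _ w1).
case/not_reducedP => u [a [v ew]].
have [||x [ex [ux cx] x1]] := IHn (u ++ v).
- by move: le_wn; rewrite ew !size_cat /=; lia.
- by rewrite -(fg_cancel u a v) -ew.
pose k := foldr maxn 0%N [seq d.1.1 | d <- x].
have fresh d : d \in x -> (d.1.1 <= k)%N.
  rewrite /k; elim: (x) => //= e y IHy; rewrite inE => /orP[/eqP->|/IHy]; lia.
pose c : (nat * X) * bool := ((k.+1, a.1), a.2).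
have nx d : d.1.1 = k.+1 -> d \notin x.
  by move=> ed; apply/negP => /fresh; rewrite ed ltnn.
pose x1' := take (size u) x; pose x2 := drop (size u) x.
have e12 : x = x1' ++ x2 by rewrite cat_take_drop.
have pc : perm_eq (x1' ++ c :: linv c :: x2) (c :: linv c :: x).
  by rewrite e12 -[c :: linv c :: x2]/([:: c; linv c] ++ x2) perm_catCA.
exists (x1' ++ c :: linv c :: x2); split.
- rewrite map_cat /= /x1' /x2 map_take map_drop ex take_size_cat // drop_size_cat // ew.
  by rewrite tag_labelV /tag_label /= -surjective_pairing.
- split; rewrite /= cats0.
    rewrite (perm_uniq pc) /= inE negb_or !nx // eq_sym linv_neq /=.
    by move: ux; rewrite /= cats0.
  move=> d; rewrite !(perm_mem pc) !inE !linv_eq => /or3P[/eqP->|/eqP->|].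
  + by rewrite linvK eqxx orbT.
  + by rewrite linvK eqxx.
  by move=> dx; have := cx d; rewrite /= cats0 => ->; rewrite ?orbT.
- by rewrite fg_cancel -e12.
Qed.

(** The whole product is one trivial word, hence a tree. Its boundary is cut into the words p
    c p^-1, and each of them is turned round to c p^-1 p with the path read by p as
    conjugator. *)
Lemma liftable_conj (D : seq (free_group X * word X)) : face_prod D = 1 ->
  liftable [seq (d.1, d.2 ++ winv (fword d.1) ++ fword d.1) | d <- D].
Proof.
move=> D1; pose blk (d : free_group X * word X) := fword d.1 ++ d.2 ++ winv (fword d.1).
have fgD E : face_prod E = fg (flatten (map blk E)).
  by elim: E => //= e E IHE; rewrite fg_cat -IHE !fg_cat fg_winv fg_fword !mulgA.
have [v [ev qv v1]] := lift_trivial_word (etrans (esym (fgD D)) D1).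
suff [M [eM fM pM]] : exists M, [/\ face_prod M = fg v, 
     [seq (letter_image tag_label m.1, map tag_label m.2) | m <- M] =
     [seq (d.1, d.2 ++ winv (fword d.1) ++ fword d.1) | d <- D] &
     perm_eq (flatten (unzip2 M)) v].
  exists M; split=> //; last by rewrite eM.
  case: qv => uv cv; split.
    by rewrite (perm_uniq pM); move: uv; rewrite /= cats0.
  by move=> x; rewrite !(perm_mem pM); have := cv x; rewrite /= cats0.
elim: D v ev {D1 qv v1} => [|[p c] D IHD] v.
  by case: v => // _; exists [::]; split.
rewrite /= {1}/blk /= -!catA => ev.
have [] := map_eq_cat ev; have := cat_take_drop (size (fword p)) v.
move: (take _ v) (drop _ v) => P v1 e eP ev1.
have [] := map_eq_cat ev1; have := cat_take_drop (size c) v1.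
move: (take _ v1) (drop _ v1) => C v2 e1 eC ev2.
have [] := map_eq_cat ev2; have := cat_take_drop (size (winv p)) v2.
move: (take _ v2) (drop _ v2) => Q v3 e2 eQ ev3.
rewrite -{}e2 in e1; rewrite -{}e1 in e; rewrite -{}e.
have [M [M1 M2 M3]] := IHD v3 ev3.
exists ((fg P, C ++ Q ++ P) :: M); split.
- by rewrite /face_prod /= -/(face_prod M) M1 !fg_cat !mulgA mulgK.
- by rewrite /= M2 letter_image_fg // eP fg_fword !map_cat eP eC eQ.
- apply: (perm_trans (y := (C ++ Q ++ P) ++ v3)); first by rewrite /= perm_cat2l.
  by apply/seq.permP => b; rewrite !count_cat; lia.
Qed.

(** Two consecutive edges of a face with inverse labels are identified by a change of names,
    which keeps the product trivial. *)
Lemma liftable_zip D1 D2 g (u v : word X) a :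
  liftable (D1 ++ (g, u ++ a :: linv a :: v) :: D2) ->
  liftable (D1 ++ (g, u ++ v) :: D2).
Proof.
move=> [M [_ [uM cM] M1 eM]].
have [M' [m [M'' [eM' e1 em e2]]]] : exists M' m M'', [/\ M = M' ++ m :: M'',
    [seq (letter_image tag_label m.1, map tag_label m.2) | m <- M'] = D1,
    (letter_image tag_label m.1, map tag_label m.2) = (g, u ++ a :: linv a :: v) &
    [seq (letter_image tag_label m.1, map tag_label m.2) | m <- M''] = D2].
  have [eT] := map_eq_cat eM; have := cat_take_drop (size D1) M.
  case: (drop _ M) => [|m M''] //= <- [em1 em2] <-.
  by exists (take (size D1) M), m, M''; rewrite em1 em2.
case: m eM' em => k f eM' [ek ef].
have [x [b [c [y [ef' ex [eb ec] ey]]]]] : exists x b c y, [/\ f = x ++ b :: c :: y,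
    map tag_label x = u, tag_label b = a /\ tag_label c = linv a & map tag_label y = v].
  have [eT] := map_eq_cat ef; have := cat_take_drop (size u) f.
  case: (drop _ f) => [|b [|c y]] //= <- [eb ec1 ec2 ey].
  exists (take (size u) f), b, c, y; do 2!split=> //.
  by rewrite /tag_label ec1 ec2.
have bc : tag_label c = linv (tag_label b) by rewrite ec eb.
pose rest := flatten (unzip2 (M' ++ (k, x ++ y) :: M'')).
have pM : perm_eq (flatten (unzip2 M)) (b :: c :: rest).
  rewrite eM' ef' /rest /unzip2 !map_cat /= !flatten_cat /=.
  apply/seq.permP => q; rewrite /= !count_cat /= ?count_cat /= ?count_cat; lia.
move: uM; rewrite (perm_uniq pM) /= inE negb_or -andbA => /and4P[nbc nb nc urest].
have crest z : z \in b :: c :: rest -> linv z \in b :: c :: rest.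
  by rewrite -!(perm_mem pM); apply: cM.
(* If b and c are the two sides of one edge, the pair just cancels. *)
have [ecb|ncb] := eqVneq c (linv b).
  exists (M' ++ (k, x ++ y) :: M''); split=> //; last first.
  - by rewrite map_cat /= e1 e2 ek map_cat ex ey.
  - move: M1; rewrite eM' !face_prod_cat /face_prod /= ef' ecb fg_cancel //.
  split=> // z zr; have := crest z; rewrite !inE zr !orbT => /(_ isT).
  rewrite !linv_eq ecb linvK => /or3P[/eqP ez|/eqP ez|//].
    by move: zr; rewrite ez -ecb (negbTE nc).
  by move: zr; rewrite ez (negbTE nb).
(* Otherwise the edge of c is renamed so that it becomes that of b. *)
pose s z := if z == c then linv b else if z == linv c then b else z.
have sV z : s (linv z) = linv (s z).
  rewrite /s linv_eq (inj_eq (@linv_inj _)); case: eqP => [->|nz]; last first.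
    by case: eqP => _; rewrite ?linvK.
  by rewrite (negbTE (linv_neq c)).
have sl z : tag_label (s z) = tag_label z.
  rewrite /s; case: eqP => [->|_]; first by rewrite tag_labelV -bc.
  by case: eqP => [->|//]; rewrite tag_labelV bc linvK.
have si g' : letter_image tag_label (letter_image s g') = letter_image tag_label g'.
  by rewrite letter_image_comp //; apply: eq_in_evw => z _; rewrite /= sl.
exists [seq (letter_image s m.1, map s m.2) | m <- M' ++ (k, x ++ y) :: M'']; split=> //.
- have efl : flatten (unzip2 [seq (letter_image s m.1, map s m.2) | m <- M' ++ (k, x ++ y) :: M''])
    = map s rest.
    by rewrite /rest map_flatten /unzip2 -!map_comp.
  rewrite /quadratic efl; split.
    rewrite map_inj_in_uniq // => z1 z2 z1r z2r; rewrite /s.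
    have nzc z : z \in rest -> (z == c) = false.
      by move=> zr; apply/eqP => ez; move: zr; rewrite ez (negbTE nc).
    have nzb z : z \in rest -> (z == b) = false.
      by move=> zr; apply/eqP => ez; move: zr; rewrite ez (negbTE nb).
    rewrite !nzc //; case: eqP => [->|_]; case: eqP => [->|_] // ez.
      by move: (nzb _ z2r); rewrite -ez eqxx.
    by move: (nzb _ z1r); rewrite ez eqxx.
  move=> _ /mapP[z zr ->]; rewrite -sV.
  have := crest z; rewrite !inE zr !orbT => /(_ isT) /or3P[/eqP ez|/eqP ez|]; last exact: map_f.
    have -> : s (linv z) = s (linv c).
      by rewrite ez /s (negbTE nbc) -linv_eq eq_sym (negbTE ncb) (negbTE (linv_neq c)) eqxx.
    apply: map_f; have := crest c; rewrite !inE eqxx orbT => /(_ isT).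
    by rewrite (negbTE (linv_neq c)) linv_eq (negbTE ncb).
  have -> : s (linv z) = s (linv b).
    by rewrite ez /s eqxx eq_sym (negbTE ncb) (inj_eq (@linv_inj _)) (negbTE nbc).
  apply: map_f; have := crest b; rewrite !inE eqxx => /(_ isT).
  by rewrite (negbTE (linv_neq b)) eq_sym (negbTE ncb).
- rewrite face_prod_image // -[RHS](evg1 (fun a => fg [:: s a])) -M1 eM'.
  rewrite -/(letter_image s _) -!face_prod_image // !map_cat !face_prod_cat; congr (_ * _).
  rewrite /face_prod /= ef' !map_cat /=; congr (_ * _ * _ * _).
  have -> : s c = linv (s b) by rewrite /s eqxx (negbTE nbc) -linv_eq eq_sym (negbTE ncb).
  by rewrite fg_cancel.
- rewrite -map_comp -[LHS]/(map _ _) map_cat /= -e1 -e2 -ek -ex -ey.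
  congr (_ ++ _ :: _).
  + by apply: eq_map => m /=; rewrite si -map_comp; congr (_, _); apply: eq_map.
  + by rewrite /= si -map_comp map_cat; congr (_, _ ++ _); apply: eq_map.
  + by apply: eq_map => m /=; rewrite si -map_comp; congr (_, _); apply: eq_map.
Qed.

End Lifting.

Lemma eq_in_letter_image (Y X : countType) (s t : Y * bool -> X * bool) (g : free_group Y) :
  {in fword g, s =1 t} -> letter_image s g = letter_image t g.
Proof. by move=> st; apply: eq_in_evw => a /st ->. Qed.

(** In the faces c p^-1 p given by [liftable_conj] the tails are folded away by
    [liftable_zip]. Finitely many edges occur, so that they can be numbered. *)
Lemma lifting (X : countType) (D : seq (free_group X * word X)) : face_prod D = 1 ->
  exists (n : nat) (s : 'I_n * bool -> X * bool) M, lifts s M D.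
Proof.
move=> D1; have := liftable_conj D1.
have zips p : forall D1 D2 g (u : word X),
    (exists M, lifts (@tag_label X) M (D1 ++ (g, u ++ winv p ++ p) :: D2)) ->
    exists M, lifts (@tag_label X) M (D1 ++ (g, u) :: D2).
  elim: p => [|a p IHp] E1 E2 g u; first by rewrite /= cats0.
  move=> lM; apply: IHp; rewrite catA.
  apply: (@liftable_zip _ _ _ _ (u ++ winv p) p (linv a)).
  by rewrite linvK -catA -(cat_rcons (linv a) (winv p)) -winv_cons.
have -> : [seq (d.1, d.2 ++ winv (fword d.1) ++ fword d.1) | d <- D] =
  [::] ++ [seq (d.1, d.2 ++ winv (fword d.1) ++ fword d.1) | d <- D] by [].
rewrite -{2}(cat0s D); elim: D [::] {D1} => [|[g u] D IHD] E lM; last first.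
  by rewrite -cat_rcons; apply: IHD; rewrite cat_rcons; apply: zips lM.
case: lM => M []; rewrite cats0 => _ [uM cM] M1 <- {E}.
pose T := map fst (flatten (unzip2 M) ++ flatten [seq fword m.1 | m <- M]).
have inT m a : m \in M -> a \in m.2 \/ a \in fword m.1 -> a.1 \in T.
  move=> mM am; apply: map_f; rewrite mem_cat; apply/orP; case: am => am; [left|right];
  apply/flattenP; [exists m.2 | exists (fword m.1)] => //; exact: map_f.
(* Without edges all faces are empty, and there are no labels to choose from. *)
case eT: T => [|x0 T'].
  pose s (a : 'I_0 * bool) : X * bool := let: Ordinal k Hk := a.1 in False_rect _ (notF Hk).
  have M0 m : m \in M -> m = (1, [::]).
    case: m => g u mM; have nou a : a \notin u.
      by apply/negP => au; have := inT _ _ mM (or_introl au); rewrite eT.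
    have nog a : a \notin fword g.
      by apply/negP => au; have := inT _ _ mM (or_intror au); rewrite eT.
    congr (_, _); last by case: (u) nou => // a v /(_ a); rewrite mem_head.
    by apply: val_inj => /=; case: (fword g) nog => // a v /(_ a); rewrite mem_head.
  exists 0%N, s, [seq (1, [::]) | m <- M]; split=> [[[]]//||//|].
  - by have e0 : flatten (unzip2 [seq (1, [::]) | m <- M]) = [::] :> word 'I_0;
      [elim: (M) | rewrite /quadratic e0].
  - by rewrite /face_prod -map_comp; elim: (M) => //= m M' ->; apply: val_inj.
  - rewrite -map_comp; apply/eq_in_map => m mM /=.
    by rewrite (M0 m mM).
pose n := size T'.
pose h (a : (nat * X) * bool) : 'I_n.+1 * bool := (inord (index a.1 T), a.2).
pose s (a : 'I_n.+1 * bool) : X * bool := ((nth x0 T a.1).2, a.2).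
have hV a : h (linv a) = linv (h a) by [].
have hk a : a.1 \in T -> nth x0 T (h a).1 = a.1.
  by move=> aT; rewrite inordK ?nth_index //; move: aT; rewrite -index_mem eT.
have sh a : a.1 \in T -> s (h a) = tag_label a.
  by move=> aT; rewrite /s hk.
exists n.+1, s, [seq (letter_image h m.1, map h m.2) | m <- M]; split=> //.
- have inT' a : a \in flatten (unzip2 M) -> a.1 \in T.
    by move=> aM; apply: map_f; rewrite mem_cat aM.
  have -> : unzip2 [seq (letter_image h m.1, map h m.2) | m <- M] = map (map h) (unzip2 M).
    by rewrite /unzip2 -!map_comp.
  rewrite /quadratic -map_flatten; split.
    rewrite map_inj_in_uniq // => a b /inT' aT /inT' bT e.
    have := congr1 (fun c : 'I_n.+1 * bool => (nth x0 T c.1, c.2)) e; rewrite /= hk // hk //.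
    by rewrite -!surjective_pairing.
  by move=> _ /mapP[a aM ->]; rewrite -hV; apply: map_f; apply: cM.
- rewrite face_prod_image // M1; exact: evg1.
- rewrite -map_comp; apply/eq_in_map => m mM /=.
  rewrite letter_image_comp // -map_comp; congr (_, _).
    by apply: eq_in_letter_image => a ag; apply: sh; apply: inT mM _; right.
  by apply/eq_in_map => a au; apply: sh; apply: inT mM _; left.
Qed.

(** * Surgery on null systems *)

Lemma nullg_swap (H : groupType) (x y : H) (C : seq H) :
  nullg [:: x, y & C] -> nullg [:: y, x & C].
Proof. by apply: nullg_perm; rewrite (perm_catCA [:: x] [:: y] C). Qed.

Lemma nullg_ones (H : groupType) (x : H) (C : seq H) :
  (forall c, c \in C -> c = 1) -> nullg (x :: C) -> x = 1.
Proof.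
elim: C => [|c C IHC] C1.
  by move=> [[|[p c'] [|? ?]] //= [->]]; rewrite mulg1 => /divg1_eq; rewrite -{2}(mulg1 p) => /mulgI.
rewrite (C1 c (mem_head _ _)) => /nullg_swap /nullg_1.
by apply: IHC => d dC; apply: C1; rewrite inE dC orbT.
Qed.

Section NullWords.
Variable Y : countType.
Implicit Types (C : seq (word Y)) (u v : word Y).

Definition nullw C : Prop := nullg [seq fg c | c <- C].

Lemma nullw_perm C C' : perm_eq C C' -> nullw C -> nullw C'.
Proof. by move=> CC'; apply: nullg_perm; apply: perm_map. Qed.

Lemma nullw_swap u v C : nullw [:: u, v & C] -> nullw [:: v, u & C].
Proof. exact: nullg_swap. Qed.

Lemma nullw_catC u v C : nullw ((u ++ v) :: C) -> nullw ((v ++ u) :: C).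
Proof.
rewrite /nullw /= !fg_cat => n; apply: (@nullg_conj _ _ (fg u)).
by rewrite mulgA mulgK.
Qed.

Lemma nullw_rot k u C : nullw (rot k u :: C) <-> nullw (u :: C).
Proof.
by split=> [/nullw_catC|n]; rewrite ?cat_take_drop //; apply: nullw_catC; rewrite cat_take_drop.
Qed.

Lemma nullw_cancel u a v C :
  nullw ((u ++ a :: linv a :: v) :: C) <-> nullw ((u ++ v) :: C).
Proof. by rewrite /nullw /= fg_cancel. Qed.

Definition subst_edge d (H : groupType) (g : H) (h : Y * bool -> H) (a : Y * bool) : H :=
  if a == d then g else if a == linv d then g^-1 else h a.

Lemma subst_edgeV d (H : groupType) (g : H) (h : Y * bool -> H) a :
    (forall b, h (linv b) = (h b)^-1) ->
  subst_edge d g h (linv a) = (subst_edge d g h a)^-1.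
Proof.
move=> hV; rewrite /subst_edge (inj_eq (@linv_inj _)) linv_eq.
case: eqP => [->|_]; first by rewrite (negbTE (linv_neq d)) ?eqxx invgK.
by case: eqP => _.
Qed.

Lemma subst_edge_out d (H : groupType) (g : H) (h : Y * bool -> H) w :
  d \notin w -> linv d \notin w -> evw (subst_edge d g h) w = evw h w.
Proof.
move=> dw d'w; apply: eq_in_evw => a aw; rewrite /subst_edge.
by case: eqP => [ad|_]; [rewrite -ad aw in dw|case: eqP => // ad; rewrite -ad aw in d'w].
Qed.

(** The two sides of d lie in the first two faces: solve the first one for d and substitute
    the solution in the second one. *)
Lemma nullw_merge d u v C :
    let w := u ++ v ++ flatten C in d \notin w -> linv d \notin w ->
  nullw [:: d :: u, linv d :: v & C] -> nullw ((v ++ u) :: C).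
Proof.
move=> /=; rewrite !mem_cat !negb_or => /and3P[du dv dC] /and3P[d'u d'v d'C].
pose h := subst_edge d (fg v) (fun a => fg [:: a]).
have hV a : h (linv a) = (h a)^-1 by apply: subst_edgeV => b; rewrite -fg_winv.
have hd : h d = fg v by rewrite /h /subst_edge eqxx.
move=> /(nullg_morph (evgM hV) (evg1 h) (evgV hV)); rewrite -map_comp /= !evg_fg //=.
rewrite hV hd !subst_edge_out // !evw_fg mulVg -fg_cat => /nullg_swap.
move=> /nullg_1; rewrite /nullw; congr (nullg (_ :: _)).
apply/eq_in_map => c cC /=; rewrite evg_fg // subst_edge_out ?evw_fg //.
- by apply: contra dC => dc; apply/flattenP; exists c.
- by apply: contra d'C => dc; apply/flattenP; exists c.
Qed.

(** Sending the letters of all other faces to 1 leaves a conjugate of u. *)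
Lemma nullw_isolated u C :
    (forall x, x \in u -> x \notin flatten C /\ linv x \notin flatten C) ->
  nullw (u :: C) -> fg u = 1.
Proof.
move=> uC; pose h a := if (a \in u) || (linv a \in u) then fg [:: a] else 1.
have hV a : h (linv a) = (h a)^-1.
  by rewrite /h linvK orbC; case: ifP => _; rewrite ?invg1 // -fg_winv.
move=> /(nullg_morph (evgM hV) (evg1 h) (evgV hV)); rewrite -map_comp /= !evg_fg //.
rewrite (@eq_in_evw _ _ h (fun a => fg [:: a])) ?evw_fg; last by move=> a au; rewrite /h au.
apply: nullg_ones => _ /mapP[c cC ->]; rewrite /= evg_fg // evw1 // => a ac; rewrite /h.
case: ifP => // /orP[au|au]; have [n1 n2] := uC _ au.
- by case/negP: n1; apply/flattenP; exists c.
- by case/negP: n2; rewrite linvK; apply/flattenP; exists c.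
Qed.

End NullWords.

(** * Euler's inequality *)

Section FaceCycles.
Variable D : eqType.
Implicit Types (f g : D -> D) (c s : seq D).

Lemma filter_eq_cat (p : pred D) s u a v : filter p s = u ++ a :: v ->
  exists U V, [/\ s = U ++ a :: V, filter p U = u & filter p V = v].
Proof.
elim: s u => [|x s IHs] u /=; first by case: u.
case: ifP => px; last first.
  by case/IHs=> U [V [-> <- <-]]; exists (x :: U), V; rewrite /= px.
case: u => [|y u] /= [xy e]; first by exists [::], s; rewrite -e -xy.
have [U [V [-> <- <-]]] := IHs _ e.
by exists (x :: U), V; rewrite /= px xy.
Qed.

Lemma fpath_ext f g x x' s y : g x' = f x -> {in s, g =1 f} ->
  path (frel f) x (rcons s y) = path (frel g) x' (rcons s y).
Proof.
elim: s x x' => [|z s IHs] x x' ex gf /=; first by rewrite ex.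
rewrite ex (IHs z z) ?gf ?mem_head // => t ts; apply: gf; by rewrite inE ts orbT.
Qed.

Lemma fcycle_closed f c x : fcycle f c -> x \in c -> f x \in c.
Proof. by move=> fc xc; rewrite (eqP (next_cycle fc xc)) mem_next. Qed.

Lemma fcycle_iter f c x n : fcycle f c -> x \in c -> iter n f x \in c.
Proof. by move=> fc xc; elim: n => //= n; apply: fcycle_closed. Qed.

End FaceCycles.

Section Euler.
Variable I : finType.
Local Notation D := (I * bool)%type.
Implicit Types (S : {set I}) (f : {perm D}) (L : seq (seq D)).

Definition active S (x : D) : bool := x.1 \in S.

Lemma edge_flip_inj S : injective (fun x : D => if active S x then linv x else x).
Proof.
apply: inv_inj => x; rewrite /active.
by have [xS|xS] := boolP (x.1 \in S); rewrite /= ?xS ?(negbTE xS) ?linvK.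
Qed.

Definition edge_flip S : {perm D} := perm (@edge_flip_inj S).

(** Adding one edge composes with a transposition, which changes the number of orbits by one. *)
Lemma edge_flipD S x : active S x ->
  edge_flip S = edge_flip (S :\ x.1) * tperm x (linv x) :> {perm D}.
Proof.
rewrite /active => xS; apply/perm.permP => y; rewrite permM ![edge_flip _ y]permE /active !inE /=.
have [e|ne] /= := eqVneq y.1 x.1; last first.
  have nx : (y != x) && (y != linv x) by apply/andP; split; apply: contra_neq ne => ->.
  case: ifP => _; rewrite tpermD // eq_sym ?linv_eq; first [by case/andP: nx | by rewrite ?linvK; case/andP: nx].
rewrite e xS.
have [->|->] : y = x \/ y = linv x.
  case: (y) (x) e => y1 [] [x1 []] /= ->; rewrite /linv /=; by [left|right].
- by rewrite tpermL.
- by rewrite linvK tpermR.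
Qed.

Lemma filter_active_rot S k c : filter (active S) (rot k c) =
  filter (active S) (drop k c) ++ filter (active S) (take k c).
Proof. by rewrite /rot filter_cat. Qed.

Lemma nullw_filter_rot S k c (C : seq (word I)) :
  nullw (filter (active S) (rot k c) :: C) <-> nullw (filter (active S) c :: C).
Proof.
rewrite filter_active_rot -[X in _ <-> nullw (filter _ X :: _)](cat_take_drop k c) filter_cat.
by split; apply: nullw_catC.
Qed.

Lemma filter_activeD1 S x (c : seq D) :
  x \notin c -> linv x \notin c -> filter (active (S :\ x.1)) c = filter (active S) c.
Proof.
move=> xc x'c; apply: eq_in_filter => y yc; rewrite /active !inE.
case: eqP => //= e; have [ey|ey] : y = x \/ y = linv x.
- by case: (y) (x) e => y1 [] [x1 []] /= ->; rewrite /linv /=; by [left|right].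
- by rewrite ey (negbTE xc) in yc.
- by rewrite ey (negbTE x'c) in yc.
Qed.

(** Vertices, edges and faces: the orbits of [edge_flip S * f] are the vertices of the map
    with edges S and face permutation f. As long as an edge separates two faces it is removed,
    which merges them. Once every edge has the same face on both sides, each face is isolated,
    so the word along it is trivial and has a cancelling pair: this edge is a spike, which is
    cut off. Both steps multiply f by a transposition and keep the family null. *)
Lemma euler_inequality n S f L :
    #|S| = n -> uniq (flatten L) -> all (fcycle f) L ->
    (forall x, active S x -> x \in flatten L) -> L <> [::] ->
    nullw [seq filter (active S) c | c <- L] ->
  (#|S| + #|porbits f| <= #|porbits (edge_flip S * f)%g| + (size L).-1.*2)%N.
Proof.
elim: n S f L => [|n IHn] S f L.
  move/eqP; rewrite cards_eq0 => /eqP -> _ _ _ _ _; rewrite cards0.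
  rewrite (_ : edge_flip finset.set0 = 1); first by rewrite mul1g leq_addr.
  by apply/perm.permP => x; rewrite permE /active inE perm1.
move=> cS uL fL SL L0 nL.
have actV x : active S (linv x) = active S x by [].
have cS1 x : active S x -> #|S :\ x.1| = n.
  by move=> xS; move: (cardsD1 x.1 S); rewrite (_ : x.1 \in S) // cS => -[].
have [/hasP[c cL /hasP[d dc /andP[dS d'c]]]|/hasPn noM] :=
  boolP (has (fun c => has (fun d => active S d && (linv d \notin c)) c) L).
  (* Removing the common edge d of the faces d A and d^-1 B leaves the face B A. The darts of d
     stay in it as points without an active edge, to keep f1 a permutation of the same set. *)
  have /flattenP[c' c'L d'c'] : linv d \in flatten L by apply: SL.
  have c'1 : c' \in rem c L.
    have ncc' : c' != c by apply: contraNneq d'c => <-.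
    by move: (perm_mem (perm_to_rem cL) c'); rewrite c'L inE (negbTE ncc') /= => <-.
  pose L' := rem c' (rem c L).
  have pL : perm_eq L [:: c, c' & L'].
    by apply: perm_trans (perm_to_rem cL) _; rewrite perm_cons; apply: perm_to_rem.
  have [k A eA] := rot_to dc; have [k' B eB] := rot_to d'c'.
  pose s := A ++ B ++ flatten L'.
  have pfl : perm_eq (flatten L) (d :: linv d :: s).
    apply: perm_trans (perm_flatten pL) _; rewrite /= /s.
    apply: (perm_trans (y := (d :: A) ++ (linv d :: B) ++ flatten L')).
      by rewrite -eA -eB; apply: perm_cat; rewrite ?perm_cat2r perm_sym perm_rot.
    by rewrite perm_cons (perm_catCA A [:: linv d]).
  have fc : fcycle f (d :: A) by rewrite -eA rot_cycle; exact: (allP fL).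
  have fc' : fcycle f (linv d :: B) by rewrite -eB rot_cycle; exact: (allP fL).
  have fL' e : e \in L' -> fcycle f e.
    by move=> eL'; apply: (allP fL); apply: (mem_rem (mem_rem eL')).
  move: (uL); rewrite (perm_uniq pfl) /= inE negb_or -andbA => /and4P[_ ds d's us].
  have nLS : nullw [:: d :: filter (active S) A, linv d :: filter (active S) B
                     & [seq filter (active S) e | e <- L']].
    have := nullw_perm (perm_map (filter (active S)) pL) nL; rewrite /= -[f in nullw (f :: _)]/(filter _ c).
    move=> /(nullw_filter_rot S k _ _).2; rewrite eA => /nullw_swap /(nullw_filter_rot S k' _ _).2.
    by rewrite eB => /nullw_swap /=; rewrite actV dS.
  pose f1 := (tperm d (linv d) * f)%g.
  have f1E x : x \in s -> f1 x = f x.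
    move=> xs; rewrite permM tpermD //.
      by apply: contraNneq ds => ->.
    by apply: contraNneq d's => ->.
  have sA x : x \in A -> x \in s by move=> xA; rewrite mem_cat xA.
  have sB x : x \in B -> x \in s by move=> xB; rewrite !mem_cat xB orbT.
  have sL x : x \in flatten L' -> x \in s by move=> xB; rewrite !mem_cat xB !orbT.
  have epo : #|porbits f1|.+1 = #|porbits f|.
    have /= := porbits_mul_tperm f d (linv d); rewrite -/f1 eq_sym linv_neq addn1.
    suff -> : d \notin porbit f (linv d) by rewrite -[true.*2]/2%N addn2 => /succn_inj.
    apply/negP => /porbitP[i di]; have : d \in linv d :: B.
      by rewrite [X in X \in _]di permX; apply: fcycle_iter; rewrite ?mem_head.
    by rewrite inE eq_sym (negbTE (linv_neq d)) /= => /sB; rewrite (negbTE ds).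
  have := IHn (S :\ d.1) f1 ((d :: B ++ linv d :: A) :: L') (cS1 _ dS).
  rewrite (edge_flipD dS) -mulgA -/f1 -epo cS (perm_size pL) (cS1 _ dS) /= => IH.
  suff H : (n + #|porbits f1| <= #|porbits (edge_flip (S :\ d.1) * f1)| + (size L').*2)%N.
    by rewrite doubleS addSn addnS !addnS !ltnS.
  have pfl1 : perm_eq ((d :: B ++ linv d :: A) ++ flatten L') (d :: linv d :: s).
    rewrite /= perm_cons -catA (perm_catCA B [:: linv d] (A ++ _)) perm_cons.
    by rewrite perm_catCA.
  apply: IH => //.
  - by move: uL; rewrite (perm_uniq pfl) -(perm_uniq pfl1).
  - apply/andP; split; last first.
      apply/allP => e eL'; have fe := fL' e eL'.
      rewrite (_ : fcycle f1 e = fcycle f e) //; case: e eL' {fe} => // x e eL' /=.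
      have xs y : y \in x :: e -> y \in s by move=> ye; apply: sL; apply/flattenP; exists (x :: e).
      apply/esym/fpath_ext; first by apply: f1E; apply: xs; rewrite mem_head.
      by move=> y ye; apply: f1E; apply: xs; rewrite inE ye orbT.
    rewrite /= rcons_cat rcons_cons -cat_rcons cat_path last_rcons.
    rewrite -(@fpath_ext _ f f1 (linv d)) ?permM ?tpermL //; last by move=> x /sB/f1E.
    rewrite -(@fpath_ext _ f f1 d) ?permM ?tpermR //; last by move=> x /sA/f1E.
    by apply/andP.
  - move=> x; rewrite /active !inE => /andP[xd xS].
    have : x \in flatten L by apply: SL.
    by rewrite (perm_mem pfl) -(perm_mem pfl1).
  - have dd' : active (S :\ d.1) d = false by rewrite /active !inE eqxx.
    rewrite /= dd' filter_cat /= [active _ (linv d)]dd'.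
    have nS x (c0 : seq D) : x \notin c0 -> x \notin filter (active S) c0.
      by rewrite mem_filter negb_and => ->; rewrite orbT.
    move: ds d's; rewrite !mem_cat !negb_or => /and3P[dA dB dL] /and3P[d'A d'B d'L].
    rewrite !filter_activeD1 //.
    have eL' : [seq filter (active (S :\ d.1)) e | e <- L'] = [seq filter (active S) e | e <- L'].
      apply/eq_in_map => e eL; apply: filter_activeD1.
        by apply: contra dL => de; apply/flattenP; exists e.
      by apply: contra d'L => de; apply/flattenP; exists e.
    rewrite [X in nullw (_ :: X)]eL'; apply: nullw_merge nLS; rewrite -filter_flatten !mem_cat !negb_or !nS //.
(* All edges have the same face on both sides, so that faces are trivial words. In a G a^-1 K
   the darts in G are inactive: a is a spike, which is cut off with the loop G. *)
have /set0Pn[i iS] : S != finset.set0 by rewrite -card_gt0 cS.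
have /flattenP[c cL ic] : (i, true) \in flatten L by apply: SL.
pose w := filter (active S) c.
pose L' := rem c L; have pL : perm_eq L (c :: L') by apply: perm_to_rem.
have pfl0 : perm_eq (flatten L) (c ++ flatten L') by apply: (perm_flatten pL).
have w1 : fg w = 1.
  have := nullw_perm (perm_map (filter (active S)) pL) nL; rewrite /= -/w.
  apply: nullw_isolated => x; rewrite mem_filter => /andP[xS xc].
  have x'c : linv x \in c.
    by move: (noM _ cL) => /hasPn/(_ _ xc); rewrite xS negbK.
  move: uL; rewrite (perm_uniq pfl0) cat_uniq => /and3P[_ /hasPn nc _].
  have nf y : y \in c -> y \notin flatten [seq filter (active S) e | e <- L'].
    move=> yc; apply/negP; rewrite -filter_flatten mem_filter => /andP[_ /nc].
    by rewrite yc.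
  by split; apply: nf.
have nrw : ~~ reduced w.
  apply/negP => rw; have := fg_inj rw (isT : reduced [::]) w1.
  by move=> w0; have : (i, true) \in w by [rewrite mem_filter ic andbT]; rewrite w0.
have [u [a [v ew]]] := not_reducedP nrw.
have [U [V0 [ec eU eV0]]] := filter_eq_cat ew.
have [G [V [eGV eG eV]]] := @filter_eq_cat _ _ V0 [::] _ _ eV0.
rewrite {V0 eV0}eGV in ec; pose K := V ++ U; pose s := G ++ K ++ flatten L'.
have aS : active S a.
  by have : a \in w by [rewrite ew mem_cat mem_head orbT]; rewrite mem_filter => /andP[].
have ecr : rot (size U) c = a :: G ++ linv a :: K by rewrite ec rot_size_cat /= -catA.
have fc : fcycle f (a :: G ++ linv a :: K) by rewrite -ecr rot_cycle; exact: (allP fL).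
have fL' e : e \in L' -> fcycle f e by move=> eL'; apply: (allP fL); apply: mem_rem eL'.
have pfl : perm_eq (flatten L) (a :: linv a :: s).
  apply: perm_trans pfl0 _; apply: (perm_trans (y := (a :: G ++ linv a :: K) ++ flatten L')).
    by rewrite -ecr perm_cat2r perm_sym perm_rot.
  by rewrite /= perm_cons -catA (perm_catCA G [:: linv a]).
move: (uL); rewrite (perm_uniq pfl) /= inE negb_or -andbA => /and4P[_ na na' us].
pose f1 := (tperm a (linv a) * f)%g.
have f1E x : x \in s -> f1 x = f x.
  move=> xs; rewrite permM tpermD //.
    by apply: contraNneq na => ->.
  by apply: contraNneq na' => ->.
have sK x : x \in K -> x \in s by move=> xK; rewrite !mem_cat -mem_cat xK orbT.
have sL x : x \in flatten L' -> x \in s by move=> xB; rewrite !mem_cat xB !orbT.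
have epo : #|porbits f1| = #|porbits f|.+1.
  have /= := porbits_mul_tperm f a (linv a); rewrite -/f1 eq_sym linv_neq addn1.
  suff -> : a \in porbit f (linv a) by rewrite addn0.
  rewrite porbit_sym; apply/porbitP; exists (size (rcons G (linv a))).
  move: fc; rewrite /= rcons_cat rcons_cons -cat_rcons cat_path => /andP[/fpathP[m em] _].
  by rewrite permX em size_traject -last_traject -em last_rcons.
have := IHn (S :\ a.1) f1 ((a :: K) :: L') (cS1 _ aS).
rewrite (edge_flipD aS) -mulgA -/f1 epo cS (perm_size pL) (cS1 _ aS) /= addnS addSn => IH.
have pfl1 : perm_eq (a :: linv a :: s) (linv a :: G ++ (a :: K) ++ flatten L').
  rewrite -[X in perm_eq X _](cat1s a) -[_ :: s](cat1s (linv a)) perm_catCA perm_cons.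
  by rewrite perm_sym (perm_catCA G [:: a]).
have pfl2 : subseq ((a :: K) ++ flatten L') (linv a :: G ++ (a :: K) ++ flatten L').
  exact: (suffix_subseq (linv a :: G)).
apply: IH => //.
- by apply: subseq_uniq pfl2 _; rewrite -(perm_uniq pfl1) -(perm_uniq pfl).
- apply/andP; split; last first.
    apply/allP => e eL'; have fe := fL' e eL'.
    rewrite (_ : fcycle f1 e = fcycle f e) //; case: e eL' {fe} => // x e eL' /=.
    have xs y : y \in x :: e -> y \in s by move=> ye; apply: sL; apply/flattenP; exists (x :: e).
    apply/esym/fpath_ext; first by apply: f1E; apply: xs; rewrite mem_head.
    by move=> y ye; apply: f1E; apply: xs; rewrite inE ye orbT.
  rewrite /= -(@fpath_ext _ f f1 (linv a)) ?permM ?tpermL //; last by move=> x /sK/f1E.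
  by move: fc; rewrite /= rcons_cat rcons_cons -cat_rcons cat_path last_rcons => /andP[].
- move=> x; rewrite /active !inE => /andP[xa xS].
  have : x \in flatten L by apply: SL.
  rewrite (perm_mem pfl) (perm_mem pfl1) inE mem_cat => /or3P[/eqP ex||].
  + by move: xa; rewrite ex /= eqxx.
  + move=> xG; have : x \in filter (active S) G by rewrite mem_filter xG andbT.
    by rewrite eG.
  + by [].
- have aa' : active (S :\ a.1) a = false by rewrite /active !inE eqxx.
  rewrite /= aa'; move: na na'; rewrite !mem_cat !negb_or -!andbA => /and4P[_ aV aU aL] /and4P[_ a'V a'U a'L].
  rewrite filter_activeD1 ?mem_cat ?negb_or ?aV ?aU ?a'V ?a'U // filter_cat eU eV.
  have -> : [seq filter (active (S :\ a.1)) e | e <- L'] = [seq filter (active S) e | e <- L'].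
    apply/eq_in_map => e eL; apply: filter_activeD1.
      by apply: contra aL => de; apply/flattenP; exists e.
    by apply: contra a'L => de; apply/flattenP; exists e.
  apply: nullw_catC; apply/(nullw_cancel u a v); rewrite -ew.
  exact: (nullw_perm (perm_map (filter (active S)) pL) nL).
Qed.

End Euler.

(** * Curvature *)

(** An orbit of at most three elements shares the weight 6 equally; a larger one has weight 2
    for each element. *)
Lemma porbits_weight (T : finType) (n : {perm T}) :
  (6 * #|porbits n| <= \sum_(x : T)
    if n x == x then 6 else if n (n x) == x then 3 else 2)%N.
Proof.
pose w x := (if n x == x then 6 else if n (n x) == x then 3 else 2)%N.
rewrite -[X in (_ <= X)%N]/(\sum_x w x)%N.
have -> : (\sum_(x : T) w x = \sum_(x in [set: T]%SET) w x)%N.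
  by apply: eq_bigl => x; rewrite inE.
rewrite (partition_big_imset (porbit n)) /=.
have -> : [set porbit n x | x in [set: T]%SET]%SET = porbits n.
  by apply/setP => O; apply/imsetP/imsetP => -[x _ ->]; exists x; rewrite ?inE.
rewrite mulnC -sum_nat_const; apply: leq_sum => O /imsetP[x _ ->].
have sub y : porbit n y = porbit n x ->
  (y \in [set: T]%SET) && (porbit n y == porbit n x) by move=> ->; rewrite inE eqxx.
have nO y : porbit n (n y) = porbit n y.
  by apply/esym/eqP; rewrite eq_porbit_mem porbit_sym; have := mem_porbit n 1 y; rewrite expg1.
have [nx|nx] := eqVneq (n x) x.
  by rewrite (bigD1 x) ?sub //= /w nx eqxx leq_addr.
have nxx y : n y != y -> w y = if n (n y) == y then 3 else 2 by rewrite /w => /negbTE ->.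
have nnx : n (n x) != n x by rewrite (inj_eq perm_inj).
rewrite (bigD1 x) ?sub //= (bigD1 (n x)) /=; last by rewrite sub.
rewrite !nxx //; have [e|n2x] := eqVneq (n (n x)) x.
  by rewrite e eqxx addnA leq_addr.
rewrite (bigD1 (n (n x))) /=; last by rewrite sub ?nO // n2x.
by rewrite (inj_eq perm_inj) (negbTE n2x) nxx ?(inj_eq perm_inj) //; case: ifP => _; rewrite !addnA; apply: leq_trans (leq_addr _ _).
Qed.

Section FaceSuccessor.
Variable D : eqType.
Implicit Types (C : seq (seq D)) (c : seq D) (x y : D).

Definition face_of C x := nth [::] C (find (fun c => x \in c) C).

Definition nxt C x := next (face_of C x) x.

Lemma face_ofP C x : x \in flatten C -> face_of C x \in C /\ x \in face_of C x.
Proof.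
move=> /flattenP[c cC xc]; have hC : has (fun c => x \in c) C by apply/hasP; exists c.
by split; [apply: mem_nth; rewrite -has_find | apply: (nth_find [::] hC)].
Qed.

Lemma face_of_out C x : x \notin flatten C -> face_of C x = [::].
Proof.
move=> xC; rewrite /face_of nth_default // leqNgt -has_find.
by apply: contra xC => /hasP[c cC xc]; apply/flattenP; exists c.
Qed.

Lemma uniq_flatten_face C c : uniq (flatten C) -> c \in C -> uniq c.
Proof.
by move=> uC cC; move: uC; rewrite (perm_uniq (perm_flatten (perm_to_rem cC))) cat_uniq => /andP[].
Qed.

Lemma uniq_faces C : [::] \notin C -> uniq (flatten C) -> uniq C.
Proof.
elim: C => // c C IHC; rewrite inE negb_or /= cat_uniq.
case/andP => c0 nC /and3P[_ /hasPn cC /(IHC nC) ->]; rewrite andbT.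
case: c c0 cC => // x c _ cC; apply/negP => xcC.
have /cC : x \in flatten C by apply/flattenP; exists (x :: c); rewrite ?mem_head.
by rewrite /= mem_head.
Qed.

Lemma flatten_rem C c x : uniq (flatten C) -> c \in C -> x \in c -> x \notin flatten (rem c C).
Proof.
move=> uC cC xc; move: uC; rewrite (perm_uniq (perm_flatten (perm_to_rem cC))) cat_uniq.
by move=> /and3P[_ /hasPn nc _]; apply/negP => /nc; rewrite xc.
Qed.

Lemma face_eq C c c' x : uniq (flatten C) -> c \in C -> c' \in C -> x \in c -> x \in c' -> c = c'.
Proof.
move=> uC cC c'C xc xc'; apply/eqP/negPn/negP => ncc'.
have := flatten_rem uC cC xc; case/negP; apply/flattenP; exists c' => //.
move: (perm_mem (perm_to_rem cC) c'); rewrite c'C inE eq_sym (negbTE ncc') /= => <-//.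
Qed.

Lemma face_of_eq C c x : uniq (flatten C) -> c \in C -> x \in c -> face_of C x = c.
Proof.
move=> uC cC xc; have xC : x \in flatten C by apply/flattenP; exists c.
by have [fC xf] := face_ofP xC; apply: face_eq uC fC cC xf xc.
Qed.

Lemma nxt_next C c x : uniq (flatten C) -> c \in C -> x \in c -> nxt C x = next c x.
Proof. by move=> uC cC xc; rewrite /nxt (face_of_eq uC cC xc). Qed.

Lemma nxt_out C x : x \notin flatten C -> nxt C x = x.
Proof. by move=> xC; rewrite /nxt face_of_out. Qed.

Lemma nxt_mem C c x : uniq (flatten C) -> c \in C -> (nxt C x \in c) = (x \in c).
Proof.
move=> uC cC; have [xC|xC] := boolP (x \in flatten C); last by rewrite nxt_out.
have [fC xf] := face_ofP xC; rewrite (nxt_next uC fC xf).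
apply/idP/idP => [nc|xc].
  by rewrite (face_eq uC cC fC nc) // mem_next.
by rewrite (face_eq uC cC fC xc xf) mem_next.
Qed.

Lemma nxt_flatten C x : uniq (flatten C) -> (nxt C x \in flatten C) = (x \in flatten C).
Proof.
move=> uC; have [xC|xC] := boolP (x \in flatten C); last by rewrite nxt_out // (negbTE xC).
by have [fC xf] := face_ofP xC; apply/flattenP; exists (face_of C x) => //; rewrite nxt_mem.
Qed.

Lemma nxt_inj C : uniq (flatten C) -> injective (nxt C).
Proof.
move=> uC x y exy; have [xC|xC] := boolP (x \in flatten C); last first.
  move: exy; rewrite (nxt_out xC) => ex.
  have : y \notin flatten C by rewrite -nxt_flatten // -ex.
  by move=> /nxt_out; rewrite -ex.
have [fC xf] := face_ofP xC; have yf : y \in face_of C x by rewrite -(nxt_mem _ uC fC) -exy nxt_mem.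
have uf := uniq_flatten_face uC fC.
by rewrite -(prev_next uf x) -(prev_next uf y) -!(nxt_next uC fC) // exy.
Qed.

Lemma nxt_cat C u x y v : uniq (flatten C) -> u ++ x :: y :: v \in C -> nxt C x = y.
Proof.
move=> uC cC; have uc := uniq_flatten_face uC cC.
rewrite (nxt_next uC cC) ?mem_cat ?mem_head ?orbT //.
rewrite -(next_rot (size u) uc) rot_size_cat /= eqxx //.
Qed.

Lemma nxt_rot C c k x y v : uniq (flatten C) -> c \in C -> rot k c = x :: y :: v -> nxt C x = y.
Proof.
move=> uC cC e; have uc := uniq_flatten_face uC cC.
have xc : x \in c by rewrite -(mem_rot k) e mem_head.
by rewrite (nxt_next uC cC xc) -(next_rot k uc) e /= eqxx.
Qed.

End FaceSuccessor.

(** The dart x points to a vertex; turning twice around it returns to x exactly when this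
    vertex has degree two. Otherwise the corner between x and its successor is a genuine one. *)
Definition bend (I : eqType) (C : seq (word I)) (x : I * bool) : bool :=
  nxt C (linv (nxt C x)) != linv x.

(** Combine V - E + F >= 2 with the fact that vertices of degree at least three have at least
    three corners, while those of degree two have flat corners only. The last hypothesis
    excludes vertices of degree one. *)
Theorem curvature (I : finType) (C : seq (word I)) :
    quadratic C -> nullw C -> C <> [::] -> [::] \notin C ->
    (forall x, x \in flatten C -> nxt C x != linv x) ->
  (count (bend C) (flatten C) + 12 <= 6 * size C)%N.
Proof.
move=> [uC cC] nC C0 nilC degC.
pose f : {perm I * bool} := perm (nxt_inj uC).
pose S := [set x.1 | x in flatten C]%SET.
have SC x : active S x = (x \in flatten C).
  rewrite /active; apply/imsetP/idP => [[y yC e]|xC]; last by exists x.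
  have [->//|->] : x = y \/ x = linv y; last exact: cC.
  by case: (y) (x) e => y1 [] [x1 []] /= ->; rewrite /linv /=; by [left|right].
have fC c : c \in C -> fcycle f c.
  move=> cinC; have uc := uniq_flatten_face uC cinC.
  by apply: (cycle_from_next uc) => x xc; rewrite /= permE (nxt_next uC cinC).
set n := (edge_flip S * f)%g.
have euler : (#|S| + #|porbits f| <= #|porbits n| + (size C).-1.*2)%N.
  apply: (@euler_inequality I #|S| S f C erefl uC) => //; [exact/allP|by move=> x; rewrite SC|].
  suff -> : [seq filter (active S) c | c <- C] = C by [].
  rewrite -[RHS]map_id; apply/eq_in_map => c cinC; apply/all_filterP/allP => x xc.
  by rewrite SC; apply/flattenP; exists c.
have nE x : x \in flatten C -> n x = nxt C (linv x) by rewrite permM !permE SC => ->.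
have nout x : x \notin flatten C -> n x = x.
  by move=> xC; rewrite permM !permE SC (negbTE xC) nxt_out.
pose out := enum [predC flatten C].
(* Distinct faces, and distinct darts outside the diagram, lie in distinct orbits of f. *)
have orbits_f : (size C + size out <= #|porbits f|)%N.
  have fO x c : c \in C -> x \in c -> forall y, (y \in porbit f x) -> y \in c.
    move=> cinC xc y /porbitP[i ->]; rewrite permX; exact: fcycle_iter (fC c cinC) xc.
  have fo x : x \notin flatten C -> forall y, (y \in porbit f x) -> y = x.
    move=> xo y /porbitP[i ->]; rewrite permX; elim: i => //= i ->.
    by rewrite permE nxt_out.
  have uC' := uniq_faces nilC uC.
  have [x0 x0C] : exists x0, x0 \in flatten C.
    case: (C) C0 nilC => // -[|x c] C' _ nc; first by rewrite mem_head in nc.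
    by exists x; rewrite mem_head.
  have hC c : c \in C -> head x0 c \in c.
    case: c => [|x c _]; last by rewrite mem_head.
    by rewrite (negbTE nilC).
  pose reps := [seq head x0 c | c <- C] ++ out.
  rewrite -(size_map (head x0) C) -size_cat -(size_map (porbit f)) cardE.
  apply: uniq_leq_size; last first.
    by move=> O /mapP[x _ ->]; rewrite mem_enum; apply: imset_f.
  rewrite map_cat cat_uniq -map_comp !map_inj_in_uniq ?enum_uniq //; last first.
  - move=> c c' cinC c'C /= e; apply: (face_eq uC cinC c'C _ (hC _ c'C)).
    by apply: fO cinC (hC _ cinC) _ _; rewrite e porbit_id.
  - move=> x y; rewrite !mem_enum !inE => xo yo e; apply: (fo _ yo).
    by rewrite -e porbit_id.
  rewrite uC' andbT; apply/hasPn => O /mapP[x]; rewrite mem_enum inE => xo ->.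
  apply/negP => /mapP[c cinC /= e]; case/negP: xo; apply/flattenP; exists c => //.
  by apply: fO cinC (hC _ cinC) _ _; rewrite -e porbit_id.
have cF : #|{: I * bool}| = (size (flatten C) + size out)%N.
  by rewrite -(cardC (mem (flatten C))) -cardE (card_uniqP uC).
have sF : size (flatten C) = (2 * #|S|)%N.
  rewrite -(card_uniqP uC) mulnC -[in RHS]card_bool -[#|{: bool}|]cardsT -cardsX.
  by apply: eq_card => -[i b]; rewrite !inE /= andbT -[i \in S]/(active S (i, b)) SC.
(* A dart at a vertex of degree two has weight 3, at a larger vertex at most 6 / 3. *)
pose w x := (if n x == x then 6 else if n (n x) == x then 3 else 2)%N.
have weight : (6 * #|porbits n| <= \sum_(x <- flatten C) w x + 6 * size out)%N.
  apply: leq_trans (porbits_weight n) _; rewrite -/w (bigID (fun x => x \in flatten C)) /=.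
  apply: leq_add; first by rewrite (big_uniq _ uC).
  rewrite mulnC -cardE -sum_nat_const; apply: leq_sum => x xo.
  by rewrite (nout _ xo) eqxx.
have corners : (\sum_(x <- flatten C) w x + count (bend C) (flatten C) = 3 * size (flatten C))%N.
  have pF : perm_eq (map (nxt C) (flatten C)) (flatten C).
    have um : uniq (map (nxt C) (flatten C)) by rewrite map_inj_uniq //; exact: nxt_inj.
    have sm : {subset map (nxt C) (flatten C) <= flatten C}.
      by move=> _ /mapP[x xC ->]; rewrite nxt_flatten.
    by apply: uniq_perm => //; apply: (uniq_min_size um sm _).2; rewrite size_map.
  have -> : count (bend C) (flatten C) = count (fun x => n (n x) != x) (flatten C).
    rewrite -[RHS](seq.permP pF) count_map; apply: eq_in_count => x xC /=.
    have yC : nxt C x \in flatten C by rewrite nxt_flatten.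
    have zC : nxt C (linv (nxt C x)) \in flatten C by rewrite nxt_flatten //; apply: cC.
    by rewrite (nE _ yC) (nE _ zC) (inj_eq (nxt_inj uC)) linv_eq.
  rewrite -sum1_count [in X in (_ + X)%N]big_mkcond -big_split /=.
  rewrite -sum1_size big_distrr /= big_seq [RHS]big_seq; apply: eq_bigr => x xC.
  have nx : n x != x.
    by rewrite nE //; have := degC (linv x) (cC x xC); rewrite linvK.
  by rewrite /w (negbTE nx); case: eqP.
have C1 : (0 < size C)%N by case: (C) C0.
move: euler orbits_f weight corners C1; rewrite sF.
move: #|S| #|porbits n| #|porbits f| (\sum_(x <- _) _)%N (count _ _) (size C) (size out).
by clear=> *; lia.
Qed.

(** * Cutting a diagram along edges *)

Section Cuts.
Variable Y : countType.
Implicit Types (C : seq (word Y)) (u v w : word Y) (a b x : Y * bool).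

Definition letter_exp b a : int := ((a == b)%:Z - (a == linv b)%:Z)%R.

Fixpoint word_exp b w : int := if w is a :: w' then (letter_exp b a + word_exp b w')%R else 0%R.

Lemma word_exp_cat b u v : word_exp b (u ++ v) = (word_exp b u + word_exp b v)%R.
Proof. by elim: u => [|a u IHu] /=; rewrite ?GRing.add0r // IHu GRing.addrA. Qed.

Lemma letter_expV b a : letter_exp b (linv a) = (- letter_exp b a)%R.
Proof.
by rewrite /letter_exp GRing.opprB linv_eq (inj_eq (@linv_inj _)).
Qed.

Lemma word_exp_winv b w : word_exp b (winv w) = (- word_exp b w)%R.
Proof.
elim: w => [|a w IHw]; first by rewrite GRing.oppr0.
by rewrite winv_cons -cats1 word_exp_cat IHw /= letter_expV; lia.
Qed.

Lemma word_exp_fg b u v : fg u = fg v -> word_exp b u = word_exp b v.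
Proof.
apply: eq_fg => {}u a {}v; rewrite !word_exp_cat /= letter_expV GRing.addrA.
by rewrite GRing.addrA GRing.addrK.
Qed.

Lemma word_exp_out b w : b \notin w -> linv b \notin w -> word_exp b w = 0%R.
Proof.
elim: w => //= a w IHw; rewrite !inE !negb_or => /andP[ba bw] /andP[b'a b'w].
by rewrite IHw // /letter_exp eq_sym (negbTE ba) eq_sym (negbTE b'a).
Qed.

Lemma word_exp_count b w : word_exp b w = ((count_mem b w)%:Z - (count_mem (linv b) w)%:Z)%R.
Proof. by elim: w => //= a w ->; rewrite /letter_exp; lia. Qed.

Definition unfold_word (L : seq (free_group Y * word Y)) : word Y :=
  flatten [seq fword m.1 ++ m.2 ++ winv (fword m.1) | m <- L].

Lemma fg_unfold L : fg (unfold_word L) = face_prod L.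
Proof.
rewrite /face_prod; elim: L => //= m L IHL; rewrite fg_cat IHL !fg_cat fg_winv fg_fword.
by rewrite !mulgA.
Qed.

Lemma nullwP C : nullw C <-> exists2 L, unzip2 L = C & face_prod L = 1.
Proof.
split=> [[L eL L1]|[L <- L1]]; last first.
  by exists [seq (m.1, fg m.2) | m <- L] => //; rewrite /unzip2 -!map_comp.
exists (zip (unzip1 L) C); first by rewrite unzip2_zip // size_map -(size_map fg) -eL size_map.
rewrite -L1 /face_prod; congr bprod; elim: L C eL {L1} => [|[p c] L IHL] [|c' C] //= [-> eL].
by rewrite IHL.
Qed.

(** Conjugation does not change exponent sums. *)
Lemma nullw_balanced C x : nullw C -> count_mem x (flatten C) = count_mem (linv x) (flatten C).
Proof.
move=> /nullwP[L <- L1]; have /(word_exp_fg x) : fg (unfold_word L) = fg [::] by rewrite fg_unfold.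
have -> : word_exp x (unfold_word L) = word_exp x (flatten (unzip2 L)).
  elim: L {L1} => //= m L IHL; rewrite !word_exp_cat IHL word_exp_winv.
  by rewrite [(_ + (_ - _))%R]GRing.addrC GRing.subrK.
by rewrite word_exp_count /= => /eqP; rewrite GRing.subr_eq0 => /eqP [].
Qed.

Lemma nullw_closed C x : nullw C -> x \in flatten C -> linv x \in flatten C.
Proof. by rewrite -!has_pred1 !has_count => /(nullw_balanced x) ->. Qed.

(** Reading a word, the exponent of b is the current sheet of the infinite cyclic covering
    that unwinds b; this keeps the letters read on one sheet. The passage to a sheet respects
    the free group relation. *)
Fixpoint at_level b (n : int) w : word Y :=
  if w is a :: w' then
    if a == b then at_level b (n - 1)%R w'
    else if a == linv b then at_level b (n + 1)%R w'
    else if n == 0%R then a :: at_level b n w' else at_level b n w'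
  else [::].

Lemma at_level_cat b n u v :
  at_level b n (u ++ v) = at_level b n u ++ at_level b (n - word_exp b u)%R v.
Proof.
elim: u n => [|a u IHu] n /=; first by rewrite GRing.subr0.
rewrite /letter_exp; case: eqP => [->|_].
  by rewrite eq_sym (negbTE (linv_neq b)) IHu; congr (_ ++ at_level _ _ _); lia.
case: eqP => _; first by rewrite IHu; congr (_ ++ at_level _ _ _); lia.
by rewrite !IHu (_ : (0%:Z - 0%:Z + word_exp b u = word_exp b u)%R) //; [case: ifP|lia].
Qed.

Lemma at_level_out b n w : b \notin w -> linv b \notin w ->
  at_level b n w = if n == 0%R then w else [::].
Proof.
elim: w => [|a w IHw] /=; first by case: ifP.
rewrite !inE !negb_or => /andP[ba bw] /andP[b'a b'w].
by rewrite eq_sym (negbTE ba) eq_sym (negbTE b'a) IHw //; case: (n == 0%R).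
Qed.

Lemma at_level_fg b n u v : fg u = fg v -> fg (at_level b n u) = fg (at_level b n v).
Proof.
apply: (@eq_fg _ _ (fun w => fg (at_level b n w))) => {}u a {}v.
rewrite !at_level_cat !fg_cat; congr (_ * _); rewrite /=.
rewrite linv_eq (inj_eq (@linv_inj _)).
case: eqP => [->|_].
  by rewrite (eq_sym b) (negbTE (linv_neq b)) (_ : _ - 1 + 1 = n - word_exp b u)%R //; lia.
case: eqP => _; first by rewrite (_ : _ + 1 - 1 = n - word_exp b u)%R //; lia.
by case: (_ == 0%R) => //; exact: (fg_cancel [::]).
Qed.

(** A face with exponent sum 0 lifts to a closed path, based on the sheet on which its
    conjugator ends. *)
Lemma at_level_conj b n p c : word_exp b c = 0%R ->
  fg (at_level b n (p ++ c ++ winv p)) =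
  fg (at_level b n p) * fg (at_level b (n - word_exp b p) c) * (fg (at_level b n p))^-1.
Proof.
move=> c0; rewrite !at_level_cat c0 GRing.subr0 !fg_cat mulgA; congr (_ * _).
apply/esym/mulg1_eq; rewrite -fg_cat -at_level_cat.
by rewrite (@at_level_fg _ _ _ [::]) // fg_cat fg_winv mulgV.
Qed.

Lemma at_level_unfold b n L : (forall m, m \in L -> word_exp b m.2 = 0%R) ->
  fg (at_level b n (unfold_word L)) =
  bprod [seq (fg (at_level b n (fword m.1)),
              fg (at_level b (n - word_exp b (fword m.1))%R m.2)) | m <- L].
Proof.
elim: L => //= m L IHL L0; rewrite at_level_cat fg_cat at_level_conj ?L0 ?mem_head //.
rewrite -IHL => [|k kL]; last by apply: L0; rewrite inE kL orbT.
congr (_ * fg (at_level _ _ _)); rewrite !word_exp_cat word_exp_winv L0 ?mem_head //; lia.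
Qed.

Lemma bprod_filter (T : eqType) (H : groupType) (F : T -> H * H) (P : pred T) (L : seq T) :
  (forall m, m \in L -> ~~ P m -> (F m).2 = 1) ->
  bprod (map F (filter P L)) = bprod (map F L).
Proof.
elim: L => //= m L IHL L1; rewrite -IHL => [|k kL]; last by apply: L1; rewrite inE kL orbT.
case: ifP => //= /negbT nP; by rewrite L1 ?mem_head // mulg1 mulgV mul1g.
Qed.

(** A face with b and b^-1 on its boundary is an annulus cut open along b. In the covering
    that unwinds b its two boundary components u and v lie on adjacent sheets, and each other
    face lies on a single sheet. The two sheets give the two sides. *)
Lemma nullw_bridge b u v C :
    let w := u ++ v ++ flatten C in b \notin w -> linv b \notin w ->
  nullw ((u ++ b :: v ++ [:: linv b]) :: C) ->
  exists m1 m2 : seq bool,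
    [/\ size m1 = size C, size m2 = size C, forall i, ~~ (nth false m1 i && nth false m2 i),
        nullw (u :: mask m1 C) & nullw (v :: mask m2 C)].
Proof.
move=> /=; rewrite !mem_cat !negb_or => /and3P[bu bv bC] /and3P[b'u b'v b'C].
move=> /nullwP[[|[p0 c0] L] //= [e0 eL]]; rewrite -{}eL in bC b'C * => L1.
pose lev (m : free_group Y * word Y) := word_exp b (fword m.1).
have out m : m \in L -> b \notin m.2 /\ linv b \notin m.2.
  move=> mL; split; [apply: contra bC | apply: contra b'C] => bm;
  by apply/flattenP; exists m.2 => //; apply: map_f.
pose n0 := word_exp b (fword p0).
(* The faces on sheet n0 + k; b joins the sheets of u and v, that is k = 0 and k = 1. *)
have key k : nullw (at_level b k c0 :: mask [seq lev m == (n0 + k)%R | m <- L] (unzip2 L)).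
  apply/nullwP.
  exists ((fg (at_level b (n0 + k)%R (fword p0)), at_level b k c0) ::
     [seq (fg (at_level b (n0 + k)%R (fword m.1)), m.2) | m <- L & lev m == (n0 + k)%R]).
    by rewrite /= filter_mask -!map_mask /unzip2 -map_comp.
  have exp0 m : m \in (p0, c0) :: L -> word_exp b m.2 = 0%R.
    rewrite inE => /orP[/eqP->|/out[bm b'm]]; last exact: word_exp_out.
    by rewrite /= e0 word_exp_cat /= word_exp_cat (word_exp_out bu) // (word_exp_out bv) //= letter_expV; lia.
  have := @at_level_fg b (n0 + k)%R _ [::] (etrans (fg_unfold _) L1).
  rewrite (at_level_unfold _ exp0) /= -/n0 (_ : n0 + k - n0 = k)%R; last lia.
  move=> L1'; rewrite -[RHS]L1' /face_prod /= -map_comp /=.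
  rewrite -[in RHS](@bprod_filter _ _ _ (fun m => lev m == (n0 + k)%R)) => [|m mL nm] /=; last first.
    have [bm b'm] := out m mL; rewrite at_level_out //.
    by rewrite GRing.subr_eq0 eq_sym (negbTE nm).
  congr (_ * bprod _); apply/eq_in_map => m; rewrite mem_filter => /andP[/eqP lm mL] /=.
  have [bm b'm] := out m mL; rewrite (at_level_out _ bm b'm).
  by move: lm; rewrite /lev => ->; rewrite GRing.subrr eqxx.
exists [seq lev m == (n0 + 0)%R | m <- L], [seq lev m == (n0 + 1)%R | m <- L].
have c0E k : at_level b k c0 = (if k == 0%R then u else [::]) ++ if k == 1%R then v else [::].
  rewrite e0 at_level_cat at_level_out // word_exp_out //= eqxx at_level_cat at_level_out //=.
  rewrite (negbTE (linv_neq b)) eqxx cats0 GRing.subr0 GRing.subr_eq0.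
  by [].
split; rewrite ?size_map //.
- move=> i; have [iL|Li] := ltnP i (size L); last by rewrite !nth_default ?size_map.
  by rewrite !(nth_map (1, [::])) // -!/(lev _); apply/negP => /andP[/eqP -> /eqP]; lia.
- by have := key 0%R; rewrite c0E /= cats0.
- by have := key 1%R; rewrite c0E.
Qed.

(** Merge the two faces along a; then b has the merged face on both sides, and [nullw_bridge]
    applies. *)
Lemma nullw_cut a b u1 u2 v1 v2 C :
    uniq (flatten [:: a :: u2 ++ b :: u1, linv b :: v2 ++ linv a :: v1 & C]) ->
  nullw [:: a :: u2 ++ b :: u1, linv b :: v2 ++ linv a :: v1 & C] ->
  exists m1 m2 : seq bool,
    [/\ size m1 = size C, size m2 = size C, forall i, ~~ (nth false m1 i && nth false m2 i),
        nullw ((v2 ++ u2) :: mask m1 C) & nullw ((u1 ++ v1) :: mask m2 C)].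
Proof.
set s := flatten _ => us nC.
have ps : perm_eq s ([:: a; linv a; b; linv b] ++ u1 ++ u2 ++ v1 ++ v2 ++ flatten C).
  apply/seq.permP => q; rewrite /s /= ?(count_cat, =^~ cat_cons) /= ?count_cat /=.
  by clear; lia.
move: us; rewrite (perm_uniq ps) cat_uniq => /and3P[uab /hasPn nab us].
have out c : c \in [:: a; linv a; b; linv b] -> c \notin u1 ++ u2 ++ v1 ++ v2 ++ flatten C.
  by move=> cab; apply/negP => /nab; rewrite cab.
have [oa oa' ob ob'] := And4 (out a) (out (linv a)) (out b) (out (linv b)).
rewrite !inE !eqxx ?orbT /= !mem_cat !negb_or in oa oa' ob ob'.
case/and5P: (oa isT) => au1 au2 av1 av2 aC; case/and5P: (oa' isT) => a'u1 a'u2 a'v1 a'v2 a'C.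
case/and5P: (ob isT) => bu1 bu2 bv1 bv2 bC; case/and5P: (ob' isT) => b'u1 b'u2 b'v1 b'v2 b'C.
move: uab; rewrite /= !inE !negb_or => /and4P[/and3P[_ ab ab'] /andP[a'b a'b'] bb' _] {oa oa' ob ob' out}.
have : nullw (((v1 ++ linv b :: v2) ++ (u2 ++ b :: u1)) :: C).
  apply: (@nullw_merge _ a); last first.
    apply: nullw_swap; apply: (nullw_catC (u := linv b :: v2) (v := linv a :: v1)).
    exact: nullw_swap.
  - by rewrite /= !(mem_cat, inE) !negb_or a'u2 a'b a'u1 a'v1 a'b' a'v2 a'C.
  - by rewrite /= !(mem_cat, inE) !negb_or au2 ab au1 av1 ab' av2 aC.
rewrite -catA => /nullw_catC; rewrite /= -!catA /= => nC1.
apply: (@nullw_bridge b (v2 ++ u2) (u1 ++ v1) C).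
- by rewrite !mem_cat !negb_or bv2 bu2 bu1 bv1 bC.
- by rewrite !mem_cat !negb_or b'v2 b'u2 b'u1 b'v1 b'C.
rewrite (_ : _ ++ _ = ((v2 ++ u2) ++ b :: u1 ++ v1) ++ [:: linv b]); last by rewrite -!catA /= -?catA.
by apply: (nullw_catC (u := [:: linv b])); move: nC1; rewrite /= -!catA /= -?catA.
Qed.
End Cuts.

(** * Cyclic words and runs *)

Section CyclicWords.
Variable X : countType.
Implicit Types (u v w : word X) (a : X * bool).

Lemma cr_rot k w : cyclically_reduced (rot k w) = cyclically_reduced w.
Proof. exact: rot_cycle. Qed.

Lemma cr_winv w : cyclically_reduced (winv w) = cyclically_reduced w.
Proof.
rewrite /cyclically_reduced /winv rev_cycle cycle_map.
by apply: eq_cycle => a b; rewrite /= -noncancelC.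
Qed.

Lemma cr_reduced w : cyclically_reduced w -> reduced w.
Proof. by case: w => //= a w; rewrite /reduced /= rcons_path => /andP[]. Qed.

(** In an inverse palindrome the middle letters cancel, or the middle letter is its own inverse. *)
Lemma reduced_winv_nil w : reduced w -> winv w = w -> w = [::].
Proof.
move=> rw ew; have [k [ek|ek]] : exists k, size w = k.*2 \/ size w = k.*2.+1.
  have e := odd_double_half (size w); exists (size w)./2.
  by case: (odd (size w)) e => /= e; [right|left]; rewrite -[LHS]e.
- case: k ek => [/size0nil //|k] ek.
  have [u [v [e eu]]] : exists u v, w = u ++ v /\ size u = k.+1.
    by exists (take k.+1 w), (drop k.+1 w); rewrite cat_take_drop size_takel //; lia.
  have ev : v = winv u.
    have sv : size (winv v) = size u by rewrite size_winv; move: ek; rewrite e size_cat; lia.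
    move: ew; rewrite e winv_cat => /eqP; rewrite eqseq_cat // => /andP[/eqP <- _].
    by rewrite winvK.
  case/lastP: u e eu ev => // u a e _ ev.
  move: rw; rewrite e ev winv_rcons cat_rcons => /reduced_cat[_].
  by rewrite /reduced /= /noncancel eqxx.
- have kw : (k < size w)%N by lia.
  have a0 : X * bool by case: (w) kw.
  have := congr1 (nth a0 ^~ k) ew; rewrite /winv nth_rev ?size_map //.
  rewrite (_ : size w - k.+1 = k)%N; last by rewrite ek -addnn; clear; lia.
  by rewrite (nth_map a0) // => /eqP; rewrite (negbTE (linv_neq _)).
Qed.

End CyclicWords.

Section RotUniq.
Variable T : eqType.
Implicit Types (s u v w : seq T) (x y : T).

Lemma rot_uniq_tail s k k' y u v :
  uniq s -> rot k s = y :: u -> rot k' s = y :: v -> u = v.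
Proof.
move=> us eu ev.
have tr j w : rot j s = y :: w -> w = traject (next s) (next s y) (size s).-1.
  move=> ew; have : fcycle (next s) (y :: w) by rewrite -ew rot_cycle cycle_next.
  rewrite /= rcons_path => /andP[/fpathP[n en] _].
  by rewrite -(size_rot j) ew /= {2}en size_traject.
by rewrite (tr _ _ eu) (tr _ _ ev).
Qed.

Lemma cat_cases w q u v : w ++ q = u ++ v ->
  (exists d, u = w ++ d) \/ (exists2 d, d <> [::] & w = u ++ d).
Proof.
elim: w u => [|x w IHw] [|y u] //=; [by left; exists [::]|by left; exists (y :: u)|by right; exists (x :: w)|].
case=> -> /IHw[[d ->]|[d d0 ->]]; first by left; exists d.
by right; exists d.
Qed.

(** A cyclic subword of A B that does not continue past the end of A or of B lies in one of
    the two. *)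
Lemma infix_of_rot (A B brk : seq T) k w q : uniq (A ++ B) -> rot k (A ++ B) = w ++ q ->
    (forall A' z, A = rcons A' z -> z \in brk) ->
    (forall B' z, B = rcons B' z -> z \in brk) ->
    (forall u z v, w = u ++ z :: v -> v <> [::] -> z \notin brk) ->
  infix w A \/ infix w B.
Proof.
case: w => [|y w] uAB e bA bB nb; first by left; apply/infixP; exists [::], A.
have yAB : y \in A ++ B by rewrite -(mem_rot k) e mem_head.
have key (A0 A1 B0 : seq T) j : rot j (A ++ B) = y :: A1 ++ B0 ->
    (forall A' z, A0 ++ y :: A1 = rcons A' z -> z \in brk) ->
    infix (y :: w) (A0 ++ y :: A1).
  move=> ej bA1; have ew := rot_uniq_tail uAB e ej.
  have [[d ed]|[d d0 ed]] := cat_cases ew.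
    by apply/infixP; exists A0, d; rewrite ed.
  case/lastP: {ej} A1 bA1 ed {ew} => [|A1 z] bA1 ed.
    have := bA1 A0 y; rewrite cats1 => /(_ erefl); rewrite (negbTE (nb [::] y w _ _)) //.
    by rewrite ed.
  have := bA1 (A0 ++ y :: A1) z; rewrite -rcons_cons -rcons_cat => /(_ erefl).
  by rewrite (negbTE (nb (y :: A1) z d _ _)) // ed cat_rcons.
move: yAB; rewrite mem_cat => /orP[yA|yB].
- case/splitPr: yA uAB e bA key => A0 A1 uAB e bA key; left.
  apply: (key A0 A1 (B ++ A0) (size A0)) => //.
  by rewrite -catA rot_size_cat /= -catA.
- case/splitPr: yB uAB e bB key => A0 A1 uAB e bB key; right.
  apply: (key A0 A1 (A ++ A0) (size (A ++ A0))) => //.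
  by rewrite catA rot_size_cat /= -?catA.
Qed.

(** The elements satisfying p cut s into runs of length less than [wt x * len / 6]; add up. *)
Lemma count_runs (p : pred T) (wt : T -> nat) (len : nat) s :
    s <> [::] ->
    (forall s' x, s = rcons s' x -> p x) ->
    (forall u t x v, s = u ++ rcons t x ++ v -> {in t, forall y, ~~ p y} -> p x ->
       (6 * size (rcons t x) < wt x * len)%N) ->
  (6 * size s < (\sum_(x <- s | p x) wt x) * len)%N.
Proof.
have [n] := ubnP (size s); elim: n s => // n IHn s le_sn s0 plast bound.
have hs : has p s.
  by case/lastP: (s) s0 plast => // s' x _ pl; rewrite has_rcons (pl s' x).
case: (split_find hs) plast bound le_sn => x t v px /hasPn npt plast bound le_sn.
have bx := bound [::] t x v erefl npt px.
have [->|/eqP v0] := eqVneq v [::].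
  rewrite cats0 big_rcons /= px; apply: leq_trans bx _.
  by rewrite leq_mul2r leq_addl orbT.
rewrite big_cat /= size_cat mulnDl mulnDr -addSn; apply: leq_add.
  rewrite big_rcons /= px; apply: leq_trans bx _.
  by rewrite leq_mul2r leq_addl orbT.
apply: ltnW; apply: IHn => //.
- by move: le_sn; rewrite size_cat size_rcons; lia.
- by move=> s' y ev; apply: (plast (rcons t x ++ s')); rewrite ev rcons_cat.
- move=> u t' y v' ev; apply: (bound (rcons t x ++ u) t' y v').
  by rewrite ev -catA.
Qed.
End RotUniq.

(** * Corners, contacts and weights *)

Lemma rot_rotE (T : Type) i k (s : seq T) : exists j, rot i (rot k s) = rot j s.
Proof.
have [le_k|lt_k] := leqP k (size s); last by exists i; rewrite (rot_oversize (ltnW lt_k)).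
have [le_i|lt_i] := leqP i (size s); last by exists k; rewrite rot_oversize // size_rot ltnW.
by eexists; apply: rot_add_mod.
Qed.

Lemma nxt_rot_cat (D : eqType) (C : seq (seq D)) c k u x y v :
  uniq (flatten C) -> c \in C -> rot k c = u ++ x :: y :: v -> nxt C x = y.
Proof.
move=> uC cC e; have [j ej] := rot_rotE (size u) k c.
by apply: (nxt_rot (k := j) (v := v ++ u) uC cC); rewrite -ej e rot_size_cat.
Qed.

Section Diagrams.
Variables (I : countType) (C : seq (word I)).
Hypotheses (uC : uniq (flatten C)) (cC : forall x, x \in flatten C -> linv x \in flatten C).
Implicit Types (c : word I) (x y z : I * bool).

Lemma face_flatten c x : c \in C -> x \in c -> x \in flatten C.
Proof. by move=> cinC xc; apply/flattenP; exists c. Qed.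

(** At a vertex of degree two both corners are flat. *)
Lemma bend_opp x z : nxt C z = linv x -> bend C x = bend C z.
Proof.
move=> ez; rewrite /bend ez linvK; congr (~~ _); apply/eqP/eqP => [|->]; last by rewrite linvK.
by rewrite -ez => /(nxt_inj uC) <-; rewrite linvK.
Qed.

(** A flat corner has the same two faces on both of its edges. *)
Lemma run_mirror c k t q :
    c \in C -> t <> [::] -> rot k c = t ++ q ->
    (forall u x y v, t = u ++ x :: y :: v -> ~~ bend C x) ->
  exists c' k' q', c' \in C /\ rot k' c' = winv t ++ q'.
Proof.
move=> cinC; elim: t k q => [|x t IHt] k q //= _ e nb.
have xc : x \in c by rewrite -(mem_rot k) e mem_head.
have x'C := cC (face_flatten cinC xc).
case: t IHt e nb => [|y t] IHt e nb.
  have /flattenP[c' c'C x'c'] := x'C; have [k' q' e'] := rot_to x'c'.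
  by exists c', k', q'.
have [j ej] := rot_rotE 1 k c; rewrite e rot1_cons in ej.
have [|||c' [k' [q' [c'C e']]]] := IHt j (rcons q x) => //.
- by rewrite -ej -rcons_cat.
- by move=> u z1 z2 v et; apply: (nb (x :: u) z1 z2 v); rewrite et.
have nxy : nxt C x = y by apply: nxt_rot e.
have nyx : nxt C (linv y) = linv x.
  by apply/eqP; have := nb [::] x y t erefl; rewrite /bend negbK nxy.
have y'c' : linv y \in c' by rewrite -(mem_rot k') e' mem_cat mem_winv linvK mem_head.
exists c', k'; rewrite -[x :: y :: t]/([:: x] ++ y :: t) winv_cat.
case: q' e' => [|z q'] e'.
  have : linv x \in c' by rewrite -nyx nxt_mem.
  rewrite -(mem_rot k') e' cats0 mem_winv linvK => xyt.
  have := uniq_flatten_face uC cinC; rewrite -(rot_uniq k) e /= => /andP[].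
  by rewrite -cat_cons mem_cat xyt.
exists q'; split=> //; rewrite e' -catA; congr (_ ++ _ :: _).
rewrite -nyx; apply/esym; apply: (nxt_rot_cat uC c'C (k := k') (u := winv t) (v := q')).
by rewrite e' winv_cons cat_rcons.
Qed.

Section Weights.
Variables (brk : seq (I * bool)) (tau : pred (I * bool)).
Hypothesis tau_nxt : forall y, y \in flatten C -> y \notin brk -> tau (nxt C y) = tau y.

(** The outer boundary is divided into labelled arcs. A corner whose opposite corner lies at
    the end of an arc counts as a genuine one, so that a run of other corners faces a single
    arc. The list [brk] holds the last darts of the arcs, and [tau] recognises one arc. *)
Definition cut_bend x : bool := bend C x || (linv (nxt C x) \in brk).

Lemma cut_bend_tau x : x \in flatten C -> ~~ cut_bend x ->
  tau (linv (nxt C x)) = tau (linv x).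
Proof.
move=> xC; rewrite negb_or negbK => /andP[/eqP <- nb].
by rewrite tau_nxt // cC // nxt_flatten.
Qed.

(** A run of flat corners on the part q of the boundary outside the contact interval is
    shorter than [wt x / 6] of the boundary by hypothesis. The part q is at least half of the
    boundary, so its corners have total weight more than 3; if there is no contact, q is
    everything and the total is more than 6. The end of the contact interval is a corner,
    since the face changes there. *)
Lemma cell_weight c (wt : I * bool -> nat) :
    c \in C -> c <> [::] -> (forall x, wt x <= 6)%N ->
    (forall k t x v, rot k c = rcons t x ++ v -> {in t, forall y, ~~ cut_bend y} ->
       ~~ tau (linv x) -> (6 * size (rcons t x) < wt x * size c)%N) ->
    (forall x, x \in c -> ~~ tau (linv x)) \/
    (exists k h0 H h q, [/\ rot k c = rcons H h ++ q, head h0 (rcons H h) = h0,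
       (2 * size (rcons H h) <= size c)%N, tau (linv h0) && tau (linv h) &
       forall x, x \in q -> ~~ tau (linv x)]) ->
  (7 <= \sum_(x <- c | cut_bend x && ~~ tau (linv x)) wt x)%N \/
  (4 <= \sum_(x <- c | cut_bend x && ~~ tau (linv x)) wt x)%N /\
  has (fun x => cut_bend x && tau (linv x)) c.
Proof.
move=> cinC c0 wt6 runs; have xC x : x \in c -> x \in flatten C := face_flatten cinC.
have s0 : (0 < size c)%N by case: (c) c0.
have key k q : (exists2 p, rot k c = p ++ q & q <> [::]) ->
    (forall q' x, q = rcons q' x -> cut_bend x) -> (forall x, x \in q -> ~~ tau (linv x)) ->
    (6 * size q < (\sum_(x <- q | cut_bend x && ~~ tau (linv x)) wt x) * size c)%N.
  move=> [p ep q0] lastq ntau.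
  have -> : (\sum_(x <- q | cut_bend x && ~~ tau (linv x)) wt x = \sum_(x <- q | cut_bend x) wt x)%N.
    rewrite big_seq_cond [RHS]big_seq_cond; apply: eq_bigl => x.
    by case: (boolP (x \in q)) => //= /ntau ->; rewrite andbT.
  apply: count_runs q0 lastq _ => u t x v eq nt cx.
  have [j ej] := rot_rotE (size (p ++ u)) k c.
  apply: (runs j t x (v ++ p ++ u)) => //.
    by rewrite -ej ep eq (catA p u) rot_size_cat -!catA.
  by apply: ntau; rewrite eq !mem_cat mem_rcons mem_head orbT.
have big_rot k F (P : pred (I * bool)) : (\sum_(x <- rot k c | P x) F x = \sum_(x <- c | P x) F x)%N.
  by apply: perm_big; rewrite perm_rot.
case=> [ntau|[k [h0 [H [h [q [ek eh leH /andP[th0 th] ntau]]]]]]].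
  left; have hb : has cut_bend c.
    apply/negPn/negP => /hasPn nb.
    have [t [x ec]] : exists t x, c = rcons t x by case/lastP: (c) c0 => // t x _; exists t, x.
    have := runs 0%N t x [::]; rewrite rot0 cats0 => /(_ ec) lt6.
    have : (6 * size c < wt x * size c)%N.
      rewrite {1}ec; apply: lt6; last by apply: ntau; rewrite ec mem_rcons mem_head.
      by move=> y yt; apply: nb; rewrite ec mem_rcons inE yt orbT.
    by rewrite ltn_pmul2r // ltnNge wt6.
  have [x xc bx] := hasP hb; have [k u ek] := rot_to xc.
  have [j ej] := rot_rotE 1 k c; rewrite ek rot1_cons in ej.
  have := key j (rcons u x) (ex_intro2 _ _ [::] (esym ej) _) _ _.
  rewrite ej big_rot size_rot ltn_pmul2r //; apply.
  - by rewrite -ej; case: (u).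
  - by move=> q' y; rewrite -ej => /rcons_inj[_ <-].
  - by move=> y; rewrite mem_rot; apply: ntau.
right; have q0 : q <> [::].
  by move=> q0; move: leH s0; rewrite -(size_rot k c) ek q0 cats0; lia.
have hc x : x \in rcons H h ++ q -> x \in c by rewrite -ek mem_rot.
split; last first.
  apply/hasP; exists h; first by apply: hc; rewrite mem_cat mem_rcons mem_head.
  rewrite th andbT; apply/negPn/negP => /cut_bend_tau => /(_ (xC _ (hc _ _))).
  case: q q0 ek ntau hc => // y q _ ek ntau hc; rewrite mem_cat mem_rcons mem_head => /(_ isT).
  rewrite (nxt_rot_cat (u := H) (y := y) (v := q) uC cinC (k := k)) ?ek ?cat_rcons //.
  by rewrite th; apply/negP; apply: ntau; rewrite mem_head.
have := key k q (ex_intro2 _ _ (rcons H h) ek q0) _ ntau; rewrite -(big_rot k) ek big_cat /=.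
set S1 := (\sum_(x <- rcons _ _ | _) _)%N; set S2 := (\sum_(x <- q | _) _)%N.
suff lastq q' x : q = rcons q' x -> cut_bend x.
  move=> /(_ lastq) lt6; have : (3 < S2)%N; last by lia.
  rewrite -(ltn_pmul2r s0); apply: leq_ltn_trans lt6.
  by move: leH; rewrite -(size_rot k c) ek size_cat; lia.
move=> eq; apply/negPn/negP => nb; have xq : x \in q by rewrite eq mem_rcons mem_head.
have := cut_bend_tau (xC _ (hc _ _)) nb; rewrite mem_cat xq orbT => /(_ isT).
have [j ej] := rot_rotE (size (rcons H h)) k c.
rewrite (nxt_rot_cat (u := q') (y := h0) (v := behead (rcons H h)) uC cinC (k := j)); last first.
  rewrite -ej ek rot_size_cat eq cat_rcons; congr (_ ++ _ :: _).
  by case: (H) eh => [|? ?] /= ->.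
by move=> e; have := ntau _ xq; rewrite -e th0.
Qed.

End Weights.

(** A corner of F along the face c is opposite to a corner of c. *)
Lemma count_bend_transfer (F : seq (I * bool)) c : uniq F -> c \in C ->
  (count (fun x => bend C x && (linv x \in c)) F <=
   count (fun z => bend C z && (linv (nxt C z) \in F)) c)%N.
Proof.
move=> uF cinC; have uc := uniq_flatten_face uC cinC.
have nz x : linv x \in c -> nxt C (prev c (linv x)) = linv x.
  by move=> x'c; rewrite (nxt_next uC cinC) ?mem_prev // next_prev.
rewrite -!size_filter -(size_map (fun x => prev c (linv x))); apply: uniq_leq_size.
  rewrite map_inj_in_uniq ?filter_uniq // => x y.
  rewrite !mem_filter => /andP[/andP[_ x'c] _] /andP[/andP[_ y'c] _] /(congr1 (nxt C)).
  by rewrite !nz // => /linv_inj.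
move=> z /mapP[x + ->]; rewrite mem_filter => /andP[/andP[bx x'c] xF].
by rewrite mem_filter nz // linvK xF -(bend_opp (nz x x'c)) bx mem_prev.
Qed.

Lemma count_breaks (F brk : seq (I * bool)) : uniq F ->
  (count (fun x => linv (nxt C x) \in brk) F <= size brk)%N.
Proof.
move=> uF; rewrite -size_filter -(size_map (fun x => linv (nxt C x))); apply: uniq_leq_size.
  by rewrite map_inj_uniq ?filter_uniq // => x y /linv_inj/(nxt_inj uC).
by move=> z /mapP[x + ->]; rewrite mem_filter => /andP[].
Qed.

End Diagrams.

Section Relators.
Variables (X : countType) (Rs : word X -> Prop).

(** What is used of the symmetrised closure of a presentation satisfying C'(1/6). *)
Record small_cancellation_relators : Prop := SmallCancellationRelators {
  relator_rot : forall k w, Rs w -> Rs (rot k w);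
  relator_winv : forall w, Rs w -> Rs (winv w);
  relator_cr : forall w, Rs w -> cyclically_reduced w;
  relator_neq0 : forall w, Rs w -> w <> [::];
  relator_piece : forall w w' p, Rs w -> Rs w' -> w <> w' -> prefix p w -> prefix p w' ->
    (6 * size p < size w)%N }.

Hypothesis RsP : small_cancellation_relators.

Variables (I : countType) (s : I * bool -> X * bool) (C : seq (word I)).
Hypothesis sV : forall a, s (linv a) = linv (s a).
Hypotheses (uC : uniq (flatten C)) (cC : forall x, x \in flatten C -> linv x \in flatten C).

(** Pairs of this kind are absent from reduced diagrams. *)
Definition mirror_faces (c c' : word I) : Prop :=
  exists x A B k k', [/\ rot k c = x :: A, rot k' c' = linv x :: B &
    map s A = winv (map s B)].

(** A face that is its own mirror image would read an inverse palindrome between two of its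
    edges, which reducedness of relators excludes. *)
Lemma mirror_self c : c \in C -> Rs (map s c) -> ~ mirror_faces c c.
Proof.
move=> cinC Rc [x [A [B [k [k' [eA eB e]]]]]].
have : linv x \in x :: A by rewrite -eA mem_rot -(mem_rot k') eB mem_head.
rewrite inE (negbTE (linv_neq x)) /= => x'A; case/splitPr: x'A eA e => A1 A2 eA e.
have [j ej] := rot_rotE (size (x :: A1)) k c.
rewrite eA -cat_cons rot_size_cat in ej.
have eB' := rot_uniq_tail (uniq_flatten_face uC cinC) (esym ej) eB.
have crA : reduced (map s (x :: A1 ++ linv x :: A2)).
  by rewrite -eA map_rot; apply: cr_reduced; apply: relator_cr => //; apply: relator_rot.
have : map s A1 = winv (map s A1).
  move: e; rewrite -eB' !map_cat winv_cat /= winv_cons cat_rcons => /eqP.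
  by rewrite eqseq_cat ?size_winv // => /andP[/eqP].
move=> /esym/reduced_winv_nil A10; have := crA.
rewrite /= map_cat => /(@reduced_cat _ [:: s x] _)[_ /reduced_cat[/A10 e0 _]].
by move: crA; rewrite /= map_cat e0 /reduced /= sV /noncancel eqxx.
Qed.

Variable cells : seq (word I).
Hypotheses (cellsC : {subset cells <= C}) (cellsR : forall c, c \in cells -> Rs (map s c)).
Hypothesis nomirror : forall c c', c \in cells -> c' \in cells -> ~ mirror_faces c c'.

(** The run is a common initial segment of two relators; were they equal, the cells would be
    mirror images. *)
Lemma cell_run c c' k k' t q q' :
    c \in cells -> c' \in cells -> t <> [::] ->
    rot k c = t ++ q -> rot k' c' = winv t ++ q' ->
  (6 * size t < size c)%N.
Proof.
move=> cc cc' t0 e e'.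
have R1 : Rs (map s t ++ map s q) by rewrite -map_cat -e map_rot; apply: relator_rot => //; exact: cellsR.
have R2 : Rs (map s t ++ winv (map s q')).
  have := relator_rot RsP (size q') (relator_winv RsP (relator_rot RsP k' (cellsR cc'))).
  rewrite -map_rot e' map_cat winv_cat -(size_map s) -(size_winv (map s q')) rot_size_cat.
  by rewrite map_winv // winvK.
have -> : size c = size (map s t ++ map s q) by rewrite -map_cat -e size_map size_rot.
rewrite -(size_map s t); apply: (relator_piece RsP R1 R2); try exact: prefix_prefix.
move=> /eqP; rewrite eqseq_cat // eqxx /= => /eqP eq.
case: (nomirror cc cc'); case: t t0 e e' {R1 R2} => // x t _ e e'.
have [j ej] := rot_rotE (size (winv t)) k' c'.
rewrite e' winv_cons cat_rcons rot_size_cat in ej.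
exists x, (t ++ q), (q' ++ winv t), k, j; split=> //.
by rewrite !map_cat winv_cat map_winv // winvK eq.
Qed.

End Relators.

(** * Removal of mirror cells *)

Lemma evw_rot1 (Y : countType) (H : groupType) (h : Y * bool -> H) k w :
  evw h (rot k w) = 1 <-> evw h w = 1.
Proof.
rewrite /rot -{3}(cat_take_drop k w) !evw_cat.
by split=> e; rewrite -(mulg1_eq e) mulVg.
Qed.

(** Solving for the common edge x makes both faces trivial: x becomes the word along the rest
    of c, and c' follows by symmetry. The label of x differs from this word by the relator
    read along c', so conjugators are changed by relators only; psi stands for the map to any
    group where this relator is trivial. *)
Lemma mirror_reduce (I X : countType) (s : I * bool -> X * bool) M D c c' :
    lifts s M D -> c \in unzip2 M -> c' \in unzip2 M -> c != c' -> mirror_faces s c c' ->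
  exists2 h : free_group I -> free_group X,
    face_prod [seq (h m.1, map s m.2) | m <- M & (m.2 != c) && (m.2 != c')] = 1 &
    forall (H : groupType) (psi : free_group X -> H),
      (forall g g', psi (g * g') = psi g * psi g') -> psi (fg (map s c')) = 1 ->
    forall g, psi (h g) = psi (letter_image s g).
Proof.
case=> sV [uM cM] M1 _ cinM c'inM ncc' [x [A [B [k [k' [eA eB e]]]]]].
pose h0 := subst_edge x (fg (map s B)) (fun a => fg [:: s a]).
have hV a : h0 (linv a) = (h0 a)^-1 by apply: subst_edgeV => b; apply: letterV.
have xc : x \in c by rewrite -(mem_rot k) eA mem_head.
have x'c' : linv x \in c' by rewrite -(mem_rot k') eB mem_head.
have outx d : d \in unzip2 M -> x \in d -> d = c by move=> dM xd; apply: face_eq uM dM cinM xd xc.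
have outx' d : d \in unzip2 M -> linv x \in d -> d = c'.
  by move=> dM xd; apply: face_eq uM dM c'inM xd x'c'.
have eh0 w : x \notin w -> linv x \notin w -> evw h0 w = fg (map s w).
  move=> xw x'w; rewrite subst_edge_out //; elim: (w) => //= a w' ->.
  by rewrite -fg_cat.
have hx : h0 x = fg (map s B) by rewrite /h0 /subst_edge eqxx.
have nx'c : linv x \notin c by apply/negP => /(outx' _ cinM) ec; rewrite ec eqxx in ncc'.
have nxc' : x \notin c' by apply/negP => /(outx _ c'inM) ec; rewrite ec eqxx in ncc'.
have hc : evw h0 c = 1.
  apply/(@evw_rot1 _ _ _ k); rewrite eA /= hx eh0 ?e; first by rewrite fg_winv mulgV.
    by have := uniq_flatten_face uM cinM; rewrite -(rot_uniq k) eA => /andP[].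
  by apply: contra nx'c => x'A; rewrite -(mem_rot k) eA inE x'A orbT.
have hc' : evw h0 c' = 1.
  apply/(@evw_rot1 _ _ _ k'); rewrite eB /= hV hx eh0; first by rewrite mulVg.
    by apply: contra nxc' => xB; rewrite -(mem_rot k') eB inE xB orbT.
  by have := uniq_flatten_face uM c'inM; rewrite -(rot_uniq k') eB => /andP[].
exists (evg h0).
  have := congr1 (evg h0) M1; rewrite evg1 /face_prod bprod_morph ?evg1 //; first last.
  - exact: evgV.
  - exact: evgM.
  rewrite -map_comp => L1; rewrite -[RHS]L1 /face_prod -map_comp.
  rewrite -[in RHS](@bprod_filter _ _ _ (fun m => (m.2 != c) && (m.2 != c'))) => [|m mM] /=.
    congr bprod; apply/eq_in_map => m; rewrite mem_filter => /andP[/andP[mc mc'] mM] /=.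
    have m2M : m.2 \in unzip2 M by apply: map_f.
    rewrite evg_fg // eh0 //.
      by apply: contra mc => /(outx _ m2M) ->.
    by apply: contra mc' => /(outx' _ m2M) ->.
  by rewrite evg_fg // negb_and !negbK => /orP[/eqP->|/eqP->].
move=> H psi psiM psic' g.
have psi1 : psi 1 = 1.
  by apply: (mulgI (psi 1)); rewrite -psiM !mulg1.
rewrite /letter_image !evg_morph //; apply: eq_in_evw => a _ /=.
have psi_word w : psi (fg (map s w)) = evw (fun a => psi (fg [:: s a])) w.
  by elim: w => //= b w <-; rewrite -psiM -fg_cat.
have psix : psi (fg (map s B)) = psi (fg [:: s x]).
  move: psic'; rewrite psi_word => /(@evw_rot1 _ _ _ k').
  rewrite eB /= sV -[[:: linv _]]/(winv [:: s x]) -psi_word -psiM.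
  by move=> /(congr1 (fun k => psi (fg [:: s x]) * k)); rewrite -psiM fg_winv mulKVg mulg1.
rewrite /h0 /subst_edge; case: eqP => [->|_]; first exact: psix.
case: eqP => [->|//]; rewrite sV -[[:: linv _]]/(winv [:: s x]) fg_winv.
apply: (mulgI (psi (fg (map s B)))); rewrite -psiM mulgV psix -psiM mulgV //.
Qed.

(** * Dehn reduced words and disc diagrams *)

Lemma first_last (T : Type) (p : pred T) s : has p s ->
  (exists u a v, [/\ s = u ++ a :: v, p a, ~~ has p u & ~~ has p v]) \/
  (exists u a w b v, [/\ s = u ++ a :: w ++ b :: v, p a && p b, ~~ has p u & ~~ has p v]).
Proof.
move=> hs; case: (split_find hs) => a u v pa nu; have [pv|nv] := boolP (has p v); last first.
  by left; exists u, a, v; rewrite cat_rcons.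
rewrite -(revK v) has_rev in pv *; case: (split_find pv) => b w z pb nw.
right; exists u, a, (rev z), b, (rev w); split; rewrite ?pa ?has_rev //.
by rewrite cat_rcons rev_cat rev_rcons.
Qed.

Section DehnReduced.
Variables (X : countType) (Rs : word X -> Prop).
Hypothesis RsP : small_cancellation_relators Rs.
Implicit Types (x y w rho sigma : word X).

Definition dehn_reduced x : Prop :=
  reduced x /\ forall y w, infix y x -> Rs w -> infix y w -> (2 * size y <= size w)%N.

Lemma dehn_reduced_infix y x : infix y x -> dehn_reduced x -> dehn_reduced y.
Proof.
move=> yx [rx dx]; split; first exact: reduced_infix yx rx.
by move=> z w zy; apply: dx; apply: infix_trans zy yx.
Qed.

(** The list y :: cs is a diagram on the sphere; outside of y it is a disc. *)
Definition disk m y : Prop :=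
  exists cs, [/\ size cs = m, forall c, c \in cs -> Rs c & nullw (y :: cs)].

Lemma disk_eq m y z : fg y = fg z -> disk m y -> disk m z.
Proof. by move=> yz [cs [sz Rcs n]]; exists cs; split=> //; move: n; rewrite /nullw /= yz. Qed.

Lemma disk_catC m y z : disk m (y ++ z) -> disk m (z ++ y).
Proof. by move=> [cs [sz Rcs n]]; exists cs; split=> //; apply: nullw_catC. Qed.

Lemma relator_reduced w : Rs w -> reduced w.
Proof. by move=> /(relator_cr RsP); apply: cr_reduced. Qed.

Section Labels.
Variables (I : countType) (s : I * bool -> X * bool).
Hypothesis sV : forall a, s (linv a) = linv (s a).

Lemma nullw_map (C : seq (word I)) : nullw C -> nullw (map (map s) C).
Proof.
move=> nC; have := @nullg_morph _ _ (letter_image s) _ (letter_imageM sV) (evg1 _) (letter_imageV sV) nC.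
by rewrite /nullw -!map_comp; congr nullg; apply: eq_map => c; rewrite /= letter_image_fg.
Qed.

(** The disc cut off by two common edges is degenerate, so the interval of the relator between
    the edges is the inverse of a subword of the Dehn reduced word. The alternative would put
    cancelling letters next to each other. *)
Lemma cut_interval_le a b A2 B1 B2 :
    dehn_reduced (map s (a :: A2 ++ [:: b])) ->
    Rs (map s (linv b :: B2 ++ linv a :: B1)) ->
    map s A2 = winv (map s B2) \/ map s A2 = map s (linv a :: B1 ++ [:: linv b]) ->
  (2 * size (rcons (linv b :: B2) (linv a)) <= size (linv b :: B2 ++ linv a :: B1))%N.
Proof.
move=> [rA dA] Rc [e|e]; last first.
  by move: rA; rewrite /= map_cat e /= sV /reduced /= /noncancel eqxx.
have eH : map s (a :: A2 ++ [:: b]) = winv (map s (rcons (linv b :: B2) (linv a))).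
  rewrite /= !map_cat map_rcons e winv_cons winv_rcons /= !sV !linvK.
  by rewrite -cats1.
have := dA _ _ (infix_refl _) (relator_winv RsP Rc); rewrite eH !size_winv !size_map; apply.
apply/infixP; exists (winv (map s B1)), [::].
by rewrite cats0 -winv_cat -map_cat rcons_cons cat_cons cat_rcons.
Qed.

End Labels.

(** The disc cut off by two edges is a closed system, so that the edges with one side on A2
    have the other one inside the disc. *)
Lemma cut_closed (I : countType) a b A1 A2 B1 B2 (rest : seq (word I)) m1 (z : I * bool) :
    uniq (flatten [:: a :: A2 ++ b :: A1, linv b :: B2 ++ linv a :: B1 & rest]) ->
    nullw ((B2 ++ A2) :: mask m1 rest) ->
    linv z \in A2 -> z \in linv b :: B2 ++ linv a :: B1 -> z \in B2.
Proof.
move=> uC nD zA zc; have yD : linv z \in flatten ((B2 ++ A2) :: mask m1 rest).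
  by rewrite /= !mem_cat zA orbT.
have := nullw_closed nD yD; rewrite linvK /= !mem_cat => /orP[/orP[//|zA']|zM].
  move: uC; rewrite -[flatten _]/((a :: A2 ++ b :: A1) ++ (linv b :: B2 ++ linv a :: B1) ++ flatten rest).
  rewrite cat_uniq => /and3P[_ /hasPn nA _]; have := nA z; rewrite mem_cat zc => /(_ isT).
  by rewrite inE mem_cat zA' orbT.
have zr : z \in flatten rest.
  by case/flattenP: zM => c /mem_mask cr zc'; apply/flattenP; exists c.
move: uC; rewrite -[flatten _]/((a :: A2 ++ b :: A1) ++ (linv b :: B2 ++ linv a :: B1) ++ flatten rest).
rewrite cat_uniq => /and3P[_ _]; rewrite cat_uniq => /and3P[_ /hasPn nB _].
by have := nB z zr; rewrite zc.
Qed.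

End DehnReduced.

(** * Reduced disc diagrams *)

(** A vertex of degree one would give a cancelling pair of labels. *)
Lemma label_nxt_neq (I X : countType) (s : I * bool -> X * bool) (C : seq (word I)) c x :
    (forall a, s (linv a) = linv (s a)) -> uniq (flatten C) -> c \in C ->
    cyclically_reduced (map s c) -> x \in c -> nxt C x != linv x.
Proof.
move=> sV uC cinC; rewrite /cyclically_reduced cycle_map => crc xc; apply/eqP => e.
have := next_cycle crc xc; rewrite -(nxt_next uC cinC xc) e /= sV.
by rewrite /noncancel eqxx.
Qed.

Lemma flat_run_prefix (I : countType) (C : seq (word I)) (brk : seq (I * bool)) c k t z v :
    uniq (flatten C) -> c \in C -> rot k c = rcons t z ++ v ->
    {in t, forall y, ~~ cut_bend C brk y} ->
  (forall u x y w, rcons t z = u ++ x :: y :: w -> ~~ bend C x) /\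
  (forall u y w, winv (rcons t z) = u ++ y :: w -> w <> [::] -> y \notin brk).
Proof.
move=> uC cinC e nb.
have int u x y w : rcons t z = u ++ x :: y :: w -> x \in t.
  case/lastP: w => [|w y'].
    by rewrite -cat_rcons cats1 => /rcons_inj[-> _]; rewrite mem_rcons mem_head.
  by rewrite -!rcons_cons -rcons_cat => /rcons_inj[-> _]; rewrite mem_cat mem_head orbT.
split=> [u x y w ez|u y [//|y2 w] ez _].
  by have := nb x (int _ _ _ _ ez); rewrite negb_or => /andP[].
have ez' : rcons t z = winv w ++ linv y2 :: linv y :: winv u.
  by rewrite -[LHS]winvK ez winv_cat !winv_cons -cat_rcons cat_rcons -cat_rcons.
have := nb (linv y2) (int _ _ _ _ ez'); rewrite negb_or => /andP[_].
rewrite (nxt_rot_cat (u := winv w) (y := linv y) (v := winv u ++ v) uC cinC (k := k)) ?linvK //.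
by rewrite e ez' -catA.
Qed.

Lemma mem_split (T : eqType) (x : T) s : x \in s -> exists u v, s = u ++ x :: v.
Proof. by move=> /splitPr[u v]; exists u, v. Qed.

Lemma leq_count_flatten (T : Type) (P Q : pred T) n (L : seq (seq T)) :
  all (fun c => n <= count P c + count Q c)%N L ->
  (n * size L <= count P (flatten L) + count Q (flatten L))%N.
Proof.
elim: L => [|c L IHL] /=; first by rewrite muln0.
by case/andP => le1 /IHL le2; rewrite mulnS !count_cat addnACA leq_add.
Qed.

Lemma count_andb (T : Type) (P Q : pred T) (L : seq T) :
  count P L = (count (fun x => P x && Q x) L + count (fun x => P x && ~~ Q x) L)%N.
Proof. by elim: L => //= x L ->; case: (P x); case: (Q x); rewrite /= ?addnS ?addSn. Qed.

Lemma leq_count_or (T : Type) (P Q : pred T) (L : seq T) :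
  (count (fun x => P x || Q x) L <= count P L + count Q L)%N.
Proof. by rewrite -[leqLHS]/(count (predU P Q) L) -count_predUI leq_addr. Qed.

(** The disc has the boundary xt rt, where rt reads the beginning of the relator (map s rt) sigma.
    The hypothesis [nomirror_rt] forbids that a cell at rt is the mirror image of this relator. *)
Section Bigon.
Variables (X : countType) (Rs : word X -> Prop).
Hypothesis RsP : small_cancellation_relators Rs.
Variables (I : finType) (s : I * bool -> X * bool).
Hypothesis sV : forall a, s (linv a) = linv (s a).
Variables (xt rt : word I) (sigma : word X) (cells : seq (word I)).
Let o := xt ++ rt.
Let C := o :: cells.
Hypotheses (qC : quadratic C) (nC : nullw C) (o0 : o <> [::]).
Hypothesis cellsR : forall c, c \in cells -> Rs (map s c).
Hypothesis cr_o : cyclically_reduced (map s o).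
Hypothesis dx : dehn_reduced Rs (map s xt).
Hypothesis Rrho : Rs (map s rt ++ sigma).
Hypothesis nomirror : forall c c', c \in cells -> c' \in cells -> c <> c' -> ~ mirror_faces s c c'.
Hypothesis nomirror_rt : forall c k r1 d r2 B, c \in cells -> rt = r1 ++ d :: r2 ->
  rot k c = linv d :: B -> map s B <> winv (map s r2 ++ sigma ++ map s r1).
Hypothesis smaller : forall m x rho tau, (m < size cells)%N -> dehn_reduced Rs x -> Rs (rho ++ tau) ->
  disk Rs m (x ++ rho) -> x = winv rho \/ x = tau.

Let uC : uniq (flatten C) := proj1 qC.
Let cC : forall x, x \in flatten C -> linv x \in flatten C := proj2 qC.
Let oC : o \in C := mem_head _ _.

Let lasts (w : word I) := if w is y :: w' then [:: last y w'] else [::].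
Let brk := lasts xt ++ lasts rt.
Let tau : pred (I * bool) := fun y => y \in xt.

Lemma bigon_cellsC : {subset cells <= C}.
Proof. by move=> c cc; rewrite inE cc orbT. Qed.

Lemma bigon_lasts w z : lasts (rcons w z) = [:: z].
Proof. by case: w => //= y w; rewrite last_rcons. Qed.

Lemma bigon_tau_nxt y : y \in flatten C -> y \notin brk -> tau (nxt C y) = tau y.
Proof.
move=> yC nb; rewrite /tau.
have [yo|yo] := boolP (y \in o); last first.
  have nyo : nxt C y \notin o by rewrite nxt_mem.
  by move: yo nyo; rewrite !mem_cat !negb_or => /andP[/negbTE-> _] /andP[/negbTE-> _].
have uo := uniq_flatten_face uC oC.
have [yx|yx] := boolP (y \in xt).
  have [x1 [x2 ex]] := mem_split yx; case: x2 ex => [|z x2] ex.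
    by move: nb; rewrite /brk ex cats1 bigon_lasts inE eqxx.
  rewrite (nxt_cat (u := x1) (y := z) (v := x2 ++ rt) uC); first by rewrite ex mem_cat !inE eqxx !orbT.
  by rewrite inE /o ex -catA eqxx.
have yr : y \in rt by move: yo; rewrite mem_cat (negbTE yx).
have [r1 [r2 er]] := mem_split yr; case: r2 er => [|z r2] er.
  by move: nb; rewrite /brk er cats1 bigon_lasts mem_cat inE eqxx orbT.
rewrite (nxt_cat (u := xt ++ r1) (y := z) (v := r2) uC); last by rewrite inE /o er -catA eqxx.
move: uo; rewrite cat_uniq => /and3P[_ /hasPn/(_ z) nz _]; apply: negbTE; apply: nz.
by rewrite er mem_cat !inE eqxx !orbT.
Qed.

Lemma bigon_self c : c \in cells -> ~ mirror_faces s c c.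
Proof. by move=> cc; exact: (mirror_self RsP sV uC (bigon_cellsC cc) (cellsR cc)). Qed.

Lemma bigon_nomirror c c' : c \in cells -> c' \in cells -> ~ mirror_faces s c c'.
Proof.
move=> cc cc'; have [->|/eqP ne] := eqVneq c c'; first exact: bigon_self.
exact: nomirror.
Qed.

(** A run outside xt faces one cell or the arc rt. In both cases it is a piece, as mirror
    images are excluded. *)
Lemma bigon_run c k t z v : c \in cells -> rot k c = rcons t z ++ v ->
  {in t, forall y, ~~ cut_bend C brk y} -> ~~ tau (linv z) ->
  (6 * size (rcons t z) < size c)%N.
Proof.
move=> cc e nb ntau; have cinC := bigon_cellsC cc.
have [nbend nbrk] := flat_run_prefix uC cinC e nb.
have tz0 : rcons t z <> [::] by case: (t).
have [c' [k' [q' [c'C e']]]] := run_mirror uC cC cinC tz0 e nbend.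
move: c'C; rewrite inE => /orP[/eqP c'o|cc']; last first.
  exact: (cell_run RsP sV cellsR bigon_nomirror cc cc' tz0 e e').
rewrite c'o in e'; have uo := uniq_flatten_face uC oC.
have lr (A' w : word I) y : w = rcons A' y -> y \in lasts w.
  by move=> ->; rewrite bigon_lasts inE.
have [] := infix_of_rot (brk := brk) uo e' _ _ nbrk.
- by move=> A' y /lr; rewrite mem_cat => ->.
- by move=> A' y /lr; rewrite mem_cat orbC => ->.
- move=> /mem_infix/(_ (linv z)); rewrite winv_rcons mem_head => /(_ isT).
  by move: ntau; rewrite /tau => /negbTE->.
move=> /infixP[r1 [r2 er]].
have R1 : Rs (map s (rcons t z) ++ map s v).
  by rewrite -map_cat -e map_rot; apply: relator_rot => //; exact: cellsR.
pose w2 := winv (map s r1) ++ winv sigma ++ winv (map s r2).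
have R2 : Rs (map s (rcons t z) ++ w2).
  have := relator_rot RsP (size (winv sigma ++ winv (map s r2))) (relator_winv RsP Rrho).
  rewrite er !map_cat !winv_cat -(catA (winv (map s r2))) (catA (winv sigma)) rot_size_cat map_winv // winvK.
  by rewrite -!catA.
have -> : size c = size (map s (rcons t z) ++ map s v) by rewrite -map_cat -e size_map size_rot.
rewrite -(size_map s (rcons t z)); apply: (relator_piece RsP R1 R2); try exact: prefix_prefix.
move=> /eqP; rewrite eqseq_cat // eqxx /= => /eqP ev.
have [y [t' et]] : exists y t', rcons t z = y :: t' by case: (t) => [|y t']; [exists z, [::]|exists y, (rcons t' z)].
rewrite et in e er ev.
have er' : rt = (r1 ++ winv t') ++ linv y :: r2 by rewrite er winv_cons cat_rcons -catA.
apply: (nomirror_rt cc er' (k := k) (B := t' ++ v)); first by rewrite linvK e.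
by rewrite map_cat ev /w2 !map_cat !winv_cat map_winv // winvK -!catA.
Qed.

(** Let a and b be the first and the last edge of xt in contact with c. They cut off a smaller
    disc, bounded by a part of xt and a part of c, to which the induction hypothesis applies. *)
Lemma bigon_hull c : c \in cells ->
  (forall z, z \in c -> ~~ tau (linv z)) \/
  (exists k h0 H h q, [/\ rot k c = rcons H h ++ q, head h0 (rcons H h) = h0,
     (2 * size (rcons H h) <= size c)%N, tau (linv h0) && tau (linv h) &
     forall z, z \in q -> ~~ tau (linv z)]).
Proof.
move=> cc; have cinC := bigon_cellsC cc; have uc := uniq_flatten_face uC cinC.
have uo := uniq_flatten_face uC oC.
have [hp|np] := boolP (has (fun y => linv y \in c) xt); last first.
  left=> z zc; apply: contra np => zx; apply/hasP; exists (linv z) => //.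
  by rewrite linvK.
have contact z : z \in c -> tau (linv z) -> linv (linv z) \in c by rewrite linvK.
right; case: (first_last hp) => [[x1 [a [x2 [ex ac n1 n2]]]]|[x1 [a [A2 [b [x3 [ex /andP[ac bc] n1 n3]]]]]]].
  have [k B eB] := rot_to ac; exists k, (linv a), [::], (linv a), B.
  have ax : a \in xt by rewrite ex mem_cat mem_head orbT.
  split=> //.
  - have ia : infix (map s [:: a]) (map s xt).
      by apply/infixP; exists (map s x1), (map s x2); rewrite ex map_cat.
    have Rc : Rs (winv (map s (linv a :: B))).
      by apply: relator_winv RsP _ _; rewrite -eB map_rot; apply: relator_rot => //; exact: cellsR.
    have ii : infix (map s [:: a]) (winv (map s (linv a :: B))).
      by apply/infixP; exists (winv (map s B)), [::]; rewrite /= winv_cons sV linvK cats1.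
    by have := (dx).2 _ _ ia Rc ii; rewrite size_winv !size_map -eB size_rot.
  - by rewrite linvK /tau ax.
  move=> z zB; apply/negP => zx; have zc : z \in c by rewrite -(mem_rot k) eB inE zB orbT.
  move: (zx); rewrite /tau ex mem_cat inE => /or3P[z1|/eqP za|z2].
  - by case/hasP: n1; exists (linv z) => //; apply: contact.
  - move: uc; rewrite -(rot_uniq k) eB -za linvK /= zB //.
  - by case/hasP: n2; exists (linv z) => //; apply: contact.
have ax : a \in xt by rewrite ex mem_cat mem_head orbT.
have bx : b \in xt by rewrite ex mem_cat inE mem_cat mem_head !orbT.
have ab : linv a != linv b.
  rewrite (inj_eq (@linv_inj _)); apply: contraTneq uo => eab.
  by rewrite /o ex eab -catA cat_uniq cat_cons [uniq (_ :: _)]/= !(mem_cat, inE) eqxx !orbT /= !andbF.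
have [k B eB] := rot_to bc.
have : linv a \in linv b :: B by rewrite -eB mem_rot.
rewrite inE (negbTE ab) /= => /mem_split[B2 [B1 eB']]; rewrite {B}eB' in eB.
pose A1 := x3 ++ rt ++ x1.
pose rest := rem c cells.
have pC : perm_eq C [:: o, c & rest] by rewrite perm_cons perm_to_rem.
have ero : rot (size x1) o = a :: A2 ++ b :: A1.
  by rewrite /o ex -catA rot_size_cat /= -!catA.
have nD : nullw [:: a :: A2 ++ b :: A1, linv b :: B2 ++ linv a :: B1 & rest].
  have := nullw_perm pC nC; rewrite -(nullw_rot (size x1)) ero => /nullw_swap.
  by rewrite -(nullw_rot k) eB => /nullw_swap.
have uD : uniq (flatten [:: a :: A2 ++ b :: A1, linv b :: B2 ++ linv a :: B1 & rest]).
  rewrite -ero -eB /= (perm_uniq (_ : perm_eq _ (flatten [:: o, c & rest]))).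
    by rewrite -(perm_uniq (perm_flatten pC)).
  by apply: perm_cat; rewrite ?perm_rot // perm_cat2r perm_rot.
have [m1 [m2 [sm1 _ _ nX _]]] := nullw_cut uD nD.
have Rc : Rs (map s (linv b :: B2 ++ linv a :: B1)).
  by rewrite -eB map_rot; apply: relator_rot => //; exact: cellsR.
have dA : dehn_reduced Rs (map s (a :: A2 ++ [:: b])).
  apply: dehn_reduced_infix dx; apply/infixP; exists (map s x1), (map s x3).
  by rewrite ex -!map_cat /= -catA.
have cases : map s A2 = winv (map s B2) \/ map s A2 = map s (linv a :: B1 ++ [:: linv b]).
  apply: (smaller (m := size (mask m1 rest))).
  - rewrite size_mask // (leq_ltn_trans (count_size _ _)) // sm1 size_rem //.
    by rewrite ltn_predL; case: (cells) cc.
  - by apply: dehn_reduced_infix dA; apply/infixP; exists [:: s a], [:: s b]; rewrite /= map_cat.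
  - rewrite -map_cat; have := relator_rot RsP 1 Rc; rewrite -map_rot /= rot1_cons.
    by rewrite rcons_cat /= -cats1.
  exists (map (map s) (mask m1 rest)); split; rewrite ?size_map //.
    by move=> _ /mapP[d /mem_mask dr ->]; apply: cellsR; apply: mem_rem dr.
  by apply: nullw_catC; rewrite -map_cat; apply: (nullw_map sV nX).
exists k, (linv b), (linv b :: B2), (linv a), B1; split=> //.
- by rewrite eB /= cat_rcons.
- by rewrite -(size_rot k c) eB; apply: cut_interval_le dA Rc cases.
- by rewrite !linvK /tau ax bx.
move=> z zB; apply/negP => zx.
have zcD : z \in linv b :: B2 ++ linv a :: B1 by rewrite inE mem_cat inE zB !orbT.
have zc : z \in c by rewrite -(mem_rot k) eB.
have := uc; rewrite -(rot_uniq k) eB -cat_cons cat_uniq => /and3P[_ /hasPn nB uB].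
have nB2 : z \notin linv b :: B2 by apply: nB; rewrite inE zB orbT.
move: (zx); rewrite /tau ex mem_cat inE mem_cat inE => /or3P[z1|/eqP za|/or3P[zA|/eqP zb|z3]].
- by case/hasP: n1; exists (linv z) => //; apply: contact.
- by move: uB; rewrite /= -za linvK zB.
- by have := cut_closed uD nX zA zcD; move: nB2; rewrite inE negb_or => /andP[_ /negbTE->].
- by move: nB2; rewrite -zb linvK mem_head.
- by case/hasP: n3; exists (linv z) => //; apply: contact.
Qed.

(** Counting corners along xt twice, each cell has weight at least 6: by [cell_weight] it has
    4 outside xt and 2 at the end of its contact with xt, or 7 outside. The corners that do
    not come from [curvature] are the at most 2 + 2 caused by the two breaks, and a bigon
    leaves room for 6 * #cells - 6 only. *)
Lemma bigon_contradiction : False.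
Proof.
pose F := flatten cells.
have uF : uniq F by move: uC; rewrite /C /= cat_uniq => /and3P[].
have weights : (6 * size cells <=
   count (cut_bend C brk) F + count (fun x => cut_bend C brk x && tau (linv x)) F)%N.
  apply: leq_count_flatten; apply/allP => c cc.
  have cinC := bigon_cellsC cc.
  have c0 : c <> [::] by move=> e; apply: (relator_neq0 RsP (cellsR cc)); rewrite e.
  have runs k t z v : rot k c = rcons t z ++ v -> {in t, forall y, ~~ cut_bend C brk y} ->
    ~~ tau (linv z) -> (6 * size (rcons t z) < 1 * size c)%N.
    by rewrite mul1n; apply: bigon_run.
  have := cell_weight uC cC bigon_tau_nxt (wt := fun=> 1%N) cinC c0 (fun=> isT) runs (bigon_hull cc).
  rewrite sum1_count has_count (count_andb (cut_bend C brk) (fun x => tau (linv x)) c).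
  by move: (count _ c) (count _ c); clear; lia.
have brk2 : (size brk <= 2)%N by rewrite /brk; case: (xt) => [|? ?]; case: (rt).
have breaks := leq_trans (count_breaks uC brk uF) brk2.
have bend1 : (count (cut_bend C brk) F <= count (bend C) F + 2)%N.
  by apply: leq_trans (leq_count_or _ _ _) _; rewrite leq_add2l.
have bend2 : (count (fun x => cut_bend C brk x && tau (linv x)) F <= count (bend C) o + 2)%N.
  have sub : subpred (fun x => cut_bend C brk x && tau (linv x))
     (fun x => (bend C x && (linv x \in o)) || (linv (nxt C x) \in brk)).
    move=> x /andP[/orP[bx tx|->]]; last by rewrite orbT.
    by rewrite bx mem_cat [_ \in xt]tx.
  apply: leq_trans (sub_count sub _) _; apply: leq_trans (leq_count_or _ _ _) _.
  apply: leq_add breaks; apply: leq_trans (count_bend_transfer uC uF oC) _.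
  by apply: sub_count => z /andP[].
have nilC : [::] \notin C.
  rewrite inE negb_or; apply/andP; split; first by apply/eqP => /esym.
  by apply/negP => /cellsR /(relator_neq0 RsP).
have degC x : x \in flatten C -> nxt C x != linv x.
  move=> /flattenP[c cinC xc]; apply: (label_nxt_neq sV uC cinC) xc.
  move: cinC; rewrite inE => /orP[/eqP-> //|/cellsR]; exact: relator_cr.
have C0 : C <> [::] by [].
have := curvature qC nC C0 nilC degC; rewrite /= count_cat -/F.
move: weights bend1 bend2; move: (count _ F) (count _ F) (count _ F) (count _ o) (size cells).
by clear; lia.
Qed.

End Bigon.

(** * Dehn's algorithm *)

Section DehnAlgorithm.
Variables (X : countType) (Rs : word X -> Prop).
Hypothesis RsP : small_cancellation_relators Rs.
Implicit Types (x y w rho sigma : word X).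

(** If the assertion fails, a minimal diagram has no mirror pair, also not between a cell and
    the cell that rho begins to describe: in the latter case the cell is removed by replacing
    rho with sigma^-1. *)
Lemma dehn_bigon_cr m x rho sigma :
    (forall m' x' rho' sigma', (m' < m)%N -> dehn_reduced Rs x' -> Rs (rho' ++ sigma') ->
       disk Rs m' (x' ++ rho') -> x' = winv rho' \/ x' = sigma') ->
    dehn_reduced Rs x -> Rs (rho ++ sigma) -> disk Rs m (x ++ rho) ->
    cyclically_reduced (x ++ rho) -> x ++ rho <> [::] ->
  x = winv rho \/ x = sigma.
Proof.
move=> IH dx Rr [cs [sz Rcs /nullwP[D eD D1]]] cr0 n0; apply: contrapT => ncon.
have [n [s [M lM]]] := lifting D1; have [sV qC M1 eM] := lM.
have eMD : map (map s) (unzip2 M) = (x ++ rho) :: cs by rewrite -eD -eM /unzip2 -!map_comp.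
case: M lM eMD {eM} qC M1 => [|[g o] Mc] //= lM [eo ec] qC M1.
have [ext ert] := map_eq_cat eo; move: (cat_take_drop (size x) o) ext ert.
move: (take _ o) (drop _ o) => xt rt eo' ext ert.
set cells := unzip2 Mc in ec qC.
have cellsR c : c \in cells -> Rs (map s c) by move=> cc; apply: Rcs; rewrite -ec map_f.
have sc : size cells = m by rewrite -sz -ec !size_map.
have nC : nullw (o :: cells) by apply/nullwP; exists ((g, o) :: Mc).
have uC := proj1 qC.
have o0 : o <> [::] by move=> e; apply: n0; rewrite -eo e.
have oncell c : c \in cells -> o != c.
  move=> cc; apply/eqP => e; case: (o) o0 (uC) e => // z o' _ uzo e.
  move: uzo; rewrite [flatten _]/= -cat_cons cat_uniq => /and3P[_ /hasPn/(_ z) nz _].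
  have : z \in flatten cells by apply/flattenP; exists c; rewrite // -e mem_head.
  by move/nz; rewrite mem_head.
have not_disk m' : (m' < m)%N -> ~ disk Rs m' (x ++ rho).
  by move=> lt dm; apply: ncon; apply: IH lt dx Rr dm.
apply: (@bigon_contradiction X Rs RsP _ s sV xt rt sigma cells); rewrite ?eo' ?eo ?ext ?ert //.
- move=> c c' cc cc' ncc' mir.
  have cM : c \in unzip2 ((g, o) :: Mc) by rewrite inE cc orbT.
  have cM' : c' \in unzip2 ((g, o) :: Mc) by rewrite inE cc' orbT.
  have [h h1 _] := mirror_reduce lM cM cM' (introN eqP ncc') mir.
  move: h1; rewrite /= (oncell c) // (oncell c') //= => h1.
  set Mf := [seq m <- Mc | _] in h1.
  apply: (not_disk (size Mf)).
    rewrite -sc /cells size_map size_filter -(count_predC (fun m => (m.2 != c) && (m.2 != c')) Mc).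
    rewrite -[X in (X < _)%N]addn0 ltn_add2l -has_count; apply/hasP.
    by case/mapP: cc => e eM ece; exists e => //=; rewrite -ece eqxx.
  exists [seq map s m.2 | m <- Mf]; split; rewrite ?size_map //.
    move=> _ /mapP[m' mM ->]; apply: cellsR; apply: map_f; move: mM; rewrite mem_filter.
    by case/andP.
  apply/nullwP; exists [seq (h m.1, map s m.2) | m <- (g, o) :: Mf] => //.
  by rewrite /= eo /unzip2 -map_comp.
- move=> c k r1 d r2 B cc ert' eB eB'.
  pose u := r2 ++ xt ++ r1; pose rest := rem c cells.
  have pC : perm_eq (o :: cells) [:: o, c & rest] by rewrite perm_cons perm_to_rem.
  have eo2 : rot (size (xt ++ r1)) o = d :: u.
    by rewrite -eo' ert' catA rot_size_cat.
  have nD : nullw [:: d :: u, linv d :: B & rest].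
    have := nullw_perm pC nC; rewrite -(nullw_rot (size (xt ++ r1))) eo2 => /nullw_swap.
    by rewrite -(nullw_rot k) eB => /nullw_swap.
  have uD : uniq (d :: linv d :: u ++ B ++ flatten rest).
    rewrite (perm_uniq (_ : perm_eq _ (flatten [:: o, c & rest]))).
      by rewrite -(perm_uniq (perm_flatten pC)).
    apply: (perm_trans (y := (d :: u) ++ (linv d :: B) ++ flatten rest)).
      by rewrite cat_cons perm_cons perm_sym (perm_catCA u [:: linv d]).
    by rewrite -eo2 -eB; apply: perm_cat; rewrite ?perm_rot // perm_cat2r perm_rot.
  move: uD; rewrite /= inE negb_or -andbA => /and4P[_ du d'u _].
  have := nullw_map sV (nullw_merge du d'u nD); rewrite /= !map_cat eB' !winv_cat -!catA ext => nE.
  have : disk Rs m.-1 (x ++ winv sigma).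
    apply: disk_catC; apply: (@disk_eq _ _ _ ((winv sigma ++ x ++ map s r1) ++ winv (map s r1))).
      by rewrite !fg_cat !fg_winv !mulgA mulgK.
    apply: disk_catC; exists (map (map s) rest); split; last first.
    - move: nE; rewrite /nullw /= !fg_cat fg_winv; congr (nullg (_ :: _)).
      by rewrite !fg_winv !mulgA mulgVK.
    - by move=> _ /mapP[e /mem_rem er ->]; apply: cellsR.
    - by rewrite size_map size_rem // sc.
  have m0 : (m.-1 < m)%N by rewrite -sc; case: (cells) cc.
  have Rw : Rs (winv sigma ++ winv rho) by rewrite -winv_cat; apply: relator_winv.
  move=> /(IH _ _ _ _ m0 dx Rw); rewrite winvK => -[ex|ex]; apply: ncon; by [right|left].
- by move=> m' x' rho' tau lt; apply: IH; rewrite -sc.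
Qed.

Lemma reduced_not_cr w : reduced w -> w <> [::] -> ~~ cyclically_reduced w ->
  exists c v, w = linv c :: rcons v c.
Proof.
case: w => // h t rw _; case/lastP: t rw => [|t l] rw.
  by rewrite /cyclically_reduced /= /noncancel eq_sym (negbTE (linv_neq h)).
rewrite /cyclically_reduced /= rcons_path; move: rw; rewrite /reduced /= => -> /=.
by rewrite last_rcons negbK => /eqP ->; exists l, t.
Qed.

Lemma disk_conj_letter m c w : disk Rs m (linv c :: rcons w c) -> disk Rs m w.
Proof.
rewrite -cats1 -cat1s => /disk_catC; rewrite -catA /= -{2}(linvK c) => /disk_eq; apply.
by rewrite linvK fg_cancel cats0.
Qed.

(** Induction on the number of cells, then on the length of the boundary. A letter that
    cancels between x and rho is moved away; this keeps the hypotheses, because rho and sigma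
    are parts of one cyclic word. *)
Theorem dehn_bigon m x rho sigma :
    dehn_reduced Rs x -> Rs (rho ++ sigma) -> disk Rs m (x ++ rho) ->
  x = winv rho \/ x = sigma.
Proof.
elim/ltn_ind: m x rho sigma => m IHm x rho sigma.
have [n] := ubnP (size x + size rho)%N; elim: n x rho sigma => // n IHn x rho sigma le_n dx Rr dm.
have rr : reduced rho by have [] := reduced_cat (relator_reduced RsP Rr).
have rs : reduced sigma by have [] := reduced_cat (relator_reduced RsP Rr).
have rx := dx.1.
suff : fg x = fg (winv rho) \/ fg x = fg sigma.
  by case=> /fg_inj e; [left|right]; apply: e; rewrite ?reduced_winv.
have [cr|ncr] := boolP (cyclically_reduced (x ++ rho)).
  have [e|/eqP n0] := eqVneq (x ++ rho) [::].
    by move: e; case: (x) (rho) => [|? ?] [|? ?] //= _; left.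
  have [m' x' rho' sigma' lt| ->|->] := dehn_bigon_cr _ dx Rr dm cr n0; by [exact: IHm|left|right].
have [ex|/eqP x0] := eqVneq x [::].
  rewrite {}ex in dm ncr le_n dx *.
  have [|c [v er]] := reduced_not_cr rr _ ncr; first by move=> e; rewrite e in ncr.
  rewrite er in dm Rr *.
  have Rv : Rs (v ++ c :: sigma ++ [:: linv c]).
    have := relator_rot RsP 1 Rr; rewrite /= rot1_cons -cats1 cat_rcons.
    by rewrite -!catA.
  have [|e|//] := IHn [::] v _ _ dx Rv (disk_conj_letter dm).
    by move: le_n; rewrite er /= size_rcons; lia.
  left; move/(congr1 (@winv X)): e; rewrite winvK => <-.
  by rewrite winv_cons winv_rcons linvK -{1}(@fg_cancel _ [::] (linv c) [::]) linvK.
have [er|/eqP r0] := eqVneq rho [::].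
  rewrite {}er cats0 in dm ncr Rr le_n *.
  have [c [v ex]] := reduced_not_cr rx x0 ncr; rewrite ex in dm.
  have vx : infix v x by apply/infixP; exists [:: linv c], [:: c]; rewrite ex /= -cats1.
  have [||e|e] := IHn v [::] sigma _ (dehn_reduced_infix vx dx) Rr.
  - by move: le_n; rewrite ex /= size_rcons; lia.
  - by rewrite cats0; apply: disk_conj_letter dm.
  - left; rewrite ex e -[X in rcons _ X](linvK c); exact: (@fg_cancel _ [::] (linv c) [::]).
  have := dx.2 _ _ vx Rr; rewrite e => /(_ (infix_refl _)).
  by case: (sigma) (relator_neq0 RsP Rr) => //= ? ? _; lia.
have [x1 [a ex]] : exists x1 a, x = rcons x1 a by case/lastP: (x) x0 => // x1 a _; exists x1, a.
have [b [rho1 er]] : exists b rho1, rho = b :: rho1 by case: (rho) r0 => // b rho1 _; exists b, rho1.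
(* The cancelling pair is at the joint of x and rho, or at the ends of x rho. *)
have [eb|nb] := eqVneq b (linv a).
  have dx1 : dehn_reduced Rs x1 by apply: dehn_reduced_infix dx; apply/infixP; exists [::], [:: a]; rewrite ex cats1.
  have Rv : Rs (rho1 ++ (sigma ++ [:: linv a])).
    by have := relator_rot RsP 1 Rr; rewrite er eb /= rot1_cons -cats1 catA.
  have [||e|e] := IHn x1 rho1 _ _ dx1 Rv.
  - by move: le_n; rewrite ex er /= size_rcons; lia.
  - by apply: disk_eq dm; rewrite ex er eb cat_rcons fg_cancel.
  - by left; rewrite ex er e eb winv_cons linvK.
  - by right; rewrite ex e -cats1 -catA; have := fg_cancel sigma (linv a) [::]; rewrite linvK cats0.
have rw : reduced (x ++ rho).
  move: rx rr; rewrite ex er /reduced cat_rcons; case: (x1) => [|h t] /=.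
    by move=> _ ->; rewrite /noncancel nb.
  by rewrite rcons_path cat_path /= => /andP[-> ->] ->; rewrite /noncancel nb.
have [|c [v ew]] := reduced_not_cr rw _ ncr; first by rewrite ex; case: (x1).
have [x2 ex2] : exists x2, x = linv c :: x2.
  by move: ew; rewrite ex; case: (x1) => [|h t] /= [-> _]; [exists [::]|exists (rcons t a)].
have [rho2 er2] : exists rho2, rho = rcons rho2 c.
  move: ew; rewrite er; case/lastP: (rho1) => [|t h].
    by rewrite cats1 -rcons_cons => /rcons_inj[_ ->]; exists [::].
  by rewrite -rcons_cons -rcons_cat -rcons_cons => /rcons_inj[_ ->]; exists (b :: t).
have dx2 : dehn_reduced Rs x2.
  by apply: dehn_reduced_infix dx; apply/infixP; exists [:: linv c], [::]; rewrite ex2 cats0.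
have Rv : Rs (rho2 ++ c :: sigma) by rewrite -cat_rcons -er2.
have [||e|e] := IHn x2 rho2 _ _ dx2 Rv.
- by move: le_n; rewrite ex2 er2 /= size_rcons; lia.
- by apply: (@disk_conj_letter _ c); move: dm; rewrite ex2 er2 rcons_cat.
- by left; rewrite ex2 er2 e winv_rcons.
- by right; rewrite ex2 e; have := @fg_cancel _ [::] (linv c) sigma; rewrite linvK.
Qed.

End DehnAlgorithm.

(** * Contact of a cell with the outer boundary of an annulus *)

Lemma split_uniq (T : eqType) (x : T) u v u' v' :
  uniq (u ++ x :: v) -> u ++ x :: v = u' ++ x :: v' -> u = u' /\ v = v'.
Proof.
elim: u u' => [|y u IHu] [|y' u'] //=.
- by move=> _ [].
- by move=> /andP[xv _] [_ ev]; rewrite ev mem_cat mem_head orbT in xv.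
- by move=> /andP[yx _] [ey _]; rewrite ey mem_cat mem_head orbT in yx.
by case/andP=> _ uu [-> /(IHu _ uu)[-> ->]].
Qed.

Lemma mulg1C (G : groupType) (g k : G) : g * k = 1 -> k * g = 1.
Proof. by move=> e; rewrite -(mulg1_eq e) mulVg. Qed.

Section DiskMorphism.
Variables (X : countType) (Rs : word X -> Prop) (H : groupType) (psi : free_group X -> H).
Hypothesis psiM : forall g g', psi (g * g') = psi g * psi g'.
Hypothesis psiR : forall w, Rs w -> psi (fg w) = 1.

Lemma hom1 : psi 1 = 1.
Proof. by apply: (mulgI (psi 1)); rewrite -psiM !mulg1. Qed.

Lemma homV g : psi g^-1 = (psi g)^-1.
Proof. by apply/esym/mulg1_eq; rewrite -psiM mulgV hom1. Qed.

Lemma disk_morph m y : disk Rs m y -> psi (fg y) = 1.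
Proof.
move=> [cs [_ Rcs n]]; have := nullg_morph psiM hom1 homV n.
rewrite -map_comp /=; apply: nullg_ones => _ /mapP[c cc ->]; exact/psiR/Rcs.
Qed.

End DiskMorphism.

Section AnnulusHull.
Variables (X : countType) (Rs : word X -> Prop).
Hypothesis RsP : small_cancellation_relators Rs.
Variables (H : groupType) (psi : free_group X -> H).
Hypothesis psiM : forall g g', psi (g * g') = psi g * psi g'.
Hypothesis psiR : forall w, Rs w -> psi (fg w) = 1.
Variables (I : finType) (s : I * bool -> X * bool).
Hypothesis sV : forall a, s (linv a) = linv (s a).
Variables (vt ut : word I) (cells : seq (word I)).
Let C := [:: vt, ut & cells].
Hypotheses (qC : quadratic C) (nC : nullw C).
Hypothesis cellsR : forall c, c \in cells -> Rs (map s c).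
Hypothesis dv : forall k, dehn_reduced Rs (rot k (map s vt)).
Hypothesis psiv : psi (fg (map s vt)) <> 1.

Let uC : uniq (flatten C) := proj1 qC.
Let cC : forall x, x \in flatten C -> linv x \in flatten C := proj2 qC.

Lemma annulus_cellsC : {subset cells <= C}.
Proof. by move=> c cc; rewrite !inE cc !orbT. Qed.

Lemma annulus_vtC : vt \in C. Proof. exact: mem_head. Qed.
Lemma annulus_utC : ut \in C. Proof. by rewrite !inE eqxx orbT. Qed.

Lemma annulus_uniq_pair c k k' : c \in cells ->
  uniq (flatten [:: rot k vt, rot k' c, ut & rem c cells]).
Proof.
move=> cc; rewrite (perm_uniq (_ : perm_eq _ (flatten C))) //.
apply: (perm_trans (y := vt ++ c ++ ut ++ flatten (rem c cells))).
  by apply: perm_cat; rewrite ?perm_rot // perm_cat2r perm_rot.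
rewrite /C /= perm_cat2l perm_catCA perm_cat2l perm_sym.
exact: perm_flatten (perm_to_rem cc).
Qed.

Lemma annulus_null_pair c k k' : c \in cells ->
  nullw [:: rot k vt, rot k' c, ut & rem c cells].
Proof.
move=> cc; apply/nullw_rot/nullw_swap/nullw_rot/nullw_swap.
apply: nullw_perm nC; rewrite perm_cons -[X in perm_eq X _]/([:: ut] ++ cells).
rewrite -[X in perm_eq _ X]/([:: c] ++ [:: ut] ++ rem c cells) perm_sym perm_catCA perm_cat2l perm_sym.
exact: perm_to_rem.
Qed.

Variable c : word I.
Hypothesis cc : c \in cells.

(** The arc A2 of the outer boundary between a and b, and the interval B2 of c facing it,
    bound a disc. The other possibility is that they enclose the hole of the annulus. *)
Definition disc_interval a A2 b A1 : Prop :=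
  exists k k' B1 B2 m, [/\ rot k vt = a :: A2 ++ b :: A1,
    rot k' c = linv b :: B2 ++ linv a :: B1 &
    nullw ((B2 ++ A2) :: mask m (rem c cells))].

(** [nullw_cut] cuts the sphere into two discs; the face ut is in one of them, and the other
    one is free of it. *)
Lemma disc_interval_dichotomy k a A2 b A1 :
    rot k vt = a :: A2 ++ b :: A1 -> linv a \in c -> linv b \in c ->
  disc_interval a A2 b A1 \/ disc_interval b A1 a A2.
Proof.
move=> ev ac bc; have [k' B eB] := rot_to bc.
have uv := uniq_flatten_face uC annulus_vtC.
have ab : linv a != linv b.
  rewrite (inj_eq (@linv_inj _)); apply: contraTneq uv => eab.
  by rewrite -(rot_uniq k) ev eab /= mem_cat mem_head orbT.
have : linv a \in linv b :: B by rewrite -eB mem_rot.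
rewrite inE (negbTE ab) /= => /mem_split[B2 [B1 eB']]; rewrite {B}eB' in eB.
have := annulus_null_pair k k' cc; have := annulus_uniq_pair k k' cc; rewrite ev eB => uD nD.
have [m1 [m2 [sm1 sm2 dis n1 n2]]] := nullw_cut uD nD.
case: m1 m2 sm1 sm2 dis n1 n2 => [|e1 m1] [|e2 m2] //= _ _ /(_ 0%N) /= dis n1 n2.
case: e1 dis n1 => /= [/negbTE e2F _|_ n1]; last by left; exists k, k', B1, B2, m1.
rewrite e2F in n2; right; have [j ej] := rot_rotE (size (a :: A2)) k vt.
have [j' ej'] := rot_rotE (size (linv b :: B2)) k' c.
exists j, j', B2, B1, m2; split.
- by rewrite -ej ev -cat_cons rot_size_cat.
- by rewrite -ej' eB -cat_cons rot_size_cat.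
exact: nullw_catC.
Qed.

Lemma disc_interval_bigon B2 A2 m : nullw ((B2 ++ A2) :: mask m (rem c cells)) ->
  exists m', disk Rs m' (map s A2 ++ map s B2).
Proof.
move=> n; exists (size (mask m (rem c cells))).
exists (map (map s) (mask m (rem c cells))); split; rewrite ?size_map //.
  by move=> _ /mapP[d /mem_mask dr ->]; apply: cellsR; apply: mem_rem dr.
by apply: nullw_catC; rewrite -map_cat; apply: (nullw_map sV n).
Qed.

(** Three disc intervals covering the outer boundary fill the whole annulus: going around
    once, the outer boundary is homotopic to the boundary of c, hence trivial modulo the
    relators. But psi(v) is not. *)
Lemma no_three_discs a A2 b A11 z A12 :
  disc_interval a A2 b (A11 ++ z :: A12) ->
  disc_interval z A12 a (A2 ++ b :: A11) ->
  ~ disc_interval b A11 z (A12 ++ a :: A2).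
Proof.
move=> [k [k' [B1 [B2 [m [ev ec nA]]]]]] [k1 [k1' [D1 [D2 [m' [ev1 ec1 nA1]]]]]].
move=> [k2 [k2' [E1 [E2 [m'' [ev2 ec2 nA2]]]]]].
have uc := uniq_flatten_face uC (annulus_cellsC cc).
have av : uniq (a :: A2 ++ b :: A11 ++ z :: A12).
  by rewrite -ev rot_uniq; apply: uniq_flatten_face uC annulus_vtC.
have rot_tail := rot_uniq_tail uc.
have zc : linv z \in c by rewrite -(mem_rot k1') ec1 inE mem_cat inE eqxx !orbT.
(* The disc over A2 is closed, so its boundary does not meet the edge of z. *)
have zB2 : linv z \notin B2.
  apply/negP => zB2; have uD := annulus_uniq_pair k k' cc; rewrite ev ec in uD.
  have nA' : nullw ((B2 ++ A2) :: mask (false :: m) (ut :: rem c cells)) by [].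
  have : z \in flatten ((B2 ++ A2) :: mask (false :: m) (ut :: rem c cells)).
    by rewrite -(linvK z); apply: (nullw_closed nA'); rewrite /= !mem_cat zB2.
  have zD : z \in a :: A2 ++ b :: A11 ++ z :: A12 by rewrite !(inE, mem_cat) eqxx !orbT.
  have {uD} : uniq ((a :: A2 ++ b :: A11 ++ z :: A12) ++
     (linv b :: B2 ++ linv a :: B1) ++ flatten (ut :: rem c cells)) by [].
  rewrite cat_uniq => /and3P[_ /hasPn nz _].
  rewrite /= !mem_cat -orbA => /or3P[zB|zA|zM].
  - have /nz : z \in (linv b :: B2 ++ linv a :: B1) ++ flatten (ut :: rem c cells).
      by rewrite !(mem_cat, inE) zB !orbT.
    by rewrite zD.
  - move: av; rewrite cons_uniq cat_uniq => /and4P[_ _ /hasPn na _]; have := na z.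
    by rewrite !(inE, mem_cat) eqxx !orbT zA => /(_ isT).
  have /nz : z \in (linv b :: B2 ++ linv a :: B1) ++ flatten (ut :: rem c cells).
    rewrite mem_cat orbC; have -> // : z \in flatten (ut :: rem c cells).
    case/flattenP: zM => d /mem_mask dr zd; apply/flattenP; exists d => //.
    by rewrite inE dr orbT.
  by rewrite zD.
have za : linv z != linv a.
  by rewrite (inj_eq (@linv_inj _)); apply: contraTneq av => ->; rewrite cons_uniq !(inE, mem_cat) eqxx !orbT.
have zb : linv z != linv b.
  rewrite (inj_eq (@linv_inj _)); apply: contraTneq av => ->.
  by rewrite cons_uniq cat_uniq cons_uniq !(inE, mem_cat) eqxx !orbT /= !andbF.
have : linv z \in linv b :: B2 ++ linv a :: B1 by rewrite -ec mem_rot.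
rewrite inE mem_cat inE (negbTE zb) (negbTE zB2) (negbTE za) /= => /mem_split[B11 [B12 eB1]].
rewrite {}eB1 in ec *.
have [j ej] := rot_rotE (size (linv b :: B2)) k' c.
rewrite ec -cat_cons rot_size_cat in ej.
have [j' ej'] := rot_rotE (size (linv b :: B2 ++ linv a :: B11)) k' c.
have ec' : rot k' c = (linv b :: B2 ++ linv a :: B11) ++ linv z :: B12 by rewrite ec /= -catA.
rewrite ec' rot_size_cat in ej'.
have uj : uniq (linv a :: (B11 ++ linv z :: B12) ++ linv b :: B2) by rewrite [X in uniq X]ej rot_uniq.
have uj' : uniq ((linv z :: B12) ++ linv b :: B2 ++ linv a :: B11) by rewrite ej' rot_uniq.
have e1 : B11 ++ linv z :: B12 ++ linv b :: B2 = D2 ++ linv z :: D1.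
  by rewrite -(rot_tail _ _ _ _ _ (esym ej) ec1) -!cat_cons catA.
have e2 : B12 ++ linv b :: B2 ++ linv a :: B11 = E2 ++ linv b :: E1.
  by rewrite -(rot_tail _ _ _ _ _ (esym ej') ec2).
have [eD _] : B11 = D2 /\ B12 ++ linv b :: B2 = D1.
  by apply: split_uniq e1; move: uj => /= /andP[_]; rewrite -catA.
have [eE _] : B12 = E2 /\ B2 ++ linv a :: B11 = E1.
  by apply: split_uniq e2; move: uj' => /= /andP[_].
have dA := disc_interval_bigon nA; have dD := disc_interval_bigon nA1.
have dE := disc_interval_bigon nA2; rewrite -{}eD -{}eE in dD dE.
(* Each disc identifies an arc of vt with an interval of c, up to relators. *)
have psi_cat (w w' : word X) : psi (fg (w ++ w')) = psi (fg w) * psi (fg w').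
  by rewrite fg_cat psiM.
have psi_inv (w w' : word X) : (exists m', disk Rs m' (w ++ w')) -> psi (fg w) = (psi (fg w'))^-1.
  move=> [m0 d]; apply: (mulIg (psi (fg w'))); rewrite -psi_cat mulVg.
  exact: disk_morph psiM psiR _ _ d.
have psi_letter (y : I * bool) (w : word I) : psi (fg (map s (y :: w))) = psi (fg [:: s y]) * psi (fg (map s w)).
  by rewrite -psi_cat.
have psi_rot j0 (w : word X) : psi (fg (rot j0 w)) = 1 -> psi (fg w) = 1.
  by rewrite /rot -{3}(cat_take_drop j0 w) !psi_cat => e; rewrite -(mulg1_eq e) mulVg.
have psi_linv y : psi (fg [:: s (linv y)]) = (psi (fg [:: s y]))^-1.
  by rewrite sV -[[:: linv _]]/(winv [:: s y]) fg_winv homV.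
have c1 : psi (fg (map s (rot k' c))) = 1.
  by rewrite map_rot; apply: psiR; apply: relator_rot => //; apply: cellsR.
apply: psiv; apply: (psi_rot k); rewrite -map_rot ev.
move: c1; rewrite ec !(psi_letter, map_cat, psi_cat) !psi_linv.
rewrite (psi_inv _ _ dA) (psi_inv _ _ dD) (psi_inv _ _ dE) !mulgA => c1.
apply: invg_inj; rewrite invg1 !invgM !invgK !mulgA.
move: c1; rewrite -[X in X = 1 -> _]mulgA -[X in X = 1 -> _]mulgA => /mulg1C.
by rewrite !mulgA.
Qed.

(** Outside the longest disc interval a' A2 b' the outer boundary does not touch c: for a
    further edge z of contact, the interval from a' to z or from z to b' would be a longer
    disc interval, or else there are three disc intervals around. *)
Lemma maximal_disc_interval k a A b B :
    rot k vt = a :: A ++ b :: B -> linv a \in c -> linv b \in c ->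
  exists a' A2 b' A1, disc_interval a' A2 b' A1 /\ forall z, z \in A1 -> linv z \notin c.
Proof.
move=> ev ac bc.
pose P n := `[< exists a' A2 b' A1, disc_interval a' A2 b' A1 /\ size A2 = n >].
have exP : exists n, P n.
  case: (disc_interval_dichotomy ev ac bc) => d; eexists; apply/asboolP; do 4!eexists;
  by split; [exact: d|reflexivity].
have boundP n : P n -> (n <= size vt)%N.
  move=> /asboolP[a' [A2 [b' [A1 [[k1 [_ [_ [_ [_ [e _ _]]]]]] <-]]]]].
  by rewrite -(size_rot k1 vt) e /= size_cat; lia.
have [n /asboolP[a' [A2 [b' [A1 [d sA]]]]] maxn] := ex_maxnP exP boundP.
exists a', A2, b', A1; split=> // z zA1; apply/negP => zc.
have [A11 [A12 eA1]] := mem_split zA1; rewrite {A1 zA1}eA1 in d.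
have [k1 [k1' [B1 [B2 [m [ev1 ec _]]]]]] := d.
have a'c : linv a' \in c by rewrite -(mem_rot k1') ec !(inE, mem_cat) eqxx !orbT.
have b'c : linv b' \in c by rewrite -(mem_rot k1') ec mem_head.
have big A' y y' B' : disc_interval y A' y' B' -> (size A' <= n)%N.
  by move=> dA; apply: maxn; apply/asboolP; exists y, A', y', B'.
have e1 : rot k1 vt = a' :: (A2 ++ b' :: A11) ++ z :: A12 by rewrite ev1 -catA.
have [/big|d1] := disc_interval_dichotomy e1 a'c zc.
  by rewrite size_cat /= -sA; lia.
have [j ej] := rot_rotE (size (a' :: A2 ++ b' :: A11)) k1 vt.
have e2 : rot j vt = z :: (A12 ++ a' :: A2) ++ b' :: A11.
  by rewrite -ej e1 -cat_cons rot_size_cat /= -catA.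
have [/big|d2] := disc_interval_dichotomy e2 zc b'c.
  by rewrite size_cat /= -sA; lia.
exact: no_three_discs d d1 d2.
Qed.

(** The longest disc interval contains all contacts of c with vt, and by [dehn_bigon] the disc
    is degenerate. *)
Lemma annulus_hull :
  (forall z, z \in c -> linv z \notin vt) \/
  (exists k h0 H h q, [/\ rot k c = rcons H h ++ q, head h0 (rcons H h) = h0,
     (2 * size (rcons H h) <= size c)%N, (linv h0 \in vt) && (linv h \in vt) &
     forall z, z \in q -> linv z \notin vt]).
Proof.
have cinC := annulus_cellsC cc; have uc := uniq_flatten_face uC cinC.
have uv := uniq_flatten_face uC annulus_vtC.
have [/hasP[a av ac]|np] := boolP (has (fun y => linv y \in c) vt); last first.
  left=> z zc; apply: contra np => zx; apply/hasP; exists (linv z) => //.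
  by rewrite linvK.
right; have [k A eA] := rot_to av.
have vA z : (z \in vt) = (z \in a :: A) by rewrite -(mem_rot k) eA.
have [/hasP[b bA bc]|nb] := boolP (has (fun y => linv y \in c) A); last first.
  have [k' B eB] := rot_to ac; exists k', (linv a), [::], (linv a), B.
  split=> //.
  - have ia : infix (map s [:: a]) (rot k (map s vt)).
      by apply/infixP; exists [::], (map s A); rewrite -map_rot eA.
    have Rc : Rs (winv (map s (linv a :: B))).
      by apply: relator_winv RsP _ _; rewrite -eB map_rot; apply: relator_rot => //; exact: cellsR.
    have ii : infix (map s [:: a]) (winv (map s (linv a :: B))).
      by apply/infixP; exists (winv (map s B)), [::]; rewrite /= winv_cons sV linvK cats1.
    by have := (dv k).2 _ _ ia Rc ii; rewrite size_winv !size_map -eB size_rot.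
  - by rewrite linvK av.
  move=> z zB; apply/negP; rewrite vA inE => /orP[/eqP za|zA].
    by move: uc; rewrite -(rot_uniq k') eB -za linvK /= zB.
  case/hasP: nb; exists (linv z) => //; rewrite linvK.
  by rewrite -(mem_rot k') eB inE zB orbT.
have [A2 [A1 eA']] := mem_split bA; rewrite {A bA vA}eA' in eA.
have := maximal_disc_interval eA ac bc; clear k A1 A2 eA.
move=> [a' [A2 [b' [A1 [[k [k' [B1 [B2 [m [ev ec nA]]]]]] noA1]]]]].
have uD := annulus_uniq_pair k k' cc; rewrite ev ec in uD.
have vA z : (z \in vt) = (z \in a' :: A2 ++ b' :: A1) by rewrite -(mem_rot k) ev.
have Rc : Rs (map s (linv b' :: B2 ++ linv a' :: B1)).
  by rewrite -ec map_rot; apply: relator_rot => //; exact: cellsR.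
have dA : dehn_reduced Rs (map s (a' :: A2 ++ [:: b'])).
  apply: dehn_reduced_infix (dv k); apply/infixP; exists [::], (map s A1).
  by rewrite -map_rot ev /= -map_cat -catA.
have cases : map s A2 = winv (map s B2) \/ map s A2 = map s (linv a' :: B1 ++ [:: linv b']).
  have [m' dm] := disc_interval_bigon nA; apply: (dehn_bigon RsP _ _ dm).
    by apply: dehn_reduced_infix dA; apply/infixP; exists [:: s a'], [:: s b']; rewrite /= map_cat.
  rewrite -map_cat; have := relator_rot RsP 1 Rc; rewrite -map_rot /= rot1_cons.
  by rewrite rcons_cat /= -cats1.
exists k', (linv b'), (linv b' :: B2), (linv a'), B1; split=> //.
- by rewrite ec /= cat_rcons.
- by rewrite -(size_rot k' c) ec; apply: cut_interval_le dA Rc cases.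
- by rewrite !linvK !vA !(inE, mem_cat) !eqxx !orbT.
move=> z zB; apply/negP => zx.
have zcD : z \in linv b' :: B2 ++ linv a' :: B1 by rewrite inE mem_cat inE zB !orbT.
have zc : z \in c by rewrite -(mem_rot k') ec.
have := uc; rewrite -(rot_uniq k') ec -cat_cons cat_uniq => /and3P[_ /hasPn nB uB].
have nB2 : z \notin linv b' :: B2 by apply: nB; rewrite inE zB orbT.
have nA' : nullw ((B2 ++ A2) :: mask (false :: m) (ut :: rem c cells)) by [].
move: (zx); rewrite vA inE mem_cat inE => /or3P[/eqP za|zA|/orP[/eqP zb|z1]].
- by move: uB; rewrite /= -za linvK zB.
- by have := cut_closed uD nA' zA zcD; move: nB2; rewrite inE negb_or => /andP[_ /negbTE->].
- by move: nB2; rewrite -zb linvK mem_head.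
- by have := noA1 _ z1; rewrite linvK zc.
Qed.

End AnnulusHull.

(** * Reduced annular diagrams *)

Section FaceInduction.
Variables (D : eqType) (C : seq (seq D)).
Hypothesis uC : uniq (flatten C).

Lemma face_ind c (P : D -> Prop) y : c \in C -> y \in c -> P y ->
  (forall z, z \in c -> P z -> P (nxt C z)) -> forall z, z \in c -> P z.
Proof.
move=> cinC yc Py Pn z zc; have [k l el] := rot_to yc.
have uc := uniq_flatten_face uC cinC.
have : z \in y :: l by rewrite -el mem_rot.
have : fcycle (next c) (y :: l) by rewrite -el rot_cycle cycle_next.
rewrite /= rcons_path => /andP[/fpathP[n ->] _]; rewrite -trajectS => /trajectP[i _ ->].
have iC j : iter j (next c) y \in c by elim: j => //= j; rewrite mem_next.
by elim: i => //= i IHi; rewrite -(nxt_next uC cinC) //; apply: Pn.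
Qed.
End FaceInduction.

Section Additive.
Variables (T : eqType) (f : seq T -> nat) (n : nat).
Hypothesis f_cat : forall u v, f (u ++ v) = (f u + f v)%N.

Lemma additive_leq L : (forall c, c \in L -> (n <= f c)%N) -> (n * size L <= f (flatten L))%N.
Proof.
elim: L => [|c L IHL] le; first by rewrite muln0.
rewrite /= mulnS f_cat leq_add ?le ?mem_head // IHL // => d dL.
by apply: le; rewrite inE dL orbT.
Qed.

Lemma additive_ltn L c : c \in L -> (n < f c)%N -> (forall c, c \in L -> (n <= f c)%N) ->
  (n * size L < f (flatten L))%N.
Proof.
move=> cL lt le; have [L1 [L2 e]] := mem_split cL; rewrite {cL}e in le *.
have le1 : (n * size L1 <= f (flatten L1))%N.
  by apply: additive_leq => d dL; apply: le; rewrite mem_cat dL.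
have le2 : (n * size L2 <= f (flatten L2))%N.
  by apply: additive_leq => d dL; apply: le; rewrite mem_cat inE dL !orbT.
rewrite flatten_cat /= !f_cat size_cat /= mulnDr mulnS; move: lt le1 le2.
by move: (n * size L1)%N (n * size L2)%N (f c) (f _) (f _); clear; lia.
Qed.
End Additive.

Lemma sum_weight (T : Type) (P Q U : pred T) (wt : T -> nat) (L : seq T) :
    (forall x, wt x = 1 + U x)%N -> (forall x, U x -> ~~ Q x) ->
  (\sum_(x <- L | P x && ~~ Q x) wt x + 2 * count (fun x => P x && Q x) L =
   count P L + count (fun x => P x && Q x) L + count (fun x => P x && U x) L)%N.
Proof.
move=> ewt UQ; elim: L => [|x L IHL] /=; first by rewrite big_nil.
rewrite big_cons; move: (UQ x) (ewt x) IHL.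
move: (\sum_(_ <- L | _) _)%N (count _ L) (count _ L) (count _ L) => S p q u.
by case: (P x); case: (Q x); case: (U x) => //= uq ew IH; (try by have := uq isT); move: ew IH; clear; lia.
Qed.

Lemma rot_winv_nil (X : countType) k (w : word X) : reduced w -> rot k w = winv w -> w = [::].
Proof.
rewrite -{1 3 4}(cat_take_drop k w) => /reduced_cat[r1 r2].
rewrite /rot winv_cat => /eqP; rewrite eqseq_cat ?size_winv // => /andP[/eqP e1 /eqP e2].
by rewrite (reduced_winv_nil r1 (esym e2)) (reduced_winv_nil r2 (esym e1)).
Qed.

(** A reduced annular diagram with boundary components vt and ut; psi stands for the natural map
    to the group of the presentation. By [u_third] a relator meets ut in less than a third of itself.
    The segment wA of the label of ut comes from a word of length N, of which it is at least
    a third, and meets relators in pieces. *)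
Section AnnulusCurvature.
Variables (X : countType) (Rs : word X -> Prop).
Hypothesis RsP : small_cancellation_relators Rs.
Variables (H : groupType) (psi : free_group X -> H).
Hypothesis psiM : forall g g', psi (g * g') = psi g * psi g'.
Hypothesis psiR : forall w, Rs w -> psi (fg w) = 1.
Variables (I : finType) (s : I * bool -> X * bool).
Hypothesis sV : forall a, s (linv a) = linv (s a).
Variables (vt ut : word I) (cells : seq (word I)).
Let C := [:: vt, ut & cells].
Hypotheses (qC : quadratic C) (nC : nullw C).
Hypothesis cellsR : forall c, c \in cells -> Rs (map s c).
Hypothesis nomirror : forall c c', c \in cells -> c' \in cells -> c <> c' -> ~ mirror_faces s c c'.
Hypotheses (v0 : vt <> [::]) (u0 : ut <> [::]).
Hypotheses (cr_v : cyclically_reduced (map s vt)) (cr_u : cyclically_reduced (map s ut)).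
Hypothesis dv : forall k, dehn_reduced Rs (rot k (map s vt)).
Hypothesis psiv : psi (fg (map s vt)) <> 1.
Hypothesis u_third : forall k y w, infix y (rot k (map s ut)) -> Rs w -> infix y w ->
  (3 * size y < size w)%N.
Variables (kA : nat) (wA wB : word X) (N : nat).
Hypotheses (eA : rot kA (map s ut) = wA ++ wB) (N0 : (0 < N)%N) (leN : (N <= 3 * size wA)%N).
Hypothesis u_sixth : forall p w, p <> [::] -> infix p wA -> Rs w -> infix p w ->
  (6 * size p < size w)%N /\ (6 * size p < N)%N.
Hypothesis cells0 : cells <> [::].

Let uC : uniq (flatten C) := proj1 qC.
Let cC : forall x, x \in flatten C -> linv x \in flatten C := proj2 qC.
Let cellsC : {subset cells <= C} := @annulus_cellsC I vt ut cells.
Let vtC : vt \in C := annulus_vtC vt ut cells.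
Let utC : ut \in C := annulus_utC vt ut cells.
Let F := flatten cells.

Lemma annulus_nomirror c c' : c \in cells -> c' \in cells -> ~ mirror_faces s c c'.
Proof.
move=> cc cc'; have [->|/eqP ne] := eqVneq c c'; last exact: nomirror.
exact: (mirror_self RsP sV uC (cellsC cc') (cellsR cc')).
Qed.

Lemma infix_relator c k t q : c \in cells -> rot k c = t ++ q ->
  exists2 w, Rs w /\ size w = size c & infix (map s (winv t)) w.
Proof.
move=> cc e; exists (winv (map s (rot k c))).
  split; last by rewrite size_winv size_map size_rot.
  by apply: relator_winv RsP _ _; rewrite map_rot; apply: relator_rot => //; exact: cellsR.
by apply/infixP; exists (winv (map s q)), [::]; rewrite e map_cat winv_cat map_winv // cats0.
Qed.

(** A run outside vt faces a cell, where it is a piece, or ut, where it is less than a third. *)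
Lemma annulus_run c k t z v : c \in cells -> rot k c = rcons t z ++ v ->
  {in t, forall y, ~~ cut_bend C [::] y} -> linv z \notin vt ->
  (6 * size (rcons t z) < (1 + (linv z \in ut)) * size c)%N.
Proof.
move=> cc e nb nv; have cinC := cellsC cc.
have [nbend _] := flat_run_prefix uC cinC e nb.
have tz0 : rcons t z <> [::] by case: (t).
have [c' [k' [q' [c'C e']]]] := run_mirror uC cC cinC tz0 e nbend.
have zc' : linv z \in c' by rewrite -(mem_rot k') e' winv_rcons mem_head.
move: (c'C); rewrite !inE => /or3P[/eqP c'v|/eqP c'u|cc'].
- by move: nv; rewrite -c'v zc'.
- have [w [Rw <-] iw] := infix_relator cc e.
  have iu : infix (map s (winv (rcons t z))) (rot k' (map s ut)).
    by rewrite -map_rot -c'u e' map_cat; apply/infixP; exists [::], (map s q').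
  have := u_third iu Rw iw; rewrite size_map size_winv -c'u zc'.
  by rewrite (_ : (1 + true = 2)%N) //; move: (size _) (size _); clear; lia.
have := cell_run RsP sV cellsR annulus_nomirror cc cc' tz0 e e'.
by move=> lt; apply: leq_trans lt _; rewrite leq_pmull.
Qed.

Lemma cut_bend0 x : cut_bend C [::] x = bend C x.
Proof. by rewrite /cut_bend in_nil orbF. Qed.

Lemma annulus_cell c (wt : I * bool -> nat) : c \in cells -> (forall x, wt x <= 2)%N ->
    (forall k t z v, rot k c = rcons t z ++ v -> {in t, forall y, ~~ cut_bend C [::] y} ->
      linv z \notin vt -> (6 * size (rcons t z) < wt z * size c)%N) ->
  let S := (\sum_(x <- c | bend C x && (linv x \notin vt)) wt x)%N in
  (7 <= S)%N \/ (4 <= S)%N /\ has (fun x => bend C x && (linv x \in vt)) c.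
Proof.
move=> cc wt2 runs S; have cinC := cellsC cc.
have c0 : c <> [::] by move=> e; apply: (relator_neq0 RsP (cellsR cc)); rewrite e.
have tau_nxt y : y \in flatten C -> y \notin [::] -> (nxt C y \in vt) = (y \in vt).
  by move=> _ _; rewrite nxt_mem.
have wt6 x : (wt x <= 6)%N by apply: leq_trans (wt2 x) _.
have := cell_weight uC cC (tau := fun y => y \in vt) tau_nxt cinC c0 wt6 runs
  (annulus_hull RsP psiM psiR sV qC nC cellsR dv psiv cc).
rewrite (eq_bigl (fun x => bend C x && (linv x \notin vt))) => [|x]; last by rewrite cut_bend0.
by rewrite (eq_has (a2 := fun x => bend C x && (linv x \in vt))) // => x; rewrite cut_bend0.
Qed.

(** Corners facing either boundary component count twice, once for the cell and once for the
    opposite corner of the component. *)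
Definition corner_weight (L : seq (I * bool)) : nat :=
  count (bend C) L + count (fun x => bend C x && (linv x \in vt)) L
  + count (fun x => bend C x && (linv x \in ut)) L.

Lemma corner_weight_cat L1 L2 : corner_weight (L1 ++ L2) = (corner_weight L1 + corner_weight L2)%N.
Proof.
rewrite /corner_weight !count_cat.
by move: (count _ L1) (count _ L1) (count _ L1) (count _ L2) (count _ L2) (count _ L2); clear; lia.
Qed.

Lemma vt_ut_disjoint x : x \in ut -> x \notin vt.
Proof.
move=> xu; apply/negP => xv; have := uC; rewrite /= !cat_uniq => /and3P[_ /hasPn h _].
by have := h x; rewrite mem_cat xu /= xv => /(_ isT).
Qed.

Lemma cell_disjoint c x : c \in cells -> x \in c -> x \notin vt /\ x \notin ut.
Proof.
move=> cc xc; have xF : x \in F by apply/flattenP; exists c.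
have := uC; rewrite /= !cat_uniq => /and3P[_ /hasPn h1 /and3P[_ /hasPn h2 _]]; split.
  by apply: h1; rewrite mem_cat [_ \in flatten _]xF orbT.
exact: h2.
Qed.

Lemma sum_corner_weight L :
  (\sum_(x <- L | bend C x && (linv x \notin vt)) (1 + (linv x \in ut)) +
   2 * count (fun x => bend C x && (linv x \in vt)) L = corner_weight L)%N.
Proof.
apply: (@sum_weight _ (bend C) (fun x => linv x \in vt) (fun x => linv x \in ut)) => // x.
exact: vt_ut_disjoint.
Qed.

Lemma cell_corner_weight c : c \in cells ->
  (7 <= corner_weight c)%N \/
  (6 <= corner_weight c)%N /\ exists2 x, x \in c & linv x \in vt.
Proof.
move=> cc.
have wt2 x : (1 + (linv x \in ut) <= 2)%N by case: (_ \in _).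
have [S7|[S4 /hasP[x xc /andP[bx xv]]]] := annulus_cell cc wt2 (fun k t z v e => annulus_run cc e).
  by left; rewrite -sum_corner_weight; apply: leq_trans S7 _; apply: leq_addr.
right; split; last by exists x.
have : (0 < count (fun x => bend C x && (linv x \in vt)) c)%N.
  by rewrite -has_count; apply/hasP; exists x; rewrite // bx.
rewrite -sum_corner_weight; move: S4; move: (count _ c) (\sum_(_ <- c | _) _)%N; clear; lia.
Qed.

Lemma curvature_bound :
  (corner_weight F <= count (bend C) F +
     count (fun z => bend C z && (linv (nxt C z) \in F)) vt +
     count (fun z => bend C z && (linv (nxt C z) \in F)) ut)%N /\
  (count (bend C) F + count (bend C) vt + count (bend C) ut <= 6 * size cells)%N.
Proof.
have uF : uniq F by move: uC; rewrite /C /= !cat_uniq => /and3P[_ _ /and3P[]].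
split; first by rewrite /corner_weight !leq_add // count_bend_transfer.
have nilC : [::] \notin C.
  rewrite !inE !negb_or; apply/and3P; split; [exact/eqP/nesym|exact/eqP/nesym|].
  by apply/negP => /cellsR /(relator_neq0 RsP).
have degC x : x \in flatten C -> nxt C x != linv x.
  move=> /flattenP[c cinC xc]; apply: (label_nxt_neq sV uC cinC) xc.
  by move: cinC; rewrite !inE => /or3P[/eqP->|/eqP->|/cellsR] //; exact: relator_cr.
have C0 : C <> [::] by [].
have := curvature qC nC C0 nilC degC; rewrite /= !count_cat -/F.
by move: (count _ F) (count _ vt) (count _ ut) (size cells); clear; lia.
Qed.

Lemma cell_weight6 c : c \in cells -> (6 <= corner_weight c)%N.
Proof. by move=> cc; have [/ltnW|[]] := cell_corner_weight cc. Qed.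

Lemma corner_weight_ge : (6 * size cells <= corner_weight F)%N.
Proof. exact: (additive_leq corner_weight_cat cell_weight6). Qed.

Lemma bend_sub L : (count (fun z => bend C z && (linv (nxt C z) \in F)) L <= count (bend C) L)%N.
Proof. by apply: sub_count => z /andP[]. Qed.

(** The bounds of [curvature] and of [cell_corner_weight] agree, so nothing is lost anywhere. *)
Lemma cell_weight_tight c : c \in cells -> ~ (7 <= corner_weight c)%N.
Proof.
move=> cc lt; have := additive_ltn corner_weight_cat cc lt cell_weight6.
have [le1 le2] := curvature_bound.
move: le1 le2 (bend_sub vt) (bend_sub ut); rewrite -/F.
move: (corner_weight _) (count _ F) (count _ vt) (count _ vt) (count _ ut) (count _ ut) (size cells).
by clear; lia.
Qed.

Lemma cell_meets_vt c : c \in cells -> exists2 x, x \in c & linv x \in vt.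
Proof. by move=> cc; have [/(cell_weight_tight cc)|[]] := cell_corner_weight cc. Qed.

(** Tightness again: each corner of ut is counted, and it is counted along a cell. *)
Lemma ut_bend_cell z : z \in ut -> bend C z -> linv (nxt C z) \in F.
Proof.
move=> zu bz; apply: contraT => nz.
have : (count (fun z => bend C z && (linv (nxt C z) \in F)) ut < count (bend C) ut)%N.
  rewrite (count_andb (bend C) (fun z => linv (nxt C z) \in F) ut) -addn1 leq_add2l.
  by rewrite -has_count; apply/hasP; exists z; rewrite // bz.
have [le1 le2] := curvature_bound.
move: le1 le2 corner_weight_ge (bend_sub vt); rewrite -/F.
move: (corner_weight _) (count _ F) (count _ vt) (count _ vt) (count _ ut) (count _ ut) (size cells).
by clear; lia.
Qed.

(** Without a corner, ut would be glued as a whole to a single face: to vt, which is glued to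
    cells; to itself, which is impossible for a reduced word; or to a cell, whose relator
    would then be shorter than itself. *)
Lemma ut_has_bend : exists2 z, z \in ut & bend C z.
Proof.
have [/hasP[z zu bz]|/hasPn nb] := boolP (has (bend C) ut); first by exists z.
have e0 : rot 0 ut = ut ++ [::] by rewrite rot0 cats0.
have [u x y v e|c' [k' [q' [c'C e']]]] := run_mirror uC cC utC u0 e0.
  by apply: nb; rewrite e mem_cat mem_head orbT.
have q0 : q' = [::].
  case: q' e' => // y q' e'.
  have [a [l eu]] : exists a l, ut = a :: l by case: (ut) u0 => // a l _; exists a, l.
  have [l' [z ez]] : exists l' z, ut = rcons l' z.
    by case/lastP: (ut) u0 => // l' z _; exists l', z.
  have uc := uniq_flatten_face uC c'C.
  have zu : z \in ut by rewrite ez mem_rcons mem_head.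
  have nz : nxt C z = a.
    case: l' ez => [|x l'] ez.
      by rewrite (nxt_next uC utC zu) ez /= eqxx; move: ez; rewrite eu => -[].
    have -> : a = x by move: ez; rewrite eu => -[].
    apply: (nxt_rot_cat (k := size (x :: l')) (u := [::]) (v := l') uC utC).
    by rewrite ez -cats1 rot_size_cat.
  have na : nxt C (linv a) = y.
    by apply: (nxt_rot_cat (k := k') (u := winv l) (v := q') uC c'C); rewrite e' eu winv_cons cat_rcons.
  have := nb z zu; rewrite /bend nz na negbK => /eqP ey.
  have := uc; rewrite -(rot_uniq k') e' ez winv_rcons ey /= mem_cat mem_head orbT //.
rewrite q0 cats0 {q0} in e'.
have inw x : (linv x \in c') = (x \in ut) by rewrite -(mem_rot k') e' mem_winv linvK.
move: (c'C); rewrite !inE => /or3P[/eqP c'v|/eqP c'u|cc'].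
- have [c cc] : exists c, c \in cells by case: (cells) cells0 => // c l _; exists c; apply: mem_head.
  have [x xc xv] := cell_meets_vt cc.
  by have [_] := cell_disjoint cc xc; rewrite -inw c'v xv.
- have := congr1 (map s) e'; rewrite c'u map_rot map_winv // => /(rot_winv_nil (cr_reduced cr_u)).
  by case: (ut) u0.
- have Rw := relator_winv RsP (relator_rot RsP k' (cellsR cc')).
  rewrite -map_rot e' map_winv // winvK in Rw.
  have := u_third (k := 0) (y := map s ut) _ Rw; rewrite rot0 infix_refl.
  by rewrite ltnNge leq_pmull // => /(_ isT isT).
Qed.

(** Going around ut, the face on the other side changes at corners only, and after each corner
    it is a cell. *)
Lemma ut_meets_cells z : z \in ut -> linv z \in F.
Proof.
have [z0 z0u bz0] := ut_has_bend.
apply: (face_ind (P := fun z => linv z \in F) uC utC (y := nxt C z0)).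
- by rewrite nxt_mem.
- exact: ut_bend_cell.
move=> x xu xF; have [bx|] := boolP (bend C x); first exact: ut_bend_cell.
rewrite negbK => /eqP e; case/flattenP: xF => c cc; rewrite -e (nxt_mem _ uC (cellsC cc)) => h.
by apply/flattenP; exists c.
Qed.

(** The run is glued to a cell, so it is a common subword of a relator and of the segment wA. *)
Lemma flat_run_sixth k t q : t <> [::] -> rot k ut = t ++ q -> infix (map s t) wA ->
    (forall u x y v, t = u ++ x :: y :: v -> ~~ bend C x) ->
  (6 * size t < N)%N /\
  exists c' k' q', [/\ c' \in cells, rot k' c' = winv t ++ q' & (6 * size t < size c')%N].
Proof.
move=> t0 e it nb; have [c' [k' [q' [c'C e']]]] := run_mirror uC cC utC t0 e nb.
have cc' : c' \in cells.
  case: t t0 e it nb e' => // x t _ e _ _ e'.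
  have /ut_meets_cells/flattenP[c cc xc] : x \in ut by rewrite -(mem_rot k) e mem_head.
  have xc' : linv x \in c' by rewrite -(mem_rot k') e' mem_cat mem_winv linvK mem_head.
  by rewrite -(face_eq uC (cellsC cc) c'C xc xc').
have [w [Rw ew]] := infix_relator cc' e'; rewrite winvK => iw.
have t0' : map s t <> [::] by case: (t) t0.
have [] := u_sixth t0' it Rw iw; rewrite size_map ew => lt1 lt2.
by split=> //; exists c', k', q'.
Qed.

(** The cell glued to the run between two consecutive corners is counted with weight 2 at the
    end of the run, as if the run could be almost a third of it. Inside wA the run is less
    than a sixth, so weight 1 suffices there, and the cell has one unit more than tightness
    allows. *)
Lemma two_bends_contradiction k u a w b v :
    rot k ut = u ++ a :: rcons w b ++ v -> infix (map s (rcons w b)) wA ->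
    bend C a -> bend C b -> ~~ has (bend C) w -> False.
Proof.
move=> e iA ba bb /hasPn nw.
have t0 : rcons w b <> [::] by case: (w).
have [k1 e1] := rot_rotE (size (rcons u a)) k ut.
rewrite e -cat_rcons rot_size_cat -catA in e1.
have flat : forall u x y v, rcons w b = u ++ x :: y :: v -> ~~ bend C x.
  move=> u' x y v' et; apply: nw; case/lastP: v' et => [|v' z] et.
    have : rcons w b = rcons (rcons u' x) y by rewrite et -!cats1 -catA.
    by move/rcons_inj => [-> _]; rewrite mem_rcons mem_head.
  have : rcons w b = rcons (u' ++ x :: y :: v') z by rewrite et -!cats1 -catA.
  by move/rcons_inj => [-> _]; rewrite mem_cat mem_head orbT.
have [_ [c' [k' [q' [cc' e' lt]]]]] := flat_run_sixth t0 (esym e1) iA flat.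
have c'C := cellsC cc'.
have [h [t' et']] : exists h t', rcons w b = h :: t' by case: (w) => [|h t']; [exists b, [::]|exists h, (rcons t' b)].
pose m := winv t'; pose xs := linv h.
have em : winv (rcons w b) = rcons m xs by rewrite et' winv_cons.
have na : nxt C a = h.
  by apply: (nxt_rot_cat (k := k) (u := u) (v := t' ++ v) uC utC); rewrite e et'.
have bxs : bend C xs by rewrite (bend_opp uC (z := a)) // na linvK.
have hu : h \in ut by rewrite -(mem_rot k) e et' mem_cat !inE eqxx !orbT.
have xsc : xs \in c' by rewrite -(mem_rot k') e' em mem_cat mem_rcons mem_head.
(* The dart xs of c' is the last one of the run, where its weight is counted. *)
pose wt x := if x == xs then 1%N else (1 + (linv x \in ut))%N.
have wt2 x : (wt x <= 2)%N by rewrite /wt; case: ifP => // _; case: (_ \in _).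
have runs j t z x : rot j c' = rcons t z ++ x -> {in t, forall y, ~~ cut_bend C [::] y} ->
    linv z \notin vt -> (6 * size (rcons t z) < wt z * size c')%N.
  rewrite /wt; case: ifP => [/eqP-> ej nt _|_]; last exact: annulus_run.
  rewrite mul1n; apply: leq_ltn_trans lt; rewrite leq_mul2l /= -(size_winv (rcons w b)) em !size_rcons ltnS.
  have [j1 ej1] := rot_rotE (size t) j c'; have [j2 ej2] := rot_rotE (size m) k' c'.
  rewrite ej cat_rcons rot_size_cat in ej1; rewrite e' em cat_rcons rot_size_cat in ej2.
  have eq : x ++ t = q' ++ m.
    exact: rot_uniq_tail (uniq_flatten_face uC c'C) (esym ej1) (esym ej2).
  have [[d ed]|[d _ ed]] := cat_cases eq; last first.
    have : x ++ t = q' ++ m := eq; rewrite ed -catA => /eqP.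
    by rewrite eqseq_cat // eqxx /= => /eqP <-; rewrite size_cat leq_addl.
  have et : t = d ++ m.
    by move: eq; rewrite ed -catA => /eqP; rewrite eqseq_cat // eqxx /= => /eqP.
  case/lastP: d {ed} et => [-> //|d y] et.
  have : nxt C y = linv b.
    have em' : rcons m xs = linv b :: winv w by rewrite -em winv_rcons.
    apply: (nxt_rot_cat (k := j) (u := d) (v := winv w ++ x) uC c'C).
    by rewrite ej et rcons_cat cat_rcons em' -catA.
  move/(bend_opp uC) => e2.
  have /nt : y \in t by rewrite et mem_cat mem_rcons mem_head.
  by rewrite cut_bend0 -e2 bb.
have uc' := uniq_flatten_face uC c'C.
have hv : linv xs \notin vt by rewrite linvK vt_ut_disjoint.
have SE : (\sum_(x <- c' | bend C x && (linv x \notin vt)) wt x <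
    \sum_(x <- c' | bend C x && (linv x \notin vt)) (1 + (linv x \in ut)))%N.
  rewrite !(big_rem _ xsc) /= bxs hv /wt eqxx linvK hu -addSn leq_add2l.
  by apply: leq_sum => x _; case: ifP.
apply: (cell_weight_tight cc'); rewrite -sum_corner_weight.
have [S7|[S4 hS]] := annulus_cell cc' wt2 runs.
  by move: S7 SE; move: (\sum_(_ <- _ | _) _)%N (\sum_(_ <- _ | _) _)%N; clear; lia.
rewrite has_count in hS; move: S4 hS SE.
by move: (count _ _) (\sum_(_ <- _ | _) _)%N (\sum_(_ <- _ | _) _)%N; clear; lia.
Qed.

(** The arc wA has at most one corner, hence consists of at most two flat runs. Each run is
    shorter than N / 6, so wA is shorter than N / 3. *)
Theorem annulus_contradiction : False.
Proof.
have [A [B [eAB eA' _]]] : exists A B, [/\ rot kA ut = A ++ B, map s A = wA & map s B = wB].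
  have em : map s (rot kA ut) = wA ++ wB by rewrite map_rot.
  have [eA' eB'] := map_eq_cat em.
  by exists (take (size wA) (rot kA ut)), (drop (size wA) (rot kA ut)); rewrite cat_take_drop.
have sA : size A = size wA by rewrite -eA' size_map.
have run k t q : rot k ut = t ++ q -> infix t A -> ~~ has (bend C) t -> (6 * size t < N)%N.
  move=> e it /hasPn nb; have [->|/eqP t0] := eqVneq t [::]; first by rewrite muln0.
  apply: (flat_run_sixth t0 e _ _).1.
    by case/infixP: it eA' => p [p' ->] <-; rewrite !map_cat; apply/infixP; exists (map s p), (map s p').
  by move=> u x y v et; apply: nb; rewrite et mem_cat mem_head orbT.
have [hA|nA] := boolP (has (bend C) A); last first.
  by have := run _ _ _ eAB (infix_refl A) nA; move: leN; rewrite sA; clear; lia.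
case: (split_find hA) eAB sA eA' run => a u v ba nu eAB sA eA' run.
have [hv|nv] := boolP (has (bend C) v).
  case: (split_find hv) eAB eA' => b w v' bb nw eAB eA'.
  have eAB' : rot kA ut = u ++ a :: rcons w b ++ (v' ++ B) by rewrite eAB -cats1 -!catA.
  apply: (two_bends_contradiction eAB' _ ba bb nw); rewrite -eA' !map_cat.
  by apply/infixP; exists (map s (rcons u a)), (map s v').
have [j ej] := rot_rotE (size (rcons u a)) kA ut.
rewrite eAB -catA rot_size_cat -catA in ej.
have lt1 : (6 * size (rcons u a) < N)%N.
  have e1 : rot kA ut = rcons u a ++ (v ++ B) by rewrite eAB -catA.
  have i1 : infix (map s (rcons u a)) wA by rewrite -eA' map_cat prefixW // prefix_prefix.
  have t0 : rcons u a <> [::] by case: (u).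
  apply: (flat_run_sixth t0 e1 i1 _).1 => u' x y v' et; move/hasPn: nu; apply.
  case/lastP: v' et => [|v' z] et.
    have : rcons u a = rcons (rcons u' x) y by rewrite et -!cats1 -catA.
    by move/rcons_inj => [-> _]; rewrite mem_rcons mem_head.
  have : rcons u a = rcons (u' ++ x :: y :: v') z by rewrite et -!cats1 -catA.
  by move/rcons_inj => [-> _]; rewrite mem_cat mem_head orbT.
have := run _ _ _ (esym ej) _ nv; rewrite suffixW ?suffix_suffix // => /(_ isT).
move: leN sA lt1; rewrite size_cat; move: (size _) (size _) (size wA); clear; lia.
Qed.

End AnnulusCurvature.

(** * Conjugacy from annular diagrams *)

Section AnnulusConjugacy.
Variables (X : countType) (Rs : word X -> Prop).
Hypothesis RsP : small_cancellation_relators Rs.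
Variables (H : groupType) (psi : free_group X -> H).
Hypothesis psiM : forall g g', psi (g * g') = psi g * psi g'.
Hypothesis psiR : forall w, Rs w -> psi (fg w) = 1.
Variables (u v : word X).
Hypotheses (v0 : v <> [::]) (u0 : u <> [::]).
Hypotheses (cr_v : cyclically_reduced v) (cr_u : cyclically_reduced u).
Hypothesis dv : forall k, dehn_reduced Rs (rot k v).
Hypothesis psiv : psi (fg v) <> 1.
Hypothesis u_third : forall k y w, infix y (rot k u) -> Rs w -> infix y w ->
  (3 * size y < size w)%N.
Variables (kA : nat) (wA wB : word X) (N : nat).
Hypotheses (eA : rot kA u = wA ++ wB) (N0 : (0 < N)%N) (leN : (N <= 3 * size wA)%N).
Hypothesis u_sixth : forall p w, p <> [::] -> infix p wA -> Rs w -> infix p w ->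
  (6 * size p < size w)%N /\ (6 * size p < N)%N.

(** Induction on the number of cells. Without mirror pairs there are no cells, and the diagram
    is a conjugacy in the free group; the value under psi of the conjugator survives the
    removal of mirror pairs. *)
Theorem annulus_conjugacy g g' D :
    (forall m, m \in D -> Rs m.2) -> face_prod [:: (g, v), (g', u) & D] = 1 ->
  exists2 h, psi h = psi (g^-1 * g') & fg v * (h * fg u * h^-1) = 1.
Proof.
have [n le_n] := ubnP (size D); elim: n D le_n g g' => // n IHn D le_n g g' DR D1.
have [n' [s [M [sV qM M1 eM]]]] := lifting D1.
case: M eM M1 qM => [//|[k vt] [//|[k' ut] M]] /= [eg ev eg' eu eM] M1 qM.
case: D le_n DR eM D1 => [_ _ _|m0 D0 le_n DR eM _].
  rewrite /face_prod /= mulg1 => e; exists (g^-1 * g') => //.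
  transitivity (g^-1 * 1 * g); last by rewrite mulg1 mulVg.
  by rewrite -e invgM invgK !mulgA mulVg mul1g.
set D := m0 :: D0 in le_n DR eM *.
pose cells := unzip2 M.
have cellsR c : c \in cells -> Rs (map s c).
  case/mapP => m mM ->; apply: (DR (letter_image s m.1, map s m.2)).
  by rewrite -eM; apply/mapP; exists m.
have nC : nullw [:: vt, ut & cells] by apply/nullwP; exists [:: (k, vt), (k', ut) & M].
have sz : size M = size D by rewrite -eM size_map.
have vt0 : vt <> [::] by move=> e; apply: v0; rewrite -ev e.
have ut0 : ut <> [::] by move=> e; apply: u0; rewrite -eu e.
have [[c [c' [cc cc' nc mir]]]|nomir] := pselect (exists c c', [/\ c \in cells, c' \in cells, c <> c' & mirror_faces s c c']).
  have cM : c \in unzip2 [:: (k, vt), (k', ut) & M] by rewrite !inE cc !orbT.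
  have c'M : c' \in unzip2 [:: (k, vt), (k', ut) & M] by rewrite !inE cc' !orbT.
  have lM : lifts s [:: (k, vt), (k', ut) & M] [:: (g, v), (g', u) & D].
    by split; rewrite //= eg ev eg' eu eM.
  have [h h1 hpsi] := mirror_reduce lM cM c'M (introN eqP nc) mir.
  have outer d w : d \in cells -> w <> [::] -> w \in [:: vt; ut] -> w != d.
    move=> dc; case: w => // x w _ wvu; apply/eqP => e.
    have xd : x \in d by rewrite -e mem_head.
    have [] := cell_disjoint qM dc xd; move: wvu; rewrite !inE.
    by case/orP => /eqP <-; rewrite mem_head.
  have psih := hpsi H psi psiM (psiR (cellsR _ cc')).
  move: h1; rewrite /= !outer ?mem_head ?inE ?eqxx ?orbT //= ev eu => h1.
  have [||h' h'1 h'2] := IHn _ _ _ _ _ h1.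
  - rewrite size_map size_filter; rewrite ltnS -sz in le_n; apply: leq_trans le_n.
    rewrite -(count_predC (fun m => (m.2 != c) && (m.2 != c')) M) -addn1 leq_add2l -has_count.
    by case/mapP: cc => m mM ->; apply/hasP; exists m; rewrite //= eqxx.
  - move=> m /mapP[m' + ->]; rewrite mem_filter => /andP[_ m'M] /=.
    by apply: cellsR; apply: map_f.
  by exists h' => //; rewrite h'1 !psiM !(homV psiM) !psih eg eg'.
exfalso.
have crv' : cyclically_reduced (map s vt) by rewrite ev.
have cru' : cyclically_reduced (map s ut) by rewrite eu.
have nomir' c c' : c \in cells -> c' \in cells -> c <> c' -> ~ mirror_faces s c c'.
  by move=> cc cc' nc mir; apply: nomir; exists c, c'.
have cells0 : cells <> [::] by move: sz; rewrite /cells /D; case: (M).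
subst v u.
exact: (annulus_contradiction RsP psiM psiR sV qM nC cellsR nomir' vt0 ut0 crv' cru' dv psiv
  u_third eA N0 leN u_sixth cells0).
Qed.
End AnnulusConjugacy.

(** * Symmetrised sets of relators *)

Section CyclicWords.
Variable X : countType.
Implicit Types (w y : word X).

Lemma winv_rot k w : exists j, winv (rot k w) = rot j (winv w).
Proof.
exists (size w - k)%N; rewrite /winv map_rot rev_rot /rotr size_rev size_map.
by [].
Qed.

(** The relation between a relator and the members of its symmetrised closure; it is symmetric
    and transitive, so it can be used to identify relators. *)
Definition cyclic_variant w w' : Prop := exists i, w = rot i w' \/ w = rot i (winv w').

Lemma cyclic_variant_trans w1 w2 w3 :
  cyclic_variant w1 w2 -> cyclic_variant w2 w3 -> cyclic_variant w1 w3.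
Proof.
have rr i j w : exists k, rot i (rot j w) = rot k w by apply: rot_rotE.
move=> [i [->|->]] [j [->|->]].
- by have [k ->] := rr i j w3; exists k; left.
- by have [k ->] := rr i j (winv w3); exists k; right.
- have [k ->] := winv_rot j w3; have [l ->] := rr i k (winv w3).
  by exists l; right.
- have [k ->] := winv_rot j (winv w3); rewrite winvK; have [l ->] := rr i k w3.
  by exists l; left.
Qed.

Lemma cyclic_variant_sym w w' : cyclic_variant w w' -> cyclic_variant w' w.
Proof.
have rk i y : exists k, y = rot k (rot i y).
  by exists (size (rot i y) - i)%N; rewrite -/(rotr i (rot i y)) rotK.
move=> [i [->|->]]; have [k ek] := rk i w'.
  by exists k; left.
have [l el] := winv_rot i (winv w'); rewrite winvK in el.
by have [m em] := rk l w'; exists m; right; rewrite el.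
Qed.

Lemma infix_rot_prefix y w : infix y w -> exists k, prefix y (rot k w).
Proof.
by case/infixP=> p [q ->]; exists (size p); rewrite rot_size_cat -catA prefix_prefix.
Qed.

Lemma infix_winv y w : infix y w -> infix (winv y) (winv w).
Proof. by case/infixP=> p [q ->]; rewrite !winv_cat -catA; apply/infixP; exists (winv q), (winv p). Qed.

End CyclicWords.

Section SymmetricClosure.
Variable X : countType.
Implicit Types (u r s : set (free_group X)) (w : word X).

Lemma sym_closureP u w : sym_closure u w <-> exists2 R, u R & cyclic_variant w (fword R).
Proof. by split=> h; exact: h. Qed.

Lemma sym_closure_sub r u : r `<=` u -> sym_closure r `<=` sym_closure u.
Proof. by move=> ru w [R rR h]; exists R => //; apply: ru. Qed.

Lemma sym_closure_rot u k w : sym_closure u w -> sym_closure u (rot k w).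
Proof.
case/sym_closureP=> R uR h; apply/sym_closureP; exists R => //.
by apply: cyclic_variant_trans h; exists k; left.
Qed.

Lemma sym_closure_winv u w : sym_closure u w -> sym_closure u (winv w).
Proof.
case/sym_closureP=> R uR h; apply/sym_closureP; exists R => //.
by apply: cyclic_variant_trans h; exists 0%N; right; rewrite rot0.
Qed.

Lemma metric_small_cancellation_sub lambda r u : r `<=` u ->
  metric_small_cancellation lambda u -> metric_small_cancellation lambda r.
Proof.
move=> ru Hu R P sR pR [P0 [R1 [R2 [s1 s2 ne p1 p2]]]].
have sub := sym_closure_sub ru.
by apply: Hu pR _; [exact: sub|split=> //; exists R1, R2; split=> //; exact: sub].
Qed.

Lemma sixth_ltn m n : ((m%:R : rat) < 1 / 6 * n%:R)%R -> (6 * m < n)%N.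
Proof.
rewrite GRing.mul1r -(@Num.Theory.ltr_nat rat) GRing.natrM => lt.
lra.
Qed.

Lemma sym_closure_small u : nontrivial_cyclically_reduced u ->
  metric_small_cancellation (1 / 6)%R u -> small_cancellation_relators (sym_closure u).
Proof.
move=> ncr C16.
have cr w : sym_closure u w -> cyclically_reduced w.
  by case=> R /ncr[_ crR] [i [->|->]]; rewrite cr_rot ?cr_winv.
have neq0 w : sym_closure u w -> w <> [::].
  case=> R /ncr[R1 _] [i e] w0; apply: R1; apply: val_inj => /=.
  by apply: size0nil; move: e; rewrite w0 => -[] /(congr1 size); rewrite size_rot ?size_winv.
split=> //; [exact: sym_closure_rot|exact: sym_closure_winv|].
move=> w w' p sw sw' ne pw pw'; have [->|/eqP p0] := eqVneq p [::].
  by rewrite muln0 lt0n size_eq0; apply/eqP/neq0.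
by apply: sixth_ltn; apply: C16 => //; split=> //; exists w, w'.
Qed.

Lemma star_reduced_dehn r x : star_reduced r x -> dehn_reduced (sym_closure r) x.
Proof.
move=> [rx nx]; split=> // y w yx sw yw; rewrite leqNgt; apply/negP => lt.
apply: nx; exists y, w; split=> //.
have : ((size w)%:R < 2 * (size y)%:R :> rat)%R by rewrite -GRing.natrM Num.Theory.ltr_nat.
by lra.
Qed.

End SymmetricClosure.

(** * Cancellation in products of words *)

Section CommonPrefix.
Variable T : eqType.
Implicit Types u v : seq T.

Fixpoint common_prefix u v : seq T :=
  match u, v with
  | a :: u', b :: v' => if a == b then a :: common_prefix u' v' else [::]
  | _, _ => [::]
  end.

Lemma common_prefix_prefix u v : prefix (common_prefix u v) u && prefix (common_prefix u v) v.
Proof.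
elim: u v => [|a u IHu] [|b v] //=; case: eqP => //= <-.
by rewrite eqxx; apply: IHu.
Qed.

Lemma common_prefix_max u v a b u' v' :
  u = common_prefix u v ++ a :: u' -> v = common_prefix u v ++ b :: v' -> a != b.
Proof.
elim: u v => [|c u IHu] [|d v] //=; case: eqP => [-> |/eqP ne] /=.
  by move=> [/IHu h] [/h].
by case=> <- _ [<- _].
Qed.
End CommonPrefix.

Section Segments.
Variables (X : countType) (T : eqType) (lw : T -> word X).
Hypothesis lw_reduced : forall a, reduced (lw a).
Implicit Types (a b z e : T) (L : seq T).

(** What cancels between a and b in a product, read from the side of b. *)
Definition overlap a b : word X := common_prefix (winv (lw a)) (lw b).

(** The part of a that survives between z and b. *)
Definition segment z a b : word X :=
  drop (size (overlap z a)) (take (size (lw a) - size (overlap a b)) (lw a)).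

(** The neighbours of the first and of the last factor are given separately, so that a cyclic
    product is the case where z is the last factor and e the first. *)
Fixpoint segments z L e : seq (word X) :=
  if L is a :: L' then segment z a (head e L') :: segments a L' e else [::].

Definition short_overlap : rel T := fun a b =>
  (6 * size (overlap a b) < size (lw a))%N && (6 * size (overlap a b) < size (lw b))%N.

(** The two overlaps take less than a sixth each. *)
Lemma segmentE z a b : short_overlap z a -> short_overlap a b ->
  lw a = overlap z a ++ segment z a b ++ winv (overlap a b) /\
  (2 * size (lw a) < 3 * size (segment z a b))%N.
Proof.
move=> /andP[_ lt1] /andP[lt2 _].
have /andP[_ /prefixP[q1 e1]] := common_prefix_prefix (winv (lw z)) (lw a).
have /andP[/prefixP[q2 e2] _] := common_prefix_prefix (winv (lw a)) (lw b).
rewrite -/(overlap z a) in e1; rewrite -/(overlap a b) in e2.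
have e3 : lw a = winv q2 ++ winv (overlap a b) by rewrite -winv_cat -e2 winvK.
have sz : size (lw a) = (size q2 + size (overlap a b))%N by rewrite e3 size_cat !size_winv.
have tk : take (size (lw a) - size (overlap a b)) (lw a) = winv q2.
  by rewrite sz addnK e3 take_size_cat // size_winv.
have sseg : size (segment z a b) = (size q2 - size (overlap z a))%N.
  by rewrite /segment tk size_drop size_winv.
split; last by move: lt1 lt2 sz; rewrite sseg; move: (size _) (size _) (size _) (size _); clear; lia.
rewrite catA [X in X ++ _](_ : _ = winv q2) // -[RHS](cat_take_drop (size (overlap z a))) /segment tk.
congr (_ ++ _).
have -> : take (size (overlap z a)) (winv q2) = take (size (overlap z a)) (lw a).
  rewrite e3 takel_cat // size_winv.
  by move: lt1 lt2 sz; move: (size _) (size _) (size _) (size _); clear; lia.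
by rewrite e1 take_size_cat.
Qed.

(** Such an x is the letter of z before its overlap with a. This describes the last letter of
    a segment independently of what precedes it. *)
Definition stops z a x : Prop := exists P, winv (lw z) = overlap z a ++ linv x :: P.

(** A letter x left over at the end of z does not cancel with the first letter of the next
    segment, as overlaps are maximal. *)
Lemma segment_step z a b x : short_overlap z a -> short_overlap a b -> stops z a x ->
  path (@noncancel X) x (segment z a b) /\ stops a b (last x (segment z a b)).
Proof.
move=> hz hb [P eP]; have [e1 lt] := segmentE hz hb.
have rA : reduced (segment z a b).
  by apply: reduced_infix (lw_reduced a); rewrite {1}e1; apply/infixP; exists (overlap z a), (winv (overlap a b)).
case eA : (segment z a b) rA e1 lt => [|y A'] rA e1 lt.
  by move: lt; rewrite muln0 ltn0.
split.
  apply/andP; split=> //; rewrite /noncancel eq_sym.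
  exact: (common_prefix_max eP e1).
have [A1 [y1 e2]] : exists A1 y1, y :: A' = rcons A1 y1 by case/lastP: (A') => [|A1 y1]; [exists [::], y | exists (y :: A1), y1].
rewrite e2 last_rcons; rewrite e2 in e1.
by exists (winv A1 ++ winv (overlap z a)); rewrite e1 !winv_cat winv_rcons winvK -catA.
Qed.

Lemma segments_spec z a L e x : path short_overlap z (rcons (a :: L) e) -> stops z a x ->
  let w := flatten (segments z (a :: L) e) in
  [/\ path (@noncancel X) x w, stops (last a L) e (last x w) &
    fg (flatten (map lw (a :: L))) = fg (overlap z a) * fg w * (fg (overlap (last a L) e))^-1].
Proof.
elim: L z a x => [|b L IHL] z a x /=.
  move=> /and3P[hz he _] st; have [h1 h2] := segment_step hz he st.
  have [e1 _] := segmentE hz he; rewrite !cats0; split=> //.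
  by rewrite {1}e1 !fg_cat fg_winv mulgA.
move=> /andP[hz hL] st; have hb : short_overlap a b by case/andP: hL.
have [h1 h2] := segment_step hz hb st; have [e1 _] := segmentE hz hb.
have /= [i1 i2 i3] := IHL a b _ hL h2.
rewrite cat_path last_cat h1 i1; split=> //.
rewrite fg_cat {1}e1 !fg_cat in i3 *; rewrite i3 fg_winv !mulgA mulgVK //.
Qed.

Lemma segments_sizes z L e A : path short_overlap z (rcons L e) -> A \in segments z L e ->
  exists2 a, a \in L & infix A (lw a) /\ (2 * size (lw a) < 3 * size A)%N.
Proof.
elim: L z => //= a L IHL z /andP[ha hL]; rewrite inE => /orP[/eqP->|/(IHL _ hL)[b bL h]].
  have hb : short_overlap a (head e L) by case: (L) hL => [|b L'] /= /andP[].
  have [e1 lt] := segmentE ha hb; exists a; first exact: mem_head.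
  split=> //; rewrite {1}e1; apply/infixP.
  by exists (overlap z a), (winv (overlap a (head e L))).
by exists b; rewrite // inE bL orbT.
Qed.

End Segments.

(** * The cyclic core of a product of words *)

Section Blocks.
Variable T : eqType.
Implicit Types (y u v A d : seq T) (L : seq (seq T)).

Lemma infix_catP y u v : infix y (u ++ v) ->
  [\/ infix y u, infix y v | exists y1 y2, [/\ y = y1 ++ y2, infix y1 u & prefix y2 v]].
Proof.
have catI (a b c : seq T) : a ++ b = a ++ c -> b = c.
  by move=> /eqP; rewrite eqseq_cat // eqxx /= => /eqP.
case/infixP=> p [q]; rewrite catA => e; have [[d ed]|[d _ ed]] := cat_cases e; last first.
  by apply: Or31; apply/infixP; exists p, d; rewrite ed -catA.
have ev : v = d ++ q by apply: (catI u); rewrite e ed -catA.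
have [[d' ed']|[d' _ ed']] := cat_cases ed.
  apply: Or33; exists d', d; rewrite ev prefix_prefix ed' suffixW ?suffix_suffix //; split=> //.
  by apply: (catI p); rewrite ed ed' -catA.
apply: Or32; apply/infixP; exists d', q; rewrite ev catA; congr (_ ++ _).
by apply: (catI u); rewrite -ed ed' -catA.
Qed.

Lemma prefix_flatten y L b : prefix y (flatten (rcons L b)) ->
    (forall A, A \in L -> ~~ infix A y) ->
  exists2 A, A \in rcons L b & infix y A.
Proof.
elim: L y => [|A L IHL] y /=.
  by rewrite cats0 => py _; exists b; rewrite ?mem_head // prefixW.
move=> /prefixP[q] e nA; have [[d ed]|[d _ ed]] := cat_cases e; last first.
  by exists A; rewrite ?mem_head // ed prefixW // prefix_prefix.
by have := nA A (mem_head _ _); rewrite ed prefixW // prefix_prefix.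
Qed.

(** A word that contains none of the middle blocks meets two consecutive blocks at most. *)
Lemma infix_flatten y d L b : infix y (flatten (d :: rcons L b)) ->
    (forall A, A \in L -> ~~ infix A y) ->
  exists y1 y2 A1 A2, [/\ y = y1 ++ y2, A1 \in d :: rcons L b, A2 \in d :: rcons L b,
    infix y1 A1 & infix y2 A2].
Proof.
elim: L d => [|A L IHL] d.
  rewrite /= cats0 => /infix_catP[yd|yb|[y1 [y2 [-> h1 /prefixW h2]]]] _.
  - by exists y, [::], d, d; rewrite cats0 mem_head infix0s.
  - by exists y, [::], b, b; rewrite cats0 !inE eqxx orbT infix0s.
  - by exists y1, y2, d, b; rewrite !inE !eqxx orbT.
rewrite rcons_cons [flatten _]/(d ++ flatten (A :: rcons L b)).
move=> /infix_catP[yd|yb|[y1 [y2 [-> h1 h2]]]] nA.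
- by exists y, [::], d, d; rewrite cats0 mem_head infix0s.
- have [||y1 [y2 [A1 [A2 [e m1 m2 i1 i2]]]]] := IHL A => //.
    by move=> B BL; apply: nA; rewrite inE BL orbT.
  by exists y1, y2, A1, A2; split=> //; rewrite inE ?m1 ?m2 orbT.
- have [|A2 m2 i2] := @prefix_flatten y2 (A :: L) b h2.
    by move=> B /nA; apply: contra => i; apply: infix_trans i (suffixW (suffix_suffix _ _)).
  by exists y1, y2, d, A2; rewrite mem_head inE m2 orbT.
Qed.

Lemma rot_flatten k L : L <> [::] ->
  exists L' d1 d2, [/\ rot k (flatten L) = flatten (d2 :: rcons L' d1), d1 ++ d2 \in L &
    {subset L' <= L}].
Proof.
move=> L0.
suff [L1 [A [L2 [d1 [d2 [eL eA et ed]]]]]] : exists L1 A L2 d1 d2, [/\ L = L1 ++ A :: L2,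
    A = d1 ++ d2, take k (flatten L) = flatten L1 ++ d1 & drop k (flatten L) = d2 ++ flatten L2].
  exists (L2 ++ L1), d1, d2; rewrite /rot et ed /= flatten_rcons flatten_cat !catA eL -eA.
  split=> //; first by rewrite mem_cat mem_head orbT.
  by move=> B; rewrite !mem_cat inE => /orP[->|->]; rewrite ?orbT.
elim: L k L0 => // A L IHL k _ /=.
have [le|lt] := leqP k (size A).
  exists [::], A, L, (take k A), (drop k A); rewrite cat_take_drop takel_cat //.
  split=> //; rewrite drop_cat; case: ltngtP le => // ->; by rewrite subnn drop0 drop_size.
case: L IHL => [|B L] IHL.
  by exists [::], A, [::], A, [::]; rewrite /= !cats0 take_oversize ?drop_oversize // ltnW.
have [|L1 [A' [L2 [d1 [d2 [eL eA et ed]]]]]] := IHL (k - size A)%N => //.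
exists (A :: L1), A', L2, d1, d2; rewrite eL; split=> //.
  by rewrite take_cat ltnNge (ltnW lt) /= -eL et -catA.
by rewrite drop_cat ltnNge (ltnW lt) /= -eL ed.
Qed.
End Blocks.

Section CyclicCore.
Variables (X : countType) (Rs : word X -> Prop).
Hypothesis RsP : small_cancellation_relators Rs.

Definition short_pieces (W : word X) : Prop :=
  forall p w, Rs w -> infix p w -> infix p W -> p <> [::] ->
  (6 * size p < size w)%N /\ (6 * size p < size W)%N.

(** A common subword with a relator contains no whole block, a block being more than two
    thirds of some W. Hence it meets at most two blocks, each in less than a sixth of the
    relator. *)
Lemma blocks_third (L : seq (word X)) : L <> [::] ->
    (forall A, A \in L -> exists2 W, short_pieces W & infix A W /\ (2 * size W < 3 * size A)%N) ->
  forall k y w, infix y (rot k (flatten L)) -> Rs w -> infix y w -> (3 * size y < size w)%N.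
Proof.
move=> L0 block k y w iy Rw yw.
have w0 : (0 < size w)%N by rewrite lt0n size_eq0; apply/eqP/(relator_neq0 RsP).
have [L' [d1 [d2 [er dL subL]]]] := rot_flatten k L0; rewrite er in iy.
have nA A : A \in L' -> ~~ infix A y.
  move=> /subL/block[W pW [AW lt]]; apply/negP => Ay.
  have A0 : A <> [::] by move=> A0; move: lt; rewrite A0 muln0.
  have [_ lt'] := pW A w Rw (infix_trans Ay yw) AW A0.
  by move: lt lt'; move: (size A) (size W); clear; lia.
have [y1 [y2 [A1 [A2 [ey m1 m2 i1 i2]]]]] := infix_flatten iy nA.
have short z A : A \in d2 :: rcons L' d1 -> infix z A -> infix z y -> (6 * size z < size w)%N.
  move=> Am zA zy; have [->|/eqP z0] := eqVneq z [::]; first by rewrite muln0.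
  have [W pW AW] : exists2 W, short_pieces W & infix A W.
    move: Am; rewrite inE mem_rcons inE => /or3P[/eqP->|/eqP->|/subL/block[W pW [AW _]]].
    - by have [W pW [AW _]] := block _ dL; exists W => //; apply: infix_trans AW; rewrite suffixW // suffix_suffix.
    - by have [W pW [AW _]] := block _ dL; exists W => //; apply: infix_trans AW; rewrite prefixW // prefix_prefix.
    - by exists W.
  by have [] := pW z w Rw (infix_trans zy yw) (infix_trans zA AW) z0.
have := short y1 A1 m1 i1; have := short y2 A2 m2 i2; rewrite ey size_cat.
rewrite suffixW ?suffix_suffix // prefixW ?prefix_prefix // => /(_ isT) h2 /(_ isT) h1.
by move: h1 h2; move: (size y1) (size y2) (size w); clear; lia.
Qed.

Variables (T : eqType) (lw : T -> word X).
Hypothesis lw_reduced : forall a, reduced (lw a).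

(** Cancel cyclically between consecutive factors. The product of the segments is u, and wA is
    the first of them. *)
Theorem cyclic_core J : J <> [::] -> path.cycle (short_overlap lw) J ->
    (forall a, a \in J -> short_pieces (lw a)) ->
  exists c u wA wB N, [/\ cyclically_reduced u, u <> [::],
    fg (flatten (map lw J)) = c * fg u * c^-1,
    forall k y w, infix y (rot k u) -> Rs w -> infix y w -> (3 * size y < size w)%N &
    [/\ u = wA ++ wB, (0 < N)%N, (N <= 3 * size wA)%N &
      forall p w, p <> [::] -> infix p wA -> Rs w -> infix p w ->
        (6 * size p < size w)%N /\ (6 * size p < N)%N]].
Proof.
case: J => // a L _ cyc pieces.
pose z := last a L.
have hJ : path (short_overlap lw) z (rcons (a :: L) a).
  have := cyc; rewrite (cycle_path a) [last _ _]/(last a L) => h.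
  by rewrite rcons_path h /=; move: cyc; rewrite /= rcons_path => /andP[].
pose S := segments lw z (a :: L) a; pose u := flatten S.
have block A : A \in S -> exists2 W, short_pieces W & infix A W /\ (2 * size W < 3 * size A)%N.
  by move=> /(segments_sizes hJ)[b bJ h]; exists (lw b) => //; apply: pieces.
pose A := segment lw z a (head a L).
have AS : A \in S by apply: mem_head.
have [W pW [AW ltW]] := block A AS.
have A0 : A <> [::] by move=> e; move: ltW; rewrite e muln0.
have [x st] : exists x, stops lw z a x.
  have /andP[/andP[lt _] _] := hJ.
  have /andP[/prefixP[q eq] _] := common_prefix_prefix (winv (lw z)) (lw a).
  case: q eq => [|x q] eq; last by exists (linv x), q; rewrite linvK.
  have := congr1 size eq; rewrite cats0 size_winv -/(overlap lw z a); move: lt.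
  by move: (size _) (size _); clear; lia.
have [h1 h2 h3] := segments_spec lw_reduced hJ st; rewrite -/S -/u in h1 h2 h3.
have u0 : u <> [::] by rewrite /u /S /= -/A; case: (A) A0.
exists (fg (overlap lw z a)), u, A, (flatten (segments lw a L a)), (size W); split=> //.
- rewrite /cyclically_reduced (cycle_path x).
  rewrite (_ : last x u = x) //; case: st h2 => P eP [P' eP'].
  have /eqP := etrans (esym eP) eP'.
  by rewrite eqseq_cat // eqxx => /eqP/(congr1 (head x))/linv_inj.
- exact: blocks_third.
split=> //.
- by case: (W) AW A0 => // /infixP[p [q]]; case: (A) => //; case: p.
- by move: ltW; move: (size _) (size _); clear; lia.
- by move=> p w p0 pA Rw pw; apply: pW => //; apply: infix_trans AW.
Qed.
End CyclicCore.

(** * Generated subgroups and normal closures *)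

Lemma cyclic_reduction (Y : countType) (T : word Y) : exists c T',
  [/\ cyclically_reduced T', {subset T' <= T} & fg T = fg c * fg T' * (fg c)^-1].
Proof.
have [n] := ubnP (size T); elim: n T => // n IHn T; rewrite ltnS => le_n.
have [rT|nrT] := boolP (reduced T); last first.
  have [u [a [v eT]]] := not_reducedP nrT.
  have [|c [T' [cr sub e]]] := IHn (u ++ v).
    by apply: leq_trans le_n; rewrite eT !size_cat /=; clear; lia.
  exists c, T'; split=> //; last by rewrite -e eT fg_cancel.
  by move=> x /sub; rewrite eT !mem_cat !inE => /orP[->|->]; rewrite ?orbT.
have [cr|ncr] := boolP (cyclically_reduced T).
  by exists [::], T; split=> //; rewrite fg_nil mul1g invg1 mulg1.
have T0 : T <> [::] by move=> e; rewrite e in ncr.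
have [a [v eT]] := reduced_not_cr rT T0 ncr.
have [|c [T' [cr sub e]]] := IHn v.
  by apply: leq_trans le_n; rewrite eT /= size_rcons; clear; lia.
exists (linv a :: c), T'; split=> //.
  by move=> x /sub xv; rewrite eT inE mem_rcons inE xv !orbT.
rewrite eT -cats1 -[linv a :: v ++ _]/([:: linv a] ++ v ++ _) -[linv a :: c]/([:: linv a] ++ c) !fg_cat e.
by rewrite -[[:: linv a]]/(winv [:: a]) fg_winv invgM invgK !mulgA.
Qed.

Section Presentation.
Variable X : countType.
Implicit Types (r s t : set (free_group X)).

Definition letter_word (a : free_group X * bool) : word X :=
  if a.2 then fword a.1 else winv a.1.

Lemma fg_substitute (T : word (free_group X)) :
  fg (substitute T) = evw (fun a => fg (letter_word a)) T.
Proof. by elim: T => //= a T <-; rewrite -fg_cat. Qed.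

Lemma letter_wordV a : fg (letter_word (linv a)) = (fg (letter_word a))^-1.
Proof. by case: a => g [] /=; rewrite /letter_word /= fg_winv ?invgK. Qed.

(** Substitution is a morphism of free groups. *)
Lemma fg_substitute_eq (T T' : word (free_group X)) : fg T = fg T' -> fg (substitute T) = fg (substitute T').
Proof. by move=> e; rewrite !fg_substitute -!(evg_fg letter_wordV) e. Qed.

Lemma substitute_cat (T T' : word (free_group X)) : substitute (T ++ T') = substitute T ++ substitute T'.
Proof. by rewrite /substitute map_cat flatten_cat. Qed.

Lemma generated1 s : generated s 1.
Proof. by move=> H [[H1 _] _]; apply: set_mem H1. Qed.

Lemma generatedP s U : generated s U ->
  exists2 T : word (free_group X), (forall a, a \in T -> s a.1) & U = fg (substitute T).
Proof.
pose E : set (free_group X) := [set U | exists2 T : word (free_group X),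
  (forall a, a \in T -> s a.1) & U = fg (substitute T)].
apply: (_ : forall U, generated s U -> E U) => {}U; apply; split; last first.
  move=> R sR; exists [:: (R, true)]; first by move=> a; rewrite inE => /eqP->.
  by rewrite /substitute /= cats0 fg_fword.
split; first by apply: mem_set; exists [::]; rewrite // /substitute fg_nil.
move=> _ _ /set_mem[T sT ->] /set_mem[T' sT' ->]; apply: mem_set.
exists (T ++ winv T').
  by move=> a; rewrite mem_cat mem_winv => /orP[/sT|/sT'].
by rewrite substitute_cat fg_cat !fg_substitute evw_winv //; exact: letter_wordV.
Qed.

Lemma face_prod_inv (D : seq (free_group X * word X)) :
  face_prod (rev [seq (m.1, winv m.2) | m <- D]) = (face_prod D)^-1.
Proof.
elim: D => [|m D IH]; first by rewrite /face_prod /= invg1.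
rewrite /= rev_cons -cats1 face_prod_cat IH /face_prod /= mulg1 !invgM invgK fg_winv.
by rewrite !mulgA.
Qed.

Lemma normal_closureP r h : normal_closure r h ->
  exists2 D : seq (free_group X * word X), (forall m, m \in D -> sym_closure r m.2) & face_prod D = h.
Proof.
pose E : set (free_group X) := [set h | exists2 D : seq (free_group X * word X),
  (forall m, m \in D -> sym_closure r m.2) & face_prod D = h].
apply: (_ : forall h, normal_closure r h -> E h) => {}h; apply; split; last first.
  move=> R rR; exists [:: (1, fword R)].
    move=> m; rewrite inE => /eqP->; apply/sym_closureP; exists R => //.
    by exists 0%N; left; rewrite rot0.
  by rewrite /face_prod /= mul1g invg1 !mulg1 fg_fword.
split.
  split; first by apply: mem_set; exists [::].
  move=> _ _ /set_mem[D rD <-] /set_mem[D' rD' <-]; apply: mem_set.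
  exists (D ++ rev [seq (m.1, winv m.2) | m <- D']).
    move=> m; rewrite mem_cat mem_rev => /orP[/rD//|/mapP[m' /rD' h' ->]].
    exact: sym_closure_winv.
  by rewrite face_prod_cat face_prod_inv.
move=> _ g [D rD <-]; exists [seq (g^-1 * m.1, m.2) | m <- D].
  by move=> m /mapP[m' /rD h' ->].
elim: D {rD} => [|m D IH]; first by rewrite /face_prod /= conj1g.
rewrite /face_prod /= -!/(face_prod _) IH conjMg; congr (_ * _).
by rewrite /conjg invgM invgK !mulgA.
Qed.

End Presentation.

(** * The group of a presentation *)

Section NaturalMap.
Variables (X : countType) (r : set (free_group X)).
Local Notation Rs := (sym_closure r).

Lemma natural_map_eq1 h : natural_map r h = 1 <-> normal_closure r h.
Proof.
split=> [e|Nh]; first by have := (eq_natural_map r 1 h).1 (esym e); rewrite invg1 mul1g.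
by apply/esym/(eq_natural_map r 1 h); rewrite invg1 mul1g.
Qed.

Lemma fg_rot k (w : word X) : fg (rot k w) = fg w ^ fg (take k w).
Proof. by rewrite /rot -[X in fg X ^ _](cat_take_drop k w) !fg_cat /conjg -mulgA mulKg. Qed.

Lemma natural_map_relator w : Rs w -> natural_map r (fg w) = 1.
Proof.
case/sym_closureP=> R rR [i e]; apply/natural_map_eq1.
have NR : normal_closure r R by move=> M [_ rM]; apply: rM.
by case: e => ->; rewrite fg_rot; apply: normal_closure_conj; rewrite ?fg_winv fg_fword //;
  apply: normal_closureV.
Qed.

Hypothesis RsP : small_cancellation_relators Rs.

(** This is [dehn_bigon] with an empty rho: a Dehn reduced word that bounds a disc with cells
    would be a whole relator. *)
Lemma dehn_nontrivial x : dehn_reduced Rs x -> x <> [::] -> natural_map r (fg x) <> 1.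
Proof.
move=> dx x0 /natural_map_eq1/normal_closureP[D rD eD].
have nx : nullw (x :: rev [seq winv m.2 | m <- D]).
  apply/nullwP; exists ((1, x) :: rev [seq (m.1, winv m.2) | m <- D]).
    by rewrite /unzip2 /= map_rev -map_comp.
  by rewrite /face_prod /= -/(face_prod _) mul1g invg1 mulg1 -eD face_prod_inv mulgV.
case: D rD eD nx => [_ /esym x1 _|m D rD _ nx].
  by apply: x0; apply: fg_inj => //; case: dx.
have Rc := rD m (mem_head _ _); set c := m.2 in Rc.
have dk : disk Rs (size (m :: D)) (x ++ [::]).
  rewrite cats0; exists (rev [seq winv m.2 | m <- m :: D]); rewrite size_rev size_map.
  split=> // c'; rewrite mem_rev => /mapP[m' /rD h ->]; exact: sym_closure_winv.
have [//|e] := dehn_bigon RsP dx (rho := [::]) Rc dk.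
have := dx.2 c c; rewrite e infix_refl => /(_ isT Rc isT); rewrite leqNgt ltn_Pmull //.
by rewrite lt0n size_eq0 -e; apply/eqP.
Qed.

(** When a pair is cancelled in w or in a rotation of it, each rotation of the shorter word
    has the same value as a rotation of w, so that the hypothesis persists. *)
Lemma dehn_core w : cyclically_star_reduced r w ->
  exists d v, [/\ v <> [::], cyclically_reduced v, fg w = d * fg v * d^-1 &
    forall k, dehn_reduced Rs (rot k v)].
Proof.
have eqfr (u v : word X) : fg u = fg v -> free_reduction u = free_reduction v.
  by move=> /(congr1 (@fword X)).
have [n] := ubnP (size w); elim: n w => // n IHn w; rewrite ltnS => le_n Qw.
have [crw|ncr] := boolP (cyclically_reduced w).
  have red k : free_reduction (rot k w) = rot k w.
    by apply: free_reduction_id; apply: cr_reduced; rewrite cr_rot.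
  exists 1, w; split=> //; last by move=> k; apply: star_reduced_dehn; rewrite -red; apply: (Qw k).2.
    by move=> w0; have [] := Qw 0%N; rewrite red rot0.
  by rewrite mul1g invg1 mulg1.
have step k u a v : rot k w = u ++ a :: linv a :: v -> exists d v', [/\ v' <> [::], cyclically_reduced v',
    fg (rot k w) = d * fg v' * d^-1 & forall k, dehn_reduced Rs (rot k v')].
  move=> e; rewrite e fg_cancel; apply: IHn.
    by apply: leq_trans le_n; rewrite -(size_rot k w) e !size_cat /=; clear; lia.
  move=> i.
  have [j ej] : exists j, fg (rot i (u ++ v)) = fg (rot j (rot k w)).
    have [p [q [-> euv]]] : exists p q, rot i (u ++ v) = q ++ p /\ u ++ v = p ++ q.
      by exists (take i (u ++ v)), (drop i (u ++ v)); rewrite cat_take_drop.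
    have [[d ed]|[d _ ed]] := cat_cases (esym euv).
      have eq : q = d ++ v by move: euv; rewrite ed -catA => /eqP; rewrite eqseq_cat // eqxx => /eqP.
      by exists (size p); rewrite e ed -catA rot_size_cat eq -!catA /= fg_cancel.
    have ev : v = d ++ q by move: euv; rewrite ed -catA => /eqP; rewrite eqseq_cat // eqxx => /eqP.
    exists (size (u ++ a :: linv a :: d)).
    by rewrite e ev -2!cat_cons catA rot_size_cat ed !(catA q) fg_cancel.
  by have [l el] := rot_rotE j k w; rewrite (eqfr _ _ ej) el; apply: Qw.
have [rw|nrw] := boolP (reduced w); last first.
  have [u [a [v e]]] := not_reducedP nrw.
  by have := step 0%N u a v; rewrite rot0; apply.
have w0 : w <> [::] by move=> e; rewrite e in ncr.
have [a [v e]] := reduced_not_cr rw w0 ncr.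
have [|d [v' [h1 h2 h3 h4]]] := step 1%N v a [::].
  by rewrite e rot1_cons -cats1 -cats1 -catA.
exists ((fg (take 1 w)) * d), v'; split=> //.
have -> : fg w = fg (take 1 w) * fg (rot 1 w) * (fg (take 1 w))^-1.
  by rewrite fg_rot /conjg !mulgA mulgV mul1g mulgK.
by rewrite h3 invgM !mulgA.
Qed.
End NaturalMap.

(** * Small cancellation between two sets of relators *)

Section TwoSets.
Variables (X : countType) (r s : set (free_group X)).
Hypotheses (rs_reduced : nontrivial_cyclically_reduced (r `|` s))
  (rs_disjoint : r `&` s = set0)
  (rs_irredundant : irredundant (r `|` s))
  (rs_C16 : metric_small_cancellation (1 / 6)%R (r `|` s)).

Lemma union_small : small_cancellation_relators (sym_closure (r `|` s)).
Proof. exact: sym_closure_small. Qed.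

Lemma left_small : small_cancellation_relators (sym_closure r).
Proof.
apply: sym_closure_small; first by move=> R rR; apply: rs_reduced; left.
by apply: metric_small_cancellation_sub rs_C16 => R; left.
Qed.

Lemma cyclic_variant_eq R R' : (r `|` s) R -> (r `|` s) R' -> cyclic_variant (fword R) (fword R') -> R = R'.
Proof.
move=> uR uR' h; have [//|ne] := pselect (R = R').
by case: (rs_irredundant uR uR' ne).
Qed.

(** A common member would make an element of r a cyclic variant of an element of s. *)
Lemma closures_disjoint w : sym_closure r w -> ~ sym_closure s w.
Proof.
case/sym_closureP=> R rR h /sym_closureP[S sS h'].
have e : R = S.
  apply: cyclic_variant_eq; [by left|by right|].
  exact: cyclic_variant_trans (cyclic_variant_sym h) h'.
suff : (r `&` s) R by rewrite rs_disjoint.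
by split=> //; rewrite e.
Qed.

Lemma letter_word_variant (a : free_group X * bool) : cyclic_variant (letter_word a) (fword a.1).
Proof. by exists 0%N; rewrite !rot0 /letter_word; case: a.2; [left|right]. Qed.

Lemma letter_word_reduced a : reduced (@letter_word X a).
Proof. by rewrite /letter_word; case: a.2; rewrite ?reduced_winv; apply: fwordP. Qed.

(** The relator and the word of a, rotated so that the common subword comes first, are
    different members of the closure of the union, so this subword is a piece. *)
Lemma cross_pieces a : s a.1 -> short_pieces (sym_closure r) (letter_word a).
Proof.
move=> sa p w rw /infix_rot_prefix[k pk] /infix_rot_prefix[l pl] _.
have sW : sym_closure s (rot l (letter_word a)).
  by apply: sym_closure_rot; apply/sym_closureP; exists a.1 => //; exact: letter_word_variant.
have rW : sym_closure r (rot k w) by apply: sym_closure_rot.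
have ne : rot k w <> rot l (letter_word a) by move=> e; apply: (closures_disjoint rW); rewrite e.
have u1 := sym_closure_sub (@subsetUl _ r s) rW; have u2 := sym_closure_sub (@subsetUr _ r s) sW.
have := relator_piece union_small u1 u2 ne pk pl; have := relator_piece union_small u2 u1 (nesym ne) pl pk.
by rewrite !size_rot.
Qed.

(** The overlap is a piece unless the inverse of a and b coincide as words. As no relator is
    listed twice this means that b is the inverse letter of a, or that a relator is its own
    inverse. *)
Lemma letter_short_overlap a b : s a.1 -> s b.1 -> noncancel a b -> short_overlap (@letter_word X) a b.
Proof.
move=> sa sb nc.
have ua : (r `|` s) a.1 by right.
have ub : (r `|` s) b.1 by right.
have sWa : sym_closure (r `|` s) (winv (letter_word a)).
  by apply: sym_closure_winv; apply/sym_closureP; exists a.1 => //; exact: letter_word_variant.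
have sWb : sym_closure (r `|` s) (letter_word b).
  by apply/sym_closureP; exists b.1 => //; exact: letter_word_variant.
have ne : winv (letter_word a) <> letter_word b.
  move=> e; have e1 : a.1 = b.1.
    apply: cyclic_variant_eq => //.
    apply: cyclic_variant_trans (cyclic_variant_sym (letter_word_variant a)) _.
    apply: cyclic_variant_trans (letter_word_variant b); rewrite -e; exists 0%N; right.
    by rewrite rot0 winvK.
  have e2 : b.2 = a.2.
    apply/eqP; rewrite -[b.2 == a.2]negbK; apply/negP => ne2; case/negP: nc; apply/eqP.
    rewrite [b]surjective_pairing -e1 /linv; congr (_, _).
    by case: (b.2) (a.2) ne2 => [] [].
  have eab : b = a by rewrite [b]surjective_pairing -e1 e2 -surjective_pairing.
  rewrite eab in e sWb; have := reduced_winv_nil (letter_word_reduced a) e.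
  exact: (relator_neq0 union_small sWb).
have /andP[p1 p2] := common_prefix_prefix (winv (letter_word a)) (letter_word b).
have := relator_piece union_small sWa sWb ne p1 p2.
have := relator_piece union_small sWb sWa (nesym ne) p2 p1.
by rewrite size_winv /short_overlap /overlap => -> ->.
Qed.

Lemma generated_core U : generated s U -> U <> 1 ->
  exists c u wA wB N, [/\ cyclically_reduced u, u <> [::], U = c * fg u * c^-1,
    forall k y w, infix y (rot k u) -> sym_closure r w -> infix y w -> (3 * size y < size w)%N &
    [/\ u = wA ++ wB, (0 < N)%N, (N <= 3 * size wA)%N &
      forall p w, p <> [::] -> infix p wA -> sym_closure r w -> infix p w ->
        (6 * size p < size w)%N /\ (6 * size p < N)%N]].
Proof.
case/generatedP=> T sT -> U1; have [d [J [crJ subJ eJ]]] := cyclic_reduction T.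
have eU : fg (substitute T) = fg (substitute d) * fg (substitute J) * (fg (substitute d))^-1.
  rewrite (@fg_substitute_eq _ T (d ++ J ++ winv d)); last by rewrite eJ !fg_cat fg_winv mulgA.
  by rewrite !substitute_cat !fg_cat !fg_substitute (evw_winv (@letter_wordV X)) mulgA.
have J0 : J <> [::] by move=> e; apply: U1; rewrite eU e /substitute mulg1 mulgV.
have cyc : path.cycle (short_overlap (@letter_word X)) J.
  apply: (sub_in_cycle (P := [in J])) crJ; last exact/allP.
  by move=> a b aJ bJ; apply: letter_short_overlap; apply: sT; apply: subJ.
have [|c [u [wA [wB [N [h1 h2 h3 h4 h5]]]]]] := cyclic_core left_small letter_word_reduced J0 cyc.
  by move=> a aJ; apply: cross_pieces; apply: sT; apply: subJ.
exists (fg (substitute d) * c), u, wA, wB, N; split=> //.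
by rewrite eU h3 invgM !mulgA.
Qed.
End TwoSets.

(** * Conjugacy of the two subgroups *)

Lemma dehn_reduced_winv (X : countType) (Rs : word X -> Prop) x :
  small_cancellation_relators Rs -> dehn_reduced Rs x -> dehn_reduced Rs (winv x).
Proof.
move=> RsP [rx dx]; split; first by rewrite reduced_winv.
move=> y w yx Rw yw; rewrite -(size_winv y) -(size_winv w).
apply: dx (relator_winv RsP Rw) (infix_winv yw).
by rewrite -(winvK x); apply: infix_winv.
Qed.

Lemma subset1_neq (G : groupType) (A : set G) : A <> [set 1] -> A 1 -> exists2 h, A h & h <> 1.
Proof.
move=> nA A1; have [//|no] := pselect (exists2 h, A h & h <> 1).
case: nA; apply/seteqP; split=> [h Ah|_ ->] //=.
by have [//|h1] := pselect (h = 1); case: no; exists h.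
Qed.

Lemma mem_free_reduction (Y : eqType) (w : word Y) : {subset free_reduction w <= w}.
Proof.
elim: w => //= a w IHw x; rewrite inE; move: (IHw x).
case: (free_reduction w) => [|b l] /=; first by rewrite inE => _ ->.
case: ifP => _; rewrite !inE; last by move=> h /orP[->//|/h->]; rewrite orbT.
by move=> h xl; rewrite h ?orbT // xl orbT.
Qed.

Section Conjugacy.
Variables (X : countType) (r s t : set (free_group X)).
Hypotheses (rs_reduced : nontrivial_cyclically_reduced (r `|` s))
  (rs_disjoint : r `&` s = set0)
  (rs_irredundant : irredundant (r `|` s))
  (rs_C16 : metric_small_cancellation (1 / 6)%R (r `|` s))
  (t_reduced : forall T : word (free_group X),
       (forall a, a \in T -> t a.1) -> T <> [::] -> reduced T ->
       cyclically_star_reduced r (substitute T)).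
Local Notation Rs := (sym_closure r).
Local Notation phi := (natural_map r).

Let phiM : forall g h, phi (g * h) = phi g * phi h := natural_mapM r.
Let phiR := @natural_map_relator X r.
Let RsP : small_cancellation_relators Rs := left_small rs_reduced rs_C16.

Lemma generated_dehn_core V : generated t V -> V <> 1 ->
  exists d v, [/\ v <> [::], cyclically_reduced v, V = d * fg v * d^-1 &
    forall k, dehn_reduced Rs (rot k v)].
Proof.
case/generatedP=> T tT -> V1.
pose T' := fword (fg T).
have eT : fg (substitute T) = fg (substitute T').
  by apply: fg_substitute_eq; rewrite fg_fword.
have T'0 : T' <> [::] by move=> e; apply: V1; rewrite eT e.
rewrite eT; apply: dehn_core; apply: t_reduced => //; last exact: fwordP.
by move=> a /mem_free_reduction/tT.
Qed.

(** If U or V is trivial then so is the other, because their cyclic cores are Dehn reduced.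
    Otherwise the equation gives an annular diagram with boundary words u and v^-1. *)
Theorem conjugacy_lifts U V g : generated s U -> generated t V ->
  (phi g)^-1 * phi U * phi g = phi V -> exists W, phi W = phi g /\ W^-1 * U * W = V.
Proof.
move=> sU tV; have <- : phi g^-1 = (phi g)^-1 := natural_mapV r g => eUV.
have phi1 : phi 1 = 1 by [].
have kconj a x : phi (a * x * a^-1) = 1 -> phi x = 1.
  move=> e; have -> : x = a^-1 * (a * x * a^-1) * a by rewrite !mulgA mulVg mul1g mulgVK.
  by rewrite phiM (phiM a^-1) e mulg1 -phiM mulVg.
have [U1|U1] := pselect (U = 1); have [V1|V1] := pselect (V = 1).
- by exists g; rewrite U1 V1 mulg1 mulVg.
- have [d [v [v0 crv eV dv]]] := generated_dehn_core tV V1.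
  case: (@dehn_nontrivial X r RsP v) => //; first by have := dv 0%N; rewrite rot0.
  by apply: (kconj d); rewrite -eV -eUV U1 phi1 mulg1 -phiM mulVg.
- have [c [u [wA [wB [N [cru u0 eU third _]]]]]] := generated_core rs_reduced rs_disjoint rs_irredundant rs_C16 sU U1.
  case: (@dehn_nontrivial X r RsP u) => //.
    split; first exact: cr_reduced.
    by move=> y w yu Rw yw; have := third 0%N y w; rewrite rot0 => /(_ yu Rw yw); move: (size _) (size _); clear; lia.
  apply: (kconj c); rewrite -eU; apply: (kconj g^-1).
  by rewrite invgK !phiM eUV V1.
have [d [v [v0 crv eV dv]]] := generated_dehn_core tV V1.
have [c [u [wA [wB [N [cru u0 eU third [eu N0 leN sixth]]]]]]] :=
  generated_core rs_reduced rs_disjoint rs_irredundant rs_C16 sU U1.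
have NV : normal_closure r (V^-1 * (g^-1 * U * g))^-1.
  have e : phi (g^-1 * U * g) = phi V by rewrite !phiM.
  by apply/natural_map_eq1; rewrite (invgM V^-1) invgK phiM -e -phiM mulVg.
have [D rD eD] := normal_closureP NV.
have v'0 : winv v <> [::] by move=> e; apply: v0; rewrite -(winvK v) e.
have crv' : cyclically_reduced (winv v) by rewrite cr_winv.
have dv' k : dehn_reduced Rs (rot k (winv v)).
  have [j ej] := winv_rot k (winv v); rewrite winvK in ej.
  by rewrite -(winvK (rot k _)) ej; apply: dehn_reduced_winv (dv j).
have psiv : phi (fg (winv v)) <> 1.
  by apply: dehn_nontrivial => //; have := dv' 0%N; rewrite rot0.
have eu0 : rot 0 u = wA ++ wB by rewrite rot0.
have D1 : face_prod [:: (d, winv v), (g^-1 * c, u) & D] = 1.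
  have ev : d * fg (winv v) * d^-1 = V^-1 by rewrite fg_winv eV !invgM invgK mulgA.
  have eu' : g^-1 * c * fg u * (g^-1 * c)^-1 = g^-1 * U * g by rewrite eU invgM invgK !mulgA.
  by rewrite /face_prod /= -/(face_prod D) eD ev eu' mulgA mulgV.
have [h h1 h2] := annulus_conjugacy RsP phiM phiR v'0 u0 crv' cru dv' psiv third eu0 N0 leN sixth rD D1.
exists (c * h^-1 * d^-1); split.
  rewrite !phiM (homV phiM h) h1 -(homV phiM) -!phiM; congr phi.
  by rewrite !invgM !invgK !mulgA mulgV mul1g mulgK.
have e : h * fg u * h^-1 = fg v.
  by apply: (mulgI (fg (winv v))); rewrite h2 fg_winv mulVg.
by rewrite eV -e eU !invgM !invgK !mulgA mulgVK mulgVK.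
Qed.
End Conjugacy.

Theorem theorem6p6 (X : countType) (r s t : set (free_group X))
    (rs_reduced : nontrivial_cyclically_reduced (r `|` s))
    (rs_disjoint : r `&` s = set0)
    (rs_irredundant : irredundant (r `|` s))
    (rs_C16 : metric_small_cancellation (1 / 6)%R (r `|` s))
    (t_reduced : forall T : word (free_group X),
       (forall a, a \in T -> t a.1) -> T <> [::] -> reduced T ->
       cyclically_star_reduced r (substitute T)) :
  (forall U V : free_group X, generated s U -> generated t V ->
     forall g : presented_group r, g^-1 * natural_map r U * g = natural_map r V ->
     exists W : free_group X, natural_map r W = g /\ W^-1 * U * W = V) /\
  ((exists g : presented_group r,
      conjugate_set (natural_map r @` generated s) g `&` (natural_map r @` generated t)
        <> [set 1]) <->
   (exists W : free_group X,
      conjugate_set (generated s) W `&` generated t <> [set 1])).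
Proof.
have lift U V (g : presented_group r) : generated s U -> generated t V ->
    g^-1 * natural_map r U * g = natural_map r V ->
  exists W, natural_map r W = g /\ W^-1 * U * W = V.
  move=> sU tV; have [g0 <-] := natural_map_surj g.
  exact: (conjugacy_lifts rs_reduced rs_disjoint rs_irredundant rs_C16 t_reduced sU tV).
split=> [U V sU tV g|]; first exact: lift.
split=> [[g]|[W]] /subset1_neq[].
- split; last by exists 1 => //; exact: generated1.
  by exists 1; [exists 1 => //; exact: generated1|exact: conj1g].
- move=> _ [[_ [U sU <-] <-] [V tV eV]] h1.
  have [|W [_ eW]] := lift U V g sU tV; first by rewrite eV /conjg mulgA.
  exists W => e; apply: h1; suff V1 : V = 1 by rewrite -eV V1.
  suff : [set 1] V by [].
  by rewrite -e; split=> //; exists U => //; rewrite /conjg mulgA.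
- split; last exact: generated1.
  by exists 1; [exact: generated1|exact: conj1g].
move=> V [[U sU eV] tV] V1.
exists (natural_map r W) => e; have [||W' [_]] := lift 1 V 1 _ tV.
- exact: generated1.
- suff : [set 1] (natural_map r V) by move=> /= ->; rewrite invg1 !mul1g.
  rewrite -e; split; last by exists V.
  exists (natural_map r U); first by exists U.
  have eW : natural_map r W^-1 = (natural_map r W)^-1 := natural_mapV r W.
  by rewrite -eV /conjg -eW !(natural_mapM r).
by rewrite mulg1 mulVg => /esym.
Qed.
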